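(* Let $1\le p<\infty$ and let $\psi(z)=az+b$ ($a,b\in\mathbb{C}$) be a nonconstant map on $\mathbb{C}$ that induces a bounded composition operator $C_\psi$ on $\mathcal{F}_\varphi^p$. Then: (i) $C_\psi$ is cyclic on $\mathcal{F}_\varphi^p$ if and only if $a^n\neq a$ for all integers $n>1$. Furthermore, in this case, a function $h\in\mathcal{F}_\varphi^p$ with Taylor series expansion $$h(z)=\sum_{n=0}^\infty a_n\Big(z-\frac{b}{1-a}\Big)^n$$ is cyclic for $C_\psi$ if and only if $a_n\neq 0$ for all $n\in\mathbb{Z}_+:=\{0,1,2,3,\dots\}$. (ii) $C_\psi$ cannot be supercyclic on $\mathcal{F}_\varphi^p$.
   Context: Weight: $\varphi:[0,\infty)\to[0,\infty)$ is a twice continuously differentiable function, extended to $\mathbb{C}$ by $\varphi(z)=\varphi(|z|)$, with Laplacian $\Delta\varphi>0$. It is assumed that there is a positive radial differentiable function $\tau$ on $\mathbb{C}$ with $\tau(z)\simeq(\Delta\varphi(z))^{-1/2}$ for $|z|\ge 1$ and $\tau(z)\simeq 1$ for $0\le|z|<1$, satisfying $\lim_{r\to\infty}\tau(r)=0$ and $\lim_{r\to\infty}\tau'(r)=0$, and such that either there exists a constant $C>0$ for which $\tau(r)r^C$ increases for large $r$, or $\lim_{r\to\infty}\tau'(r)\log\frac{1}{\tau(r)}=0$. Here $U\simeq V$ means that $U\le cV$ and $V\le cU$ on the set in question for some constant $c>0$. Spaces: $\mathcal{F}_\varphi^p$ is the space of entire functions $f$ with $\|f\|_p^p=\int_{\mathbb{C}}|f(z)|^pe^{-p\varphi(z)}\,dA(z)<\infty$,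 where $dA$ is Lebesgue area measure on $\mathbb{C}$. Operators: $C_\psi f=f\circ\psi$. A bounded linear operator $T$ on a Banach space $\mathcal{H}$ is cyclic if there is a vector $x\in\mathcal{H}$ (called a cyclic vector for $T$) such that the linear span of $\{T^nx:n=0,1,2,\dots\}$ is dense in $\mathcal{H}$; it is supercyclic if there is $x\in\mathcal{H}$ such that the projective orbit $\{\lambda T^nx:\lambda\in\mathbb{C},\ n=0,1,2,\dots\}$ is dense in $\mathcal{H}$. *)

(* Defs.v *)
From HB Require Import structures.
From mathcomp Require Export all_boot all_order all_algebra.
From mathcomp Require Export all_classical all_reals all_analysis.
From mathcomp Require Export complex.

Set Implicit Arguments.
Unset Strict Implicit.
Unset Printing Implicit Defensive.

Export Order.TTheory GRing.Theory Num.Theory.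
Export numFieldNormedType.Exports.

#[export] Set Implicit Arguments.
#[export] Unset Strict Implicit.
#[export] Unset Printing Implicit Defensive.

Global Open Scope classical_set_scope.
Global Open Scope ring_scope.
Global Open Scope complex_scope.

(* A space is given by its carrier [H] inside an ambient module [V] and by an
   extended-real norm [N] on [V] that is finite on [H]. *)
Section LinearDynamics.
Context {R : realType} {V : lmodType R[i]}.
Implicit Types (H S : set V) (N : V -> \bar R) (T : V -> V) (x : V).

Definition linear_span S : set V :=
  [set y | exists n (c : 'I_n -> R[i]) (v : 'I_n -> V),
     (forall i, S (v i)) /\ y = \sum_(i < n) c i *: v i].

Definition orbit_of T x : set V := range (fun n => iter n T x).

Definition projective_orbit T x : set V :=
  [set y | exists (l : R[i]) (n : nat), y = l *: iter n T x].

Definition norm_dense H N S : Prop :=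
  forall y (e : R), H y -> 0 < e -> exists2 s, (H `&` S) s & (N (y - s)%R < e%:E)%E.

Definition bounded_on H N T : Prop :=
  (forall x, H x -> H (T x)) /\
  exists M : R, forall x, H x -> (N (T x) <= M%:E * N x)%E.

Definition cyclic_vector H N T x : Prop :=
  H x /\ norm_dense H N (linear_span (orbit_of T x)).

Definition is_cyclic H N T : Prop := exists x, cyclic_vector H N T x.

Definition supercyclic_vector H N T x : Prop :=
  H x /\ norm_dense H N (projective_orbit T x).

Definition is_supercyclic H N T : Prop := exists x, supercyclic_vector H N T x.

End LinearDynamics.

Section Plane.
Context {R : realType}.
Local Notation C := R[i].
Local Notation modulus := (@Normc.normc R).

(* A function on the complex plane seen as a function of two real variables. *)
Definition on_R2 {T : Type} (u : C -> T) : R * R -> T := fun q => u (q.1 +i* q.2).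

Definition radial_ext (f : R -> R) : C -> R := fun z => f (modulus z).

Definition laplacian (u : C -> R) (z : C) : R :=
  let U := on_R2 u in
  'D_((1, 0) : R * R) ('D_((1, 0) : R * R) U) (complex.Re z, complex.Im z) +
  'D_((0, 1) : R * R) ('D_((0, 1) : R * R) U) (complex.Re z, complex.Im z).

(* [l] is the derivative at [x] of the restriction of [f] to [0, +oo[
   (one-sided at the origin). *)
Definition deriv_on_nonneg (f : R -> R) (x l : R) : Prop :=
  (fun y => (f y - f x) / (y - x)) @ within `[0, +oo[ x^' --> l.

Definition C2_on_nonneg (f : R -> R) : Prop :=
  exists f1 f2 : R -> R,
    [/\ forall x, 0 <= x -> deriv_on_nonneg f x (f1 x),
        forall x, 0 <= x -> deriv_on_nonneg f1 x (f2 x) &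
        {within `[0, +oo[, continuous f2}].

Definition comparable_on (A : set C) (U W : C -> R) : Prop :=
  exists2 c : R, 0 < c & forall z, A z -> U z <= c * W z /\ W z <= c * U z.

(* "Increases" is read in the weak sense; the strict reading is equivalent,
   since C may be replaced by C + 1. *)
Definition power_increasing (t : R -> R) : Prop :=
  exists2 c : R, 0 < c & exists2 r0 : R, 0 < r0 &
    {in >= r0 &, {homo (fun r => t r * r `^ c) : r s / r <= s}}.

Record weight_scale (phi : R -> R) (tau : C -> R) : Prop := {
  scale_gt0 : forall z, 0 < tau z;
  scale_radial : forall z w, modulus z = modulus w -> tau z = tau w;
  (* differentiability is real differentiability in the plane *)
  scale_diff : forall q : R * R, differentiable (on_R2 tau) q;
  scale_far : comparable_on [set z | 1 <= modulus z] tau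
                (fun z => laplacian (radial_ext phi) z `^ (- 2^-1));
  scale_near : comparable_on [set z | modulus z < 1] tau (fun=> 1);
  scale_lim : tau r%:C @[r --> +oo] --> (0 : R);
  scale_deriv_lim : derive1 (fun r : R => tau r%:C) r @[r --> +oo] --> (0 : R);
  scale_growth :
    power_increasing (fun r => tau r%:C) \/
    derive1 (fun r : R => tau r%:C) r * ln (1 / tau r%:C) @[r --> +oo] --> (0 : R)
}.

(* At the origin the radial extension of a C^2 function on [0, +oo[ need not be
   differentiable (e.g. phi r = expR r), and its Laplacian vanishes there for
   the model weights phi r = r ^+ m with m > 2; positivity is required where
   the extension is C^2, that is, off the origin. *)
Record weight (phi : R -> R) : Prop := {
  weight_ge0 : forall r, 0 <= r -> 0 <= phi r;
  weight_C2 : C2_on_nonneg phi;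
  weight_laplacian : forall z, z != 0 -> 0 < laplacian (radial_ext phi) z;
  weight_has_scale : exists tau, weight_scale phi tau
}.

Definition entire (f : C -> C^o) : Prop :=
  forall z : C^o, derivable (f : C^o -> C^o) z 1.

Definition fock_integral (phi : R -> R) (p : R) (f : C -> C^o) : \bar R :=
  (\int[(@lebesgue_measure R \x @lebesgue_measure R)]_q
     (on_R2 (fun z => modulus (f z) `^ p * expR (- p * radial_ext phi z)) q)%:E)%E.

Definition fock_norm (phi : R -> R) (p : R) (f : C -> C^o) : \bar R :=
  (fock_integral phi p f `^ p^-1)%E.

Definition fock_space (phi : R -> R) (p : R) : set (C -> C^o) :=
  [set f | entire f /\ (fock_integral phi p f < +oo)%E].

Definition affine_map (a b : C) : C -> C := fun z => a * z + b.

Definition composition_operator (psi : C -> C) (f : C -> C^o) : C -> C^o :=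
  f \o psi.

Definition taylor_expansion (h : C -> C^o) (c : C) (u : nat -> C) : Prop :=
  forall z, (series (fun n => u n * (z - c) ^+ n) : nat -> C^o) @ \oo --> h z.

End Plane.

(* Main.v *)
(** Let [z0 = b / (1 - a)], a fixed point of [psi]. On Taylor coefficients at [z0] the
operator [T = C_psi] acts diagonally, [u n |-> a ^+ n * u n], and each coefficient is a
continuous functional on the space. So a cyclic vector has no zero coefficient; if
[a ^+ m = 1] the functional [u m * coef 0 - u 0 * coef m] kills the orbit of a vector with
coefficients [u]; and since [mod a <= 1] the quotient of the coefficients of index 1 and 0
is bounded along a projective orbit, which excludes supercyclicity.

Boundedness gives [mod a <= 1], and [b = 0] when [mod a = 1], by comparing the norm of
[(a z + b) ^+ n] with those of its monomials.

Conversely let all [u n] be nonzero. If [mod a < 1], then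
[a ^- (k m) * (T ^ k h - sum_(n < m) a ^+ (k n) * u n * (z - z0) ^+ n)] tends to
[u m * (z - z0) ^+ m], so all powers lie in the closed span of the orbit. If [mod a = 1],
then [T] is an isometric rotation and the averages of [a ^- (k m) * T ^ k h] over [k < n]
tend to [u m * z ^+ m]. Polynomials are dense.

The estimates come from [r phi'(r)], whose derivative [r * laplacian phi] outgrows every
multiple of [r]: [phi] grows faster than any quadratic polynomial, and
[phi (rho r + c) <= phi r - B r ^ 2 + O(1)] for all [rho < 1], [c] and [B]. Combined with the
coefficient bound [mod (u n) * s ^+ n <= K * exp (phi (s + mod c + 1))], this controls any
series whose coefficients are dominated by [rho ^+ n * mod (u n)]. *)

Require Import Defs.
From mathcomp Require Import cyclic separable cyclotomic.
From mathcomp Require Import ring lra measurable_realfun.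
Import ComplexField.

(** * Complex modulus and derivatives *)

(** [entire] asserts complex differentiability at each point and nothing more, while every argument
    runs on Taylor coefficients at an arbitrary centre; hence the passage through Goursat's lemma,
    and the uniqueness of coefficients to compare discs.

    The link between norm and coefficients is a projection onto one coefficient by averaging over
    rotations, which does not increase the integral of [mod f ^ p * w] for any rotation-invariant
    [w >= 0]. It is used with the indicator of an annulus, for bounds at any centre, and with
    [exp (- p phi)], for the comparison with monomials.

    Estimates are made on the [p]-th power of the norm: convexity gives
    [I (f + g) <= 2 ^ p * (I f + I g)], whence tolerances of the form [e / 2 / 2 ^ p]. Domination of
    coefficients needs a factor [rho ^ n] with [rho < 1]; where the operator does not supply it, a
    dilation [f (r z)] does.

    When [a = 1], the expression [b / (1 - a)] is 0 by the convention on division, and boundedness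
    forces [b = 0], so it still names a fixed point. *)

Section Modulus.
Context {R : realType}.
Local Notation C := R[i].
Local Notation mod := (@Normc.normc R).

Lemma normE (z : C) : `|z| = (mod z)%:C. Proof. by []. Qed.

Lemma modM (x y : C) : mod (x * y) = mod x * mod y. Proof. exact: Normc.normcM. Qed.
Lemma mod_ge0 (x : C) : 0 <= mod x.
Proof. by case: x => x y; exact: sqrtr_ge0. Qed.
Lemma modN (x : C) : mod (- x) = mod x. Proof. exact: normcN. Qed.
Lemma modD (x y : C) : mod (x + y) <= mod x + mod y. Proof. exact: le_normcD. Qed.
Lemma modB (x y : C) : mod (x - y) <= mod x + mod y.
Proof. by rewrite -(modN y) modD. Qed.
Lemma mod0 : mod 0 = 0. Proof. exact: Normc.normc0. Qed.
Lemma mod1 : mod 1 = 1. Proof. exact: Normc.normc1. Qed.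
Lemma modV (x : C) : mod x^-1 = (mod x)^-1. Proof. exact: Normc.normcV. Qed.
Lemma modX (x : C) n : mod (x ^+ n) = mod x ^+ n.
Proof. by elim: n => [|n IH]; rewrite ?expr0 ?mod1// !exprS modM IH. Qed.
Lemma mod_eq0 (x : C) : (mod x == 0) = (x == 0).
Proof. by apply/eqP/eqP => [/Normc.eq0_normc|->]//; exact: mod0. Qed.
Lemma mod_gt0 (x : C) : (0 < mod x) = (x != 0).
Proof. by rewrite lt_def mod_ge0 andbT mod_eq0. Qed.
Lemma mod_real (x : R) : mod x%:C = `|x|.
Proof. by rewrite /= expr0n addr0 sqrtr_sqr. Qed.
Lemma mod_Re (x : C) : `|complex.Re x| <= mod x.
Proof. by case: x => x y /=; rewrite -sqrtr_sqr ler_wsqrtr// lerDl sqr_ge0. Qed.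
Lemma mod_Im (x : C) : `|complex.Im x| <= mod x.
Proof. by case: x => x y /=; rewrite -sqrtr_sqr ler_wsqrtr// lerDr sqr_ge0. Qed.
Lemma modBC (x y : C) : mod (x - y) = mod (y - x).
Proof. by rewrite -modN opprB. Qed.
Lemma mod_le_ReIm (x : C) : mod x <= `|complex.Re x| + `|complex.Im x|.
Proof.
case: x => x y /=; rewrite -[leRHS]ger0_norm ?addr_ge0// -[leRHS]sqrtr_sqr ler_wsqrtr//.
by rewrite sqrrD -!normrX ger0_norm ?sqr_ge0// [`|y ^+ 2|]ger0_norm ?sqr_ge0// addrAC lerDl mulrn_wge0// mulr_ge0.
Qed.
Lemma mod_sum (I : Type) (s : seq I) (P : pred I) (F : I -> C) :
  mod (\sum_(i <- s | P i) F i) <= \sum_(i <- s | P i) mod (F i).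
Proof.
elim/big_ind2 : _ => //; first by rewrite mod0.
by move=> x x' y y' h1 h2; apply: (le_trans (modD _ _)); exact: lerD.
Qed.
Lemma mod_dist (x y : C) : mod x - mod y <= mod (x - y).
Proof. by rewrite lerBlDr (le_trans _ (modD _ _))// subrK. Qed.

(* The library norm of [R[i]] is [R[i]]-valued; derivatives and limits are restated with the
   [R]-valued modulus. *)
Definition cderiv (f : C -> C) (z l : C) := forall e : R, 0 < e ->
  exists2 d : R, 0 < d & forall h, mod h < d -> mod (f (z + h) - f z - l * h) <= e * mod h.

Lemma cvg_eps (T : Type) (F : set_system T) (FF : Filter F) (g : T -> C^o) (l : C) :
  g @ F --> (l : C^o) <-> forall e : R, 0 < e -> \forall t \near F, mod (g t - l) <= e.
Proof.
split=> [/cvgrPdist_le h e e0|h].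
  have := h e%:C; rewrite ltcR => /(_ e0); apply: filterS => t.
  by rewrite normE lecR modBC.
(* In [R[i]], [0 < e] forces the imaginary part of [e] to vanish, so a real tolerance suffices. *)
apply/cvgrPdist_le => e; rewrite ltcE/= => /andP[/eqP e1 e0].
have := h _ e0; apply: filterS => t.
by rewrite normE lecE/= modBC => ->; rewrite e1 eqxx.
Qed.

Lemma cvg_cderiv (f : C -> C^o) (z l : C) : cderiv f z l <->
  (fun h => h^-1 *: (f (h *: (1 : C^o) + z) - f z)) @ (0 : C^o)^' --> (l : C^o).
Proof.
split=> [H|/cvg_eps H e e0]; last first.
  have := H e e0; rewrite near_withinE => /nbhs_ballP[d /=].
  rewrite ltcE/= => /andP[/eqP d1 d0] Hd; exists (complex.Re d) => // h hd.
  have [->|h0] := eqVneq h 0; first by rewrite addr0 subrr mulr0 subr0 mod0 mulr0.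
  have : mod (h^-1 * (f (h * 1 + z) - f z) - l) <= e.
    apply: Hd => //=; change (`|0 - h| < d); rewrite sub0r normrN normE ltcE/=.
    by rewrite d1 eqxx.
  rewrite -(ler_pM2r (x:=mod h)) ?mod_gt0// -modM mulrBl mulrAC mulVf// mul1r mulr1.
  by rewrite (addrC h).
apply/cvg_eps => e e0; have [d d0 Hd] := H e e0.
rewrite near_withinE; apply/nbhs_ballP; exists d%:C => /=; first by rewrite ltcR.
move=> h hd h0; have {}hd : mod h < d.
  by move: hd; change (`|0 - h| < d%:C -> mod h < d); rewrite sub0r normrN normE ltcR.
rewrite -(ler_pM2r (x:=mod h)) ?mod_gt0// -modM mulrBl; apply: le_trans (Hd h hd).
have -> : h^-1 *: (f (h%:A + z) - f z) * h = f (z + h) - f z.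
  by rewrite /GRing.scale/= mulrAC mulVf// mul1r mulr1 (addrC h).
exact: lexx.
Qed.

Lemma is_derive_cderiv (f : C -> C^o) (z l : C) :
  is_derive (z : C^o) (1 : C^o) (f : C^o -> C^o) l <-> cderiv f z l.
Proof.
split=> [[df <-]|]; first exact/cvg_cderiv.
by move=> /cvg_cderiv H; split; [apply/cvg_ex; exists l|exact/cvg_lim].
Qed.

Lemma derivable_cderiv (f : C -> C^o) (z : C) :
  derivable (f : C^o -> C^o) z 1 <-> exists l, cderiv f z l.
Proof.
split=> [/cvg_ex[/= l /cvg_cderiv H]|[l /is_derive_cderiv[]//]].
by exists l.
Qed.

End Modulus.

(** * Primitives of continuous functions of a real variable *)

Section RealPrimitive.
Context {R : realType}.
Local Notation C := R[i].
Local Notation mod := (@Normc.normc R).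
Implicit Types f : R -> R.

(** The same first-order error bound as [cderiv], also the shape of [rderiv] below, so that real,
    mixed and complex derivatives combine by direct estimates. *)
Definition rd (f : R -> R) (t l : R) := forall e : R, 0 < e ->
  exists2 d : R, 0 < d & forall h, `|h| < d -> `|f (t + h) - f t - l * h| <= e * `|h|.

Lemma is_derive_rd f (t l : R) : is_derive t (1:R) f l <-> rd f t l.
Proof.
split=> [[df dl] e e0|H].
  have : (fun h => h^-1 *: (f (h *: 1 + t) - f t)) @ 0^' --> l by rewrite -dl; exact: df.
  move=> /cvgrPdist_le/(_ e e0); rewrite near_withinE => /nbhs_ballP[d /= d0 Hd].
  exists d => // h hd.
  have [->|h0] := eqVneq h 0; first by rewrite addr0 subrr mulr0 subr0 normr0 mulr0.
  have : `|l - h^-1 * (f (h * 1 + t) - f t)| <= e.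
    by apply: Hd => //; change (`|0 - h| < d); rewrite sub0r normrN.
  rewrite -(ler_pM2r (x:=`|h|)) ?normr_gt0// -normrM mulrBl mulrAC mulVf// mul1r mulr1.
  by rewrite (addrC h) distrC.
suff : (fun h => h^-1 *: (f (h *: 1 + t) - f t)) @ 0^' --> l.
  by move=> cf; split; [apply/cvg_ex; exists l|apply/cvg_lim].
apply/cvgrPdist_le => e e0; have [d d0 Hd] := H e e0.
rewrite near_withinE; apply/nbhs_ballP; exists d => // h hd0 h0.
have hd : `|h| < d by move: hd0; change (`|0 - h| < d -> `|h| < d); rewrite sub0r normrN.
rewrite distrC -(ler_pM2r (x:=`|h|)) ?normr_gt0// -normrM mulrBl; apply: le_trans (Hd h hd).
have -> : h^-1 *: (f (h%:A + t) - f t) * h = f (t + h) - f t.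
  by rewrite /GRing.scale/= mulrAC mulVf// mul1r mulr1 (addrC h).
exact: lexx.
Qed.

Lemma rd_continuous f (t l : R) : rd f t l -> {for t, continuous f}.
Proof.
move=> /is_derive_rd[df _]; apply: differentiable_continuous.
exact/derivable1_diffP.
Qed.

Lemma MVT_rd f g (a b : R) : a <= b -> (forall t, a <= t <= b -> rd f t (g t)) ->
  exists2 c, a <= c <= b & f b - f a = g c * (b - a).
Proof.
move=> ab H; have [] := @MVT_segment R f g a b ab.
- move=> x; rewrite in_itv/= => /andP[ax xb]; apply/is_derive_rd/H.
  by rewrite !ltW.
- apply/continuous_in_subspaceT => x; rewrite inE/= in_itv/= => xab.
  by apply: rd_continuous (H x xab).
- by move=> c; rewrite in_itv/= => cab ->; exists c.
Qed.

(** The integral from [- n] has derivative [f] inside the window by the fundamental theorem of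
    calculus; the normalisation [G 0 = 0] is what allows windows to be glued. *)
Lemma real_primitive_window f (n : R) : 0 < n -> continuous f ->
  exists2 G, G 0 = 0 & forall t, - n < t < n -> rd G t (f t).
Proof.
move=> n0 cf.
pose F x := (\int[@lebesgue_measure R]_(t in [set` `[- n, x]]) (f t))%R.
exists (fun x => F x - F 0); first by rewrite subrr.
move=> t /andP[nt tn]; apply/is_derive_rd.
have [|dF Fd] := @continuous_FTC1_closed R f (- n) t n tn _ nt (cf t).
  apply: continuous_compact_integrable; first exact: segment_compact.
  by apply: continuous_subspaceT.
have dF' : is_derive t (1:R) F (f t).
  by rewrite -Fd derive1E; split.
by have := is_deriveB dF' (is_derive_cst (F 0) t (1:R)); rewrite subr0.
Qed.

Lemma rd_ext f g (t l d : R) : 0 < d -> (forall s, `|s - t| < d -> f s = g s) ->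
  rd f t l -> rd g t l.
Proof.
move=> d0 E H e e0; have [d' d'0 H'] := H e e0.
exists (Num.min d d'); first by rewrite lt_min d0.
move=> h; rewrite lt_min => /andP[hd hd']; rewrite -!E ?H'//.
  by rewrite subrr normr0.
by rewrite addrC addKr.
Qed.

Lemma rdB f g (t k l : R) : rd f t k -> rd g t l -> rd (fun x => f x - g x) t (k - l).
Proof. by move=> /is_derive_rd H /is_derive_rd H'; apply/is_derive_rd; exact: is_deriveB. Qed.

Lemma rd_eq f g h (a b : R) : a <= b ->
  (forall t, a <= t <= b -> rd f t (h t)) -> (forall t, a <= t <= b -> rd g t (h t)) ->
  f b - f a = g b - g a.
Proof.
move=> ab Hf Hg.
have [t tab|c _] := @MVT_rd (fun x => f x - g x) (fun x => h x - h x) a b ab.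
  by apply: rdB; [apply: Hf|apply: Hg].
by rewrite subrr mul0r; lra.
Qed.

Lemma real_primitive f : continuous f -> exists G, forall t, rd G t (f t).
Proof.
move=> cf.
have /(_ _)/cid2-/all_sig2[G G0 GP] : forall n : nat, exists2 G, G 0 = 0 &
    forall t, - n.+1%:R < t < n.+1%:R -> rd G t (f t).
  by move=> n; apply: real_primitive_window.
have agree : forall m n x, `|x| < m.+1%:R -> `|x| < n.+1%:R -> G m x = G n x.
  move=> m n x; rewrite !ltr_norml => /andP[xm1 xm2] /andP[xn1 xn2].
  have [x0|x0] := leP 0 x.
    suff : G m x - G m 0 = G n x - G n 0 by rewrite !G0 !subr0.
    by apply: (@rd_eq _ _ f) => // t /andP[t0 tx]; apply: GP; lra.
  suff : G m 0 - G m x = G n 0 - G n x by rewrite !G0 !sub0r => /oppr_inj.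
  by apply: (@rd_eq _ _ f) (ltW x0) _ _ => t /andP[t0 tx]; apply: GP; lra.
have H (x : R) : `|x| < (Num.truncn `|x|).+1%:R by exact: truncnS_gt.
exists (fun x => G (Num.truncn `|x|) x) => t.
(* One index more than [t] itself requires: the window then contains the unit neighbourhood of
   [t]. *)
pose n := (Num.truncn `|t|).+1.
apply: (@rd_ext (G n) _ _ _ 1) => //.
  move=> s st; apply: agree => //.
  have : `|s| <= `|s - t| + `|t| by rewrite -{1}(subrK t s) ler_normD.
  have := H t; rewrite /n (natrD _ 1 (Num.truncn `|t|).+1); lra.
apply: GP; rewrite -ltr_norml; apply: lt_trans (H t) _.
by rewrite ltr_nat /n.
Qed.

Definition rderiv (G : R -> C) (t : R) (l : C) := forall e : R, 0 < e ->
  exists2 d : R, 0 < d & forall h, `|h| < d ->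
    mod (G (t + h) - G t - l * h%:C) <= e * `|h|.

Definition rcont (g : R -> C) := forall t (e : R), 0 < e ->
  exists2 d : R, 0 < d & forall s, `|s - t| < d -> mod (g s - g t) <= e.

Lemma rderivP G t l : rderiv G t l <->
  rd (fun x => complex.Re (G x)) t (complex.Re l) /\
  rd (fun x => complex.Im (G x)) t (complex.Im l).
Proof.
split=> [H|[H1 H2] e e0].
  split=> e e0; have [d d0 Hd] := H e e0; exists d => // h hd;
    apply: le_trans (Hd h hd).
  - by apply: le_trans (mod_Re _); case: (G _) => ? ?; case: (G _) => ? ?; case: l {H Hd} => ? ? /=; rewrite mulr0 subr0.
  - by apply: le_trans (mod_Im _); case: (G _) => ? ?; case: (G _) => ? ?; case: l {H Hd} => ? ? /=; rewrite mulr0 add0r.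
have e20 : 0 < e / 2 by rewrite divr_gt0.
have [d1 d10 Hd1] := H1 _ e20; have [d2 d20 Hd2] := H2 _ e20.
exists (Num.min d1 d2); first by rewrite lt_min d10.
move=> h; rewrite lt_min => /andP[/Hd1 h1 /Hd2 h2].
apply: le_trans (mod_le_ReIm _) _.
apply: le_trans (_ : e / 2 * `|h| + e / 2 * `|h| <= _); last by lra.
apply: lerD.
- apply: le_trans h1; case: (G _) => ? ?; case: (G _) => ? ?; case: (l) => ? ? /=.
  by rewrite mulr0 subr0.
- apply: le_trans h2; case: (G _) => ? ?; case: (G _) => ? ?; case: (l) => ? ? /=.
  by rewrite mulr0 add0r.
Qed.

Lemma rcont_ReIm g : rcont g ->
  continuous (fun t => complex.Re (g t)) /\ continuous (fun t => complex.Im (g t)).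
Proof.
move=> cg; split=> t; apply/cvgrPdist_le => e e0; have [d d0 Hd] := cg t e e0;
  apply/nbhs_ballP; exists d => //= s; rewrite /ball/= distrC => /Hd h;
  rewrite distrC; apply: le_trans h.
- by apply: le_trans (mod_Re _); case: (g s) (g t) => ? ? [].
- by apply: le_trans (mod_Im _); case: (g s) (g t) => ? ? [].
Qed.

Lemma complex_primitive g : rcont g -> exists G, forall t, rderiv G t (g t).
Proof.
move=> /rcont_ReIm[/real_primitive[G1 H1] /real_primitive[G2 H2]].
by exists (fun t => G1 t +i* G2 t) => t; apply/rderivP; split => /=.
Qed.

(* The factor 2: the mean value theorem is applied to the real and imaginary parts. *)
Lemma rderiv_bound G g (M a b : R) :
  (forall t, rderiv G t (g t)) ->
  (forall s, 0 <= s <= 1 -> mod (g (a + s * (b - a))) <= M) ->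
  mod (G b - G a) <= 2 * M * `|b - a|.
Proof.
wlog ab : a b / a <= b.
  move=> W dG HM; have [ab|/ltW ba] := leP a b; first exact: W.
  rewrite modBC distrC; apply: W => // s /andP[s0 s1].
  have -> : b + s * (a - b) = a + (1 - s) * (b - a) by ring.
  by apply: HM; lra.
move=> dG HM.
have HM' t : a <= t <= b -> mod (g t) <= M.
  move=> /andP[at_ tb]; have [eab|nab] := eqVneq a b.
    have -> : t = a + 0 * (b - a) by lra.
    by apply: HM; rewrite lexx ler01.
  have lab : 0 < b - a by rewrite subr_gt0 lt_def eq_sym nab.
  have -> : t = a + (t - a) / (b - a) * (b - a) by field; rewrite gt_eqF.
  by apply: HM; rewrite divr_ge0 ?subr_ge0//= ler_pdivrMr// mul1r; lra.
have M0 : 0 <= M by apply: le_trans (HM' a _); rewrite ?mod_ge0// lexx ab.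
apply: le_trans (mod_le_ReIm _) _.
have [t _|c1 /HM' c1ab E1] := @MVT_rd (fun x => complex.Re (G x)) (fun x => complex.Re (g x)) a b ab.
  by have /rderivP[] := dG t.
have [t _|c2 /HM' c2ab E2] := @MVT_rd (fun x => complex.Im (G x)) (fun x => complex.Im (g x)) a b ab.
  by have /rderivP[] := dG t.
have -> : complex.Re (G b - G a) = complex.Re (G b) - complex.Re (G a).
  by case: (G b) (G a) => ? ? [].
have -> : complex.Im (G b - G a) = complex.Im (G b) - complex.Im (G a).
  by case: (G b) (G a) => ? ? [].
rewrite E1 E2 !normrM -mulrDl ler_wpM2r//.
have := mod_Re (g c1); have := mod_Im (g c2); lra.
Qed.

End RealPrimitive.

(** * Goursat's lemma *)

Section Goursat.
Context {R : realType}.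
Local Notation C := R[i].
Local Notation mod := (@Normc.normc R).

Lemma rderivD (F G : R -> C) t k l : rderiv F t k -> rderiv G t l ->
  rderiv (fun x => F x + G x) t (k + l).
Proof.
move=> HF HG e e0; have e20 : 0 < e / 2 by rewrite divr_gt0.
have [d1 d10 Hd1] := HF _ e20; have [d2 d20 Hd2] := HG _ e20.
exists (Num.min d1 d2); first by rewrite lt_min d10.
move=> h; rewrite lt_min => /andP[/Hd1 h1 /Hd2 h2].
have -> : F (t + h) + G (t + h) - (F t + G t) - (k + l) * h%:C =
  (F (t + h) - F t - k * h%:C) + (G (t + h) - G t - l * h%:C) by ring.
by apply: le_trans (modD _ _) _; lra.
Qed.

Lemma rderivZ (F : R -> C) t k (c : C) : rderiv F t k ->
  rderiv (fun x => c * F x) t (c * k).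
Proof.
move=> HF e e0.
have e20 : 0 < e / (mod c + 1) by rewrite divr_gt0// ltr_wpDl// mod_ge0.
have [d1 d10 Hd1] := HF _ e20; exists d1 => // h /Hd1 h1.
have -> : c * F (t + h) - c * F t - c * k * h%:C = c * (F (t + h) - F t - k * h%:C) by ring.
rewrite modM; apply: le_trans (ler_wpM2l (mod_ge0 _) h1) _.
rewrite mulrA ler_wpM2r// mulrCA ler_piMr ?(ltW e0)//.
by rewrite ler_pdivrMr ?mul1r ?ltr_wpDl ?mod_ge0// lerDl.
Qed.

Lemma rderivN (F : R -> C) t k : rderiv F t k -> rderiv (fun x => - F x) t (- k).
Proof.
move=> /(@rderivZ _ _ _ (-1)); rewrite mulN1r.
by rewrite (_ : (fun x => -1 * F x) = (fun x => - F x))//; apply/funext => x; rewrite mulN1r.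
Qed.

Lemma rderivB (F G : R -> C) t k l : rderiv F t k -> rderiv G t l ->
  rderiv (fun x => F x - G x) t (k - l).
Proof. by move=> HF HG; apply: rderivD => //; exact: rderivN. Qed.

Lemma rderiv_cst (c : C) t : rderiv (fun=> c) t 0.
Proof.
move=> e e0; exists 1 => // h _.
by rewrite subrr mul0r subr0 mod0 mulr_ge0// ltW.
Qed.

Lemma rderiv_eq (F G : R -> C) (g : R -> C) a b :
  (forall t, rderiv F t (g t)) -> (forall t, rderiv G t (g t)) ->
  F b - F a = G b - G a.
Proof.
move=> HF HG; apply/eqP; rewrite -subr_eq0 -mod_eq0 eq_le mod_ge0 andbT.
have := @rderiv_bound _ (fun x => F x - G x) (fun x => g x - g x) 0 a b.
rewrite mulr0 mul0r => H.
rewrite (_ : F b - F a - (G b - G a) = F b - G b - (F a - G a)); last by ring.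
apply: H => [t|s _]; first exact: rderivB.
by rewrite subrr mod0.
Qed.

(* Junk value [0] when [g] has no primitive. *)
Definition prim (g : R -> C) : R -> C := xget (fun=> 0) [set G | forall t, rderiv G t (g t)].

(** Integration through a primitive: additivity over adjacent intervals becomes a ring identity, as
    in [rect_int_split]. *)
Definition cint (g : R -> C) (a b : R) : C := prim g b - prim g a.

Lemma cint_prim g G a b : (forall t, rderiv G t (g t)) -> cint g a b = G b - G a.
Proof.
move=> HG; apply: (rderiv_eq (g := g)) => //.
by rewrite /prim; case: xgetP => [_ -> //|/(_ G)].
Qed.

Lemma primP g : rcont g -> forall t, rderiv (prim g) t (g t).
Proof.
move=> /complex_primitive[G HG].
by rewrite /prim; case: xgetP => [_ -> //|/(_ G)].
Qed.

Lemma cint_bound g (M a b : R) : rcont g ->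
  (forall s, 0 <= s <= 1 -> mod (g (a + s * (b - a))) <= M) ->
  mod (cint g a b) <= 2 * M * `|b - a|.
Proof. by move=> /primP; exact: rderiv_bound. Qed.

Lemma cintB g1 g2 a b : rcont g1 -> rcont g2 ->
  cint (fun t => g1 t - g2 t) a b = cint g1 a b - cint g2 a b.
Proof.
move=> /primP c1 /primP c2.
rewrite (cint_prim (G := fun t => prim g1 t - prim g2 t)); first by rewrite /cint; ring.
by move=> t; exact: rderivB.
Qed.

Lemma cintD g1 g2 a b : rcont g1 -> rcont g2 ->
  cint (fun t => g1 t + g2 t) a b = cint g1 a b + cint g2 a b.
Proof.
move=> /primP c1 /primP c2.
rewrite (cint_prim (G := fun t => prim g1 t + prim g2 t)); first by rewrite /cint; ring.
by move=> t; exact: rderivD.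
Qed.

Lemma cintZ g c a b : rcont g -> cint (fun t => c * g t) a b = c * cint g a b.
Proof.
move=> /primP c1.
rewrite (cint_prim (G := fun t => c * prim g t)); first by rewrite /cint; ring.
by move=> t; exact: rderivZ.
Qed.

Lemma cint_cst c a b : cint (fun=> c) a b = c * (b - a)%:C.
Proof.
rewrite (cint_prim (G := fun t => c * t%:C)); first by rewrite -mulrBr rmorphB.
move=> t e e0; exists 1 => // h _.
have -> : c * (t + h)%:C - c * t%:C - c * h%:C = 0 by rewrite rmorphD; ring.
by rewrite mod0 mulr_ge0// ltW.
Qed.

Definition ccont (f : C -> C) := forall z (e : R), 0 < e ->
  exists2 d : R, 0 < d & forall w, mod (w - z) < d -> mod (f w - f z) <= e.

Lemma cderiv_ccont1 (f : C -> C) z l : cderiv f z l -> forall e : R, 0 < e ->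
  exists2 d : R, 0 < d & forall w, mod (w - z) < d -> mod (f w - f z) <= e.
Proof.
move=> /(_ 1 ltr01)[d d0 H] e e0.
have m1 : 0 < 1 + mod l by rewrite ltr_wpDr// mod_ge0.
exists (Num.min d (e / (1 + mod l))); first by rewrite lt_min d0 divr_gt0.
move=> w; rewrite lt_min => /andP[/H + h2]; rewrite (addrC z) subrK mul1r => h1.
have -> : f w - f z = (f w - f z - l * (w - z)) + l * (w - z) by ring.
apply: le_trans (modD _ _) _; rewrite modM.
move: h2; rewrite ltr_pdivlMr//; nra.
Qed.

Lemma cderiv_ccont (f : C -> C) : (forall z, exists l, cderiv f z l) -> ccont f.
Proof. by move=> H z; have [l /cderiv_ccont1] := H z. Qed.

Lemma rderiv_rcont1 (g : R -> C) t l : rderiv g t l -> forall e : R, 0 < e ->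
  exists2 d : R, 0 < d & forall s, `|s - t| < d -> mod (g s - g t) <= e.
Proof.
move=> /(_ 1 ltr01)[d d0 H] e e0.
have m1 : 0 < 1 + mod l by rewrite ltr_wpDr// mod_ge0.
exists (Num.min d (e / (1 + mod l))); first by rewrite lt_min d0 divr_gt0.
move=> w; rewrite lt_min => /andP[/H + h2]; rewrite (addrC t) subrK mul1r => h1.
have -> : g w - g t = (g w - g t - l * (w - t)%:C) + l * (w - t)%:C by ring.
apply: le_trans (modD _ _) _; rewrite modM mod_real.
move: h2; rewrite ltr_pdivlMr//; nra.
Qed.

Lemma ccont_comp (f : C -> C) (g : R -> C) : ccont f -> rcont g -> rcont (fun t => f (g t)).
Proof.
move=> cf cg t e e0; have [d d0 H] := cf (g t) e e0.
have d20 : 0 < d / 2 by rewrite divr_gt0.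
have [d' d'0 H'] := cg t _ d20; exists d' => // s /H' h; apply: H.
by lra.
Qed.

Lemma rderiv_comp (P : C -> C) (g : R -> C) t l m : cderiv P (g t) l -> rderiv g t m ->
  rderiv (fun s => P (g s)) t (l * m).
Proof.
move=> HP Hg e e0.
have K0 : 0 < 1 + mod m by rewrite ltr_wpDr// mod_ge0.
have L0 : 0 < 1 + mod l by rewrite ltr_wpDr// mod_ge0.
have e1 : 0 < e / 2 / (1 + mod m) by rewrite !divr_gt0.
have e2 : 0 < e / 2 / (1 + mod l) by rewrite !divr_gt0.
have [d d0 H] := HP _ e1.
have [d1 d10 H1] := Hg _ ltr01.
have [d2 d20 H2] := Hg _ e2.
exists (Num.min d1 (Num.min d2 (d / (1 + mod m)))).
  by rewrite !lt_min d10 d20 divr_gt0.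
move=> h; rewrite !lt_min => /and3P[/H1 + /H2 + hd].
set k := g (t + h) - g t.
have gk : g t + k = g (t + h) by rewrite /k addrC subrK.
rewrite mul1r => h1 h2.
have kh : mod k <= (1 + mod m) * `|h|.
  have -> : k = (k - m * h%:C) + m * h%:C by ring.
  by apply: le_trans (modD _ _) _; rewrite modM mod_real; lra.
have kd : mod k < d by apply: (le_lt_trans kh); rewrite mulrC -ltr_pdivlMr.
have := H _ kd; rewrite gk => h3.
have -> : P (g (t + h)) - P (g t) - l * m * h%:C =
  (P (g (t + h)) - P (g t) - l * k) + l * (k - m * h%:C) by ring.
apply: le_trans (modD _ _) _; rewrite modM.
apply: le_trans (_ : e / 2 * `|h| + e / 2 * `|h| <= _); last by lra.
apply: lerD.
  apply: (le_trans h3); rewrite -mulrA ler_pM2l ?divr_gt0//.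
  by rewrite mulrC ler_pdivrMr// mulrC.
apply: le_trans (ler_wpM2l (mod_ge0 l) h2) _.
rewrite mulrA ler_wpM2r// mulrCA ler_piMr ?divr_ge0 ?(ltW e0)//.
by rewrite ler_pdivrMr// mul1r lerDr.
Qed.

(** The boundary integral, counterclockwise when [x0 <= x1] and [y0 <= y1]; the vertical sides carry
    the factor ['i] because [dz = 'i ds] there. *)
Definition rect_int (f : C -> C) (x0 x1 y0 y1 : R) : C :=
  cint (fun t => f (t +i* y0)) x0 x1 - cint (fun t => f (t +i* y1)) x0 x1 +
  'i * (cint (fun s => f (x1 +i* s)) y0 y1 - cint (fun s => f (x0 +i* s)) y0 y1).

Lemma hderiv (y t : R) : rderiv (fun t => t +i* y) t 1.
Proof.
move=> e e0; exists 1 => // h _; rewrite (_ : _ - _ - _ = 0).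
  by rewrite mod0 mulr_ge0// ltW.
by apply/eqP; rewrite eq_complex /=; apply/andP; split; apply/eqP; ring.
Qed.

Lemma vderiv (x t : R) : rderiv (fun t => x +i* t) t 'i.
Proof.
move=> e e0; exists 1 => // h _; rewrite (_ : _ - _ - _ = 0).
  by rewrite mod0 mulr_ge0// ltW.
by apply/eqP; rewrite eq_complex /=; apply/andP; split; apply/eqP; ring.
Qed.

Lemma h_rcont (y : R) : rcont (fun t => t +i* y).
Proof. by move=> t; exact: rderiv_rcont1 (hderiv y t). Qed.
Lemma v_rcont (x : R) : rcont (fun t => x +i* t).
Proof. by move=> t; exact: rderiv_rcont1 (vderiv x t). Qed.

Lemma rect_int_primitive f P x0 x1 y0 y1 : (forall z, cderiv P z (f z)) -> ccont f ->
  rect_int f x0 x1 y0 y1 = 0.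
Proof.
move=> HP cf; rewrite /rect_int.
have hE y : cint (fun t => f (t +i* y)) x0 x1 = P (x1 +i* y) - P (x0 +i* y).
  apply: (@cint_prim _ (fun t => P (t +i* y))) => t; rewrite -[f _]mulr1.
  by apply: rderiv_comp (HP _) (hderiv _ _).
have vE x : 'i * cint (fun t => f (x +i* t)) y0 y1 = P (x +i* y1) - P (x +i* y0).
  rewrite -cintZ; last exact: (ccont_comp cf (v_rcont x)).
  apply: (@cint_prim _ (fun t => P (x +i* t))) => t; rewrite mulrC.
  by apply: rderiv_comp (HP _) (vderiv _ _).
by rewrite mulrBr !vE !hE; ring.
Qed.

Lemma rect_int_B f g x0 x1 y0 y1 : ccont f -> ccont g ->
  rect_int (fun z => f z - g z) x0 x1 y0 y1 = rect_int f x0 x1 y0 y1 - rect_int g x0 x1 y0 y1.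
Proof.
move=> cf cg; rewrite /rect_int.
have hc y := ccont_comp cf (h_rcont y); have hg y := ccont_comp cg (h_rcont y).
have vc y := ccont_comp cf (v_rcont y); have vg y := ccont_comp cg (v_rcont y).
by rewrite !cintB//; ring.
Qed.

Lemma rect_int_split f x0 xm x1 y0 ym y1 : rect_int f x0 x1 y0 y1 =
  rect_int f x0 xm y0 ym + rect_int f xm x1 y0 ym + rect_int f x0 xm ym y1 + rect_int f xm x1 ym y1.
Proof. rewrite /rect_int /cint; ring. Qed.

Lemma mod_i : mod 'i = 1.
Proof. by rewrite /= expr0n expr1n add0r sqrtr1. Qed.

(** Each side contributes at most twice [M] times its length, by [cint_bound], and opposite sides
    have equal length. *)
Lemma rect_int_bound f (M x0 x1 y0 y1 : R) : ccont f ->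
  (forall s t, 0 <= s <= 1 -> 0 <= t <= 1 ->
     mod (f ((x0 + s * (x1 - x0)) +i* (y0 + t * (y1 - y0)))) <= M) ->
  mod (rect_int f x0 x1 y0 y1) <= 4 * M * (`|x1 - x0| + `|y1 - y0|).
Proof.
move=> cf HM.
have i0 : 0 <= (0:R) <= 1 by rewrite lexx ler01.
have i1 : 0 <= (1:R) <= 1 by rewrite lexx ler01.
have h0 : mod (cint (fun t => f (t +i* y0)) x0 x1) <= 2 * M * `|x1 - x0|.
  apply: cint_bound; first exact: (ccont_comp cf (h_rcont _)).
  by move=> s s01; have := HM s 0 s01 i0; rewrite mul0r addr0.
have h1 : mod (cint (fun t => f (t +i* y1)) x0 x1) <= 2 * M * `|x1 - x0|.
  apply: cint_bound; first exact: (ccont_comp cf (h_rcont _)).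
  by move=> s s01; have := HM s 1 s01 i1; rewrite mul1r (addrC y0) subrK.
have v0 : mod (cint (fun t => f (x0 +i* t)) y0 y1) <= 2 * M * `|y1 - y0|.
  apply: cint_bound; first exact: (ccont_comp cf (v_rcont _)).
  by move=> s s01; have := HM 0 s i0 s01; rewrite mul0r addr0.
have v1 : mod (cint (fun t => f (x1 +i* t)) y0 y1) <= 2 * M * `|y1 - y0|.
  apply: cint_bound; first exact: (ccont_comp cf (v_rcont _)).
  by move=> s s01; have := HM 1 s i1 s01; rewrite mul1r (addrC x0) subrK.
apply: le_trans (modD _ _) _; rewrite modM mod_i mul1r.
have := modB (cint (fun t => f (t +i* y0)) x0 x1) (cint (fun t => f (t +i* y1)) x0 x1).
have := modB (cint (fun t => f (x1 +i* t)) y0 y1) (cint (fun t => f (x0 +i* t)) y0 y1).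
by lra.
Qed.

(** Each interval [[s k, s k + 2 ^ - k]] is the left or right half of the preceding one; the
    supremum of the left ends lies in all of them. *)
Lemma dyadic_nested (s : nat -> R) :
  (forall k, s k.+1 = s k \/ s k.+1 = s k + 2^-1 ^+ k.+1) ->
  exists c, forall k, s k <= c <= s k + 2^-1 ^+ k.
Proof.
move=> H.
have nd m n : (m <= n)%N -> s m <= s n.
  move=> /subnK <-; elim: (n - m)%N => [|k IH]; first by rewrite add0n.
  apply: (le_trans IH); rewrite addSn; case: (H (k + m)%N) => ->//.
  by rewrite lerDl exprn_ge0.
have ni m n : (m <= n)%N -> s n + 2^-1 ^+ n <= s m + 2^-1 ^+ m.
  move=> /subnK <-; elim: (n - m)%N => [|k IH]; first by rewrite add0n.
  apply: le_trans _ IH; rewrite addSn exprS; have := H (k + m)%N; rewrite exprS.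
  have : 0 <= 2^-1 ^+ (k + m) :> R by rewrite exprn_ge0.
  by move=> ? [->|->]; lra.
have ub k j : s j <= s k + 2^-1 ^+ k.
  have [jk|kj] := leqP j k.
    by apply: (le_trans (nd _ _ jk)); rewrite lerDl exprn_ge0.
  apply: le_trans (ni _ _ (ltnW kj)); by rewrite lerDl exprn_ge0.
exists (sup (range s)) => k; apply/andP; split.
  apply: ub_le_sup; last by exists k.
  by exists (s 0%N + 2^-1 ^+ 0) => _ [j _ <-]; exact: ub.
by apply: ge_sup; [exists (s 0%N); exists 0%N|move=> _ [j _ <-]; exact: ub].
Qed.

(** The primitive that makes the affine approximation of [f] integrate to zero in [Goursat]. *)
Lemma cderiv_quadratic (z a l w : C) :
  cderiv (fun w => a * (w - z) + l * (w - z) ^+ 2 / 2) w (a + l * (w - z)).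
Proof.
move=> e e0.
have m1 : 0 < 1 + mod l by rewrite ltr_wpDr// mod_ge0.
exists (e / (1 + mod l)); first by rewrite divr_gt0.
move=> h; rewrite ltr_pdivlMr// => hh.
have -> : a * (w + h - z) + l * (w + h - z) ^+ 2 / 2 -
  (a * (w - z) + l * (w - z) ^+ 2 / 2) - (a + l * (w - z)) * h = l * h * h / 2 by field.
have -> : mod (l * h * h / 2) = mod l * mod h * mod h / 2.
  by rewrite !modM modV -[2 in LHS](rmorph_nat (real_complex R) 2) mod_real normr_nat.
have := mod_ge0 l; have := mod_ge0 h; nra.
Qed.

(** Bisection: nested quarters, each carrying at least a quarter of the preceding integral, shrink
    to a point near which [f] is affine up to a small multiple of the distance. Differentiability is
    asked on the closed rectangle alone, so that an exceptional point can be cut off in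
    [Goursat_corner]. *)
Lemma Goursat (f : C -> C) (x0 x1 y0 y1 : R) : ccont f ->
  (forall s t, 0 <= s <= 1 -> 0 <= t <= 1 -> exists l,
     cderiv f ((x0 + s * (x1 - x0)) +i* (y0 + t * (y1 - y0))) l) ->
  rect_int f x0 x1 y0 y1 = 0.
Proof.
move=> cf Hf.
(* Parametrised by the unit square, all subrectangles are similar, and a corner [p] with one side
   parameter [h] describes each of them. *)
pose X s := x0 + s * (x1 - x0); pose Y t := y0 + t * (y1 - y0).
pose J (p : R * R) (h : R) := mod (rect_int f (X p.1) (X (p.1 + h)) (Y p.2) (Y (p.2 + h))).
pose nxt (p q : R * R) (h : R) := [/\ q.1 = p.1 \/ q.1 = p.1 + h,
   q.2 = p.2 \/ q.2 = p.2 + h & J p (2 * h) <= 4 * J q h].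
(* If each of the four quarters carried less than a quarter of the integral, their sum would fall
   short of the whole. *)
have step (ph : R * R * R) : exists q, nxt ph.1 q ph.2.
  move: ph => [[s t] h] /=; apply: contrapT => N.
  have F q1 q2 : (q1 = s \/ q1 = s + h) -> (q2 = t \/ q2 = t + h) ->
      4 * J (q1, q2) h < J (s, t) (2 * h).
    by move=> H1 H2; rewrite ltNge; apply/negP => H; apply: N; exists (q1, q2); split.
  have F1 := F s t (or_introl erefl) (or_introl erefl).
  have F2 := F (s + h) t (or_intror erefl) (or_introl erefl).
  have F3 := F s (t + h) (or_introl erefl) (or_intror erefl).
  have F4 := F (s + h) (t + h) (or_intror erefl) (or_intror erefl).
  have : J (s, t) (2 * h) <= J (s, t) h + J (s + h, t) h + J (s, t + h) h + J (s + h, t + h) h.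
    rewrite /J /= (rect_int_split f _ (X (s + h)) _ _ (Y (t + h))).
    rewrite (_ : 2 * h = h + h); last by ring.
    rewrite (addrA s) (addrA t).
    by do 3![apply: le_trans (modD _ _) _; apply: lerD => //].
  by lra.
have [N HN] := choice step.
pose p := fix p k : R * R := if k is k'.+1 then N (p k', 2^-1 ^+ k) else (0, 0).
have pS k : nxt (p k) (p k.+1) (2^-1 ^+ k.+1) by exact: (HN (p k, _)).
have [|s Hs] := @dyadic_nested (fun k => (p k).1); first by move=> k; have [] := pS k.
have [|t Ht] := @dyadic_nested (fun k => (p k).2); first by move=> k; have [] := pS k.
have E k : mod (rect_int f x0 x1 y0 y1) <= 4 ^+ k * J (p k) (2^-1 ^+ k).
  elim: k => [|k IH].
    rewrite !expr0 mul1r /J /X /Y /= !add0r !mul0r !addr0 !mul1r.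
    by rewrite (addrC x0) (addrC y0) !subrK.
  apply: (le_trans IH); rewrite exprS (mulrC 4) -mulrA ler_wpM2l ?exprn_ge0//.
  have [_ _] := pS k.
  by rewrite (_ : 2 * 2^-1 ^+ k.+1 = 2^-1 ^+ k :> R)// exprS mulrA divff// mul1r.
have p0 k : 0 <= (p k).1 /\ 0 <= (p k).2.
  elim: k => [|k [IH1 IH2]] //.
  have [H1 H2 _] := pS k; have : 0 <= 2^-1 ^+ k.+1 :> R by rewrite exprn_ge0.
  by move=> ?; split; [case: H1 => ->|case: H2 => ->]; rewrite ?addr_ge0.
have s01 : 0 <= s <= 1.
  by have := Hs 0%N; rewrite /= add0r expr0.
have t01 : 0 <= t <= 1.
  by have := Ht 0%N; rewrite /= add0r expr0.
have [l Hl] := Hf s t s01 t01.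
rewrite -/(X s) -/(Y t) in Hl; set z := X s +i* Y t in Hl.
set D := `|x1 - x0| + `|y1 - y0|.
have D0 : 0 <= D by rewrite addr_ge0.
have main (e : R) : 0 < e -> mod (rect_int f x0 x1 y0 y1) <= 4 * e * D ^+ 2.
  move=> e0; have [d d0 Hd] := Hl e e0.
  have [k Hk] : exists k, 2^-1 ^+ k * D < d.
    have dD : 0 < d / (D + 1) by rewrite divr_gt0// ltr_wpDl.
    have /cvgrPdist_lt cv : (2^-1 : R) ^+ n @[n --> \oo] --> 0.
      by apply: cvg_expr; rewrite ger0_norm ?invr_ge0// invf_lt1 ?ltr1n.
    have [k _ Hk] := cv _ dD; have := Hk k (leqnn _).
    rewrite /= sub0r normrN ger0_norm ?exprn_ge0// => H.
    exists k; have : 2^-1 ^+ k * (D + 1) < d by rewrite -ltr_pdivlMr// ltr_wpDl.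
    by apply: le_lt_trans; rewrite ler_wpM2l ?exprn_ge0// lerDl.
  pose h : R := 2^-1 ^+ k.
  have h0 : 0 < h by rewrite exprn_gt0.
  pose A w := f z + l * (w - z).
  have cA : ccont A.
    move=> w; apply: (@cderiv_ccont1 A w l) => e' e'0; exists 1 => // k' _.
    rewrite /A (_ : _ - _ - _ = 0); last by ring.
    by rewrite mod0 mulr_ge0 ?mod_ge0// ltW.
  have cfA : ccont (fun w => f w - A w).
    move=> w e' e'0; have e'2 : 0 < e' / 2 by rewrite divr_gt0.
    have [d1 d10 H1] := cf w _ e'2; have [d2 d20 H2] := cA w _ e'2.
    exists (Num.min d1 d2); first by rewrite lt_min d10.
    move=> v; rewrite lt_min => /andP[/H1 h1 /H2 h2].
    have -> : f v - A v - (f w - A w) = (f v - f w) - (A v - A w) by ring.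
    by apply: le_trans (modB _ _) _; lra.
  have JE : J (p k) h <= 4 * (e * (h * D)) * (h * D).
    rewrite /J -[X in mod X]subr0.
    rewrite -(@rect_int_primitive A (fun w => f z * (w - z) + l * (w - z) ^+ 2 / 2)
      (X (p k).1) (X ((p k).1 + h)) (Y (p k).2) (Y ((p k).2 + h)))//; last first.
      by move=> w; exact: cderiv_quadratic.
    rewrite -rect_int_B//.
    have hDE : `|X ((p k).1 + h) - X (p k).1| + `|Y ((p k).2 + h) - Y (p k).2| = h * D.
      rewrite (_ : X _ - X _ = h * (x1 - x0)); last by rewrite /X; ring.
      rewrite (_ : Y _ - Y _ = h * (y1 - y0)); last by rewrite /Y; ring.
      by rewrite !normrM (ger0_norm (ltW h0)) /D; ring.
    rewrite -[X in _ <= _ * X]hDE; apply: rect_int_bound => // s' t' s'01 t'01.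
    set w := _ +i* _.
    have wz : mod (w - z) <= h * D.
      apply: le_trans (mod_le_ReIm _) _.
      rewrite /w /z /= /D (mulrDr h); apply: lerD.
      - rewrite (_ : _ - X s = ((p k).1 + s' * h - s) * (x1 - x0)); last by rewrite /X; ring.
        rewrite normrM ler_wpM2r// ler_norml; have := Hs k; rewrite -/h.
        by move=> /andP[]; nra.
      - rewrite (_ : _ - Y t = ((p k).2 + t' * h - t) * (y1 - y0)); last by rewrite /Y; ring.
        rewrite normrM ler_wpM2r// ler_norml; have := Ht k; rewrite -/h.
        by move=> /andP[]; nra.
    have := Hd (w - z) (le_lt_trans wz Hk); rewrite (addrC z) subrK => H.
    rewrite (_ : f w - A w = f w - f z - l * (w - z)); last by rewrite /A; ring.
    by apply: (le_trans H); rewrite ler_pM2l.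
  apply: (le_trans (E k)); rewrite -/h.
  (* The loss [4 ^ k] from [k] bisections is exactly compensated by one factor [2 ^ - k] from the
     perimeter and one from the approximation error. *)
  have h4 : 4 ^+ k * (h * h) = 1.
    by rewrite /h -exprMn -exprMn mulrA (_ : 4 * 2^-1 * 2^-1 = 1 :> R) ?expr1n//; field.
  apply: le_trans (ler_wpM2l (exprn_ge0 _ _) JE) _ => //.
  rewrite [leLHS](_ : _ = 4 ^+ k * (h * h) * (4 * e * D ^+ 2)); last by ring.
  by rewrite h4 mul1r.
apply/eqP; rewrite -mod_eq0 eq_le mod_ge0 andbT; apply/ler_addgt0Pr => e e0.
have e1 : 0 < e / (4 * (D ^+ 2 + 1)).
  by rewrite divr_gt0// mulr_gt0// ltr_wpDl// sqr_ge0.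
rewrite add0r; apply: (le_trans (main _ e1)).
have D1 : 0 < D ^+ 2 + 1 by rewrite ltr_wpDl// sqr_ge0.
rewrite (_ : 4 * _ * _ = e * (D ^+ 2 / (D ^+ 2 + 1))); last by field; rewrite gt_eqF.
by rewrite ler_piMr ?(ltW e0)// ler_pdivrMr// mul1r lerDl.
Qed.

End Goursat.

(** * Primitives in the plane *)

Section Primitive.
Context {R : realType}.
Local Notation C := R[i].
Local Notation mod := (@Normc.normc R).

Lemma rcont_cst (c : C) : rcont (fun=> c).
Proof. by move=> t; exact: rderiv_rcont1 (rderiv_cst c t). Qed.

Lemma rect_int_degenerate_h (f : C -> C) x y0 y1 : rect_int f x x y0 y1 = 0.
Proof. rewrite /rect_int /cint; ring. Qed.
Lemma rect_int_degenerate_v (f : C -> C) x0 x1 y : rect_int f x0 x1 y y = 0.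
Proof. rewrite /rect_int /cint; ring. Qed.

(* The exceptional point is a corner: cutting off a small similar rectangle at
   that corner leaves three rectangles to which [Goursat] applies. *)
Lemma Goursat_corner (q : C -> C) (x y : R) : ccont q ->
  (forall w, w != 0 -> exists l, cderiv q w l) -> rect_int q 0 x 0 y = 0.
Proof.
move=> cq dq.
have [->|x0] := eqVneq x 0; first exact: rect_int_degenerate_h.
have [->|y0] := eqVneq y 0; first exact: rect_int_degenerate_v.
have nz (u v : R) : u != 0 \/ v != 0 -> u +i* v != 0.
  by rewrite eq_complex/= negb_and => -[->|->]//; rewrite orbT.
have E (n : R) : 0 < n < 1 -> rect_int q 0 x 0 y = rect_int q 0 (n * x) 0 (n * y).
  move=> /andP[n0 n1]; rewrite (rect_int_split q 0 (n * x) x 0 (n * y) y).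
  have pos (s : R) : 0 <= s <= 1 -> n + s * (1 - n) != 0.
    by move=> /andP[s0 s1]; rewrite gt_eqF// ltr_pwDl// mulr_ge0// subr_ge0 ltW.
  rewrite [rect_int q (n * x) x 0 _]Goursat// => [|s t s01 t01]; last first.
    apply/dq/nz; left; rewrite (_ : _ + _ = (n + s * (1 - n)) * x); last by ring.
    by rewrite mulf_neq0// pos.
  rewrite [rect_int q 0 (n * x) (n * y) y]Goursat// => [|s t s01 t01]; last first.
    apply/dq/nz; right; rewrite (_ : _ + _ = (n + t * (1 - n)) * y); last by ring.
    by rewrite mulf_neq0// pos.
  rewrite [rect_int q (n * x) x (n * y) y]Goursat// => [|s t s01 t01]; last first.
    apply/dq/nz; left; rewrite (_ : _ + _ = (n + s * (1 - n)) * x); last by ring.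
    by rewrite mulf_neq0// pos.
  by rewrite !addr0.
pose D := `|x| + `|y|; pose M := 1 + mod (q 0).
have M0 : 0 < M by rewrite ltr_pwDl// mod_ge0.
have D0 : 0 < D by rewrite addr_gt0// normr_gt0.
apply/eqP; rewrite -mod_eq0 eq_le mod_ge0 andbT; apply/ler_addgt0Pr => e e0.
rewrite add0r; have [d d0 Hd] := cq 0 1 ltr01.
pose n := Num.min (2^-1 : R) (Num.min (d / 2 / D) (e / (4 * M * D))).
have n0 : 0 < n by rewrite !lt_min invr_gt0 ltr0n !divr_gt0// !mulr_gt0.
have n1 : n <= 2^-1 by rewrite ge_min lexx.
have n2 : n * D <= d / 2 by rewrite -ler_pdivlMr// !ge_min lexx orbT.
have n3 : n * (4 * M * D) <= e by rewrite -ler_pdivlMr ?mulr_gt0// !ge_min lexx !orbT.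
rewrite (E n); last by rewrite n0; lra.
apply: le_trans (_ : 4 * M * (`|n * x - 0| + `|n * y - 0|) <= _); last first.
  by rewrite !subr0 !normrM -mulrDr (ger0_norm (ltW n0)) -/D; lra.
apply: rect_int_bound => // s t /andP[s0 s1] /andP[t0 t1]; rewrite !add0r !subr0.
set w := _ +i* _.
have wd : mod (w - 0) < d.
  rewrite subr0; apply: le_lt_trans (mod_le_ReIm _) _ => /=.
  rewrite !normrM !(ger0_norm (ltW n0)) (ger0_norm s0) (ger0_norm t0).
  apply: (@le_lt_trans _ _ (n * D)); last by lra.
  rewrite /D mulrDr lerD//.
    by rewrite ler_piMl// mulr_ge0// ltW.
  by rewrite ler_piMl// mulr_ge0// ltW.
have := Hd w wd; rewrite /M => H.
have -> : q w = (q w - q 0) + q 0 by ring.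
by apply: le_trans (modD _ _) _; lra.
Qed.

(** [F] integrates from 0 first horizontally and then vertically; by [Goursat_corner] the opposite
    order gives the same value ([FE]). The first form yields vertical increments, the second
    horizontal ones, so an increment of [F] is the integral of [q] along a short L-shaped path,
    where [q] is nearly constant. *)
Lemma primitive0 (q : C -> C) : ccont q ->
  (forall w, w != 0 -> exists l, cderiv q w l) ->
  exists Q, forall w, cderiv Q w (q w).
Proof.
move=> cq dq.
pose F (w : C) := let: x +i* y := w in
  cint (fun t => q (t +i* 0)) 0 x + 'i * cint (fun s => q (x +i* s)) 0 y.
have hq y : rcont (fun t => q (t +i* y)) by exact: (ccont_comp cq (h_rcont y)).
have vq x : rcont (fun t => q (x +i* t)) by exact: (ccont_comp cq (v_rcont x)).
have FE x y : F (x +i* y) =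
    cint (fun t => q (t +i* y)) 0 x + 'i * cint (fun s => q (0 +i* s)) 0 y.
  apply/eqP; rewrite -subr_eq0 -(Goursat_corner x y cq dq) /F /rect_int; apply/eqP; ring.
exists F => -[x y] e e0.
have e4 : 0 < e / 4 by rewrite divr_gt0.
have [d d0 Hd] := cq (x +i* y) _ e4.
exists (d / 2); first by rewrite divr_gt0.
move=> [k m] hd; set h := k +i* m in hd *.
have kh : `|k| <= mod h := mod_Re h.
have mh : `|m| <= mod h := mod_Im h.
have E1 : F (x +i* y + h) - F ((x + k) +i* y) = 'i * cint (fun s => q ((x + k) +i* s)) y (y + m).
  by rewrite /F /h /= /cint; ring.
have E2 : F ((x + k) +i* y) - F (x +i* y) = cint (fun t => q (t +i* y)) x (x + k).
  by rewrite !FE /cint; ring.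
set Z := q (x +i* y) in Hd *.
have c1 : cint (fun s => q ((x + k) +i* s) - Z) y (y + m) =
    cint (fun s => q ((x + k) +i* s)) y (y + m) - Z * m%:C.
  by rewrite cintB// ?cint_cst ?(addrC y) ?addrK//; exact: rcont_cst.
have c2 : cint (fun t => q (t +i* y) - Z) x (x + k) =
    cint (fun t => q (t +i* y)) x (x + k) - Z * k%:C.
  by rewrite cintB// ?cint_cst ?(addrC x) ?addrK//; exact: rcont_cst.
have hE : h = k%:C + 'i * m%:C.
  by rewrite /h; apply/eqP; rewrite eq_complex /=; apply/andP; split; apply/eqP; ring.
have -> : F (x +i* y + h) - F (x +i* y) - Z * h =
    'i * cint (fun s => q ((x + k) +i* s) - Z) y (y + m) +
    cint (fun t => q (t +i* y) - Z) x (x + k).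
  by rewrite c1 c2 -E2 mulrBr -E1 {2}hE; ring.
apply: le_trans (modD _ _) _; rewrite modM mod_i mul1r.
have rB (g : R -> C) : rcont g -> rcont (fun t => g t - Z).
  by move=> cg t e' e'0; have [d' d'0 Hd'] := cg t e' e'0; exists d' => // s /Hd';
    rewrite (_ : g s - Z - (g t - Z) = g s - g t); last by ring.
have b1 : mod (cint (fun s => q ((x + k) +i* s) - Z) y (y + m)) <= 2 * (e / 4) * `|m|.
  have := @cint_bound _ (fun s => q ((x + k) +i* s) - Z) (e / 4) y (y + m) (rB _ (vq _)).
  rewrite (addrC y) addrK; apply => s /andP[s0 s1]; apply: Hd.
  apply: le_lt_trans (mod_le_ReIm _) _ => /=; rewrite (addrC x) addrK (addrC y) addrK normrM ger0_norm//.
  have : s * `|m| <= `|m| by rewrite ler_piMl.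
  by lra.
have b2 : mod (cint (fun t => q (t +i* y) - Z) x (x + k)) <= 2 * (e / 4) * `|k|.
  have := @cint_bound _ (fun t => q (t +i* y) - Z) (e / 4) x (x + k) (rB _ (hq _)).
  rewrite (addrC x) addrK; apply => s /andP[s0 s1]; apply: Hd.
  apply: le_lt_trans (mod_le_ReIm _) _ => /=; rewrite subrr normr0 addr0 (addrC x) addrK normrM ger0_norm//.
  have : s * `|k| <= `|k| by rewrite ler_piMl.
  by lra.
by nra.
Qed.

Lemma cderiv_shift (f : C -> C) c w l : cderiv f (w + c) l -> cderiv (fun v => f (v + c)) w l.
Proof. by move=> H e e0; have [d d0 Hd] := H e e0; exists d => // h /Hd; rewrite (addrAC w). Qed.

Lemma primitive_off_point (q : C -> C) (z : C) : ccont q ->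
  (forall w, w != z -> exists l, cderiv q w l) ->
  exists Q, forall w, cderiv Q w (q w).
Proof.
move=> cq dq; have [||Q HQ] := @primitive0 (fun w => q (w + z)).
- move=> w e e0; have [d d0 Hd] := cq (w + z) e e0; exists d => // v vd.
  by apply: Hd; rewrite opprD addrACA subrr addr0.
- move=> w w0; have [|l Hl] := dq (w + z); last by exists l; exact: cderiv_shift.
  by rewrite -subr_eq0 addrK.
exists (fun w => Q (w - z)) => w; apply: cderiv_shift.
by have := HQ (w - z); rewrite subrK.
Qed.

(** With [l] the derivative of [f] at [z], this quotient is continuous everywhere and differentiable
    off [z], which is what [primitive_off_point] asks for. *)
Definition dquot (f : C -> C) (z l : C) : C -> C :=
  fun w => if w == z then l else (f w - f z) / (w - z).

Lemma dquotE f z l w : dquot f z l w * (w - z) = f w - f z.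
Proof.
rewrite /dquot; have [->|wz] := eqVneq w z; first by rewrite !subrr mulr0.
by rewrite divfK// subr_eq0.
Qed.

Lemma dquot_deriv f z l w : w != z -> (exists m, cderiv f w m) ->
  exists m, cderiv (dquot f z l) w m.
Proof.
move=> wz [m Hm].
have wz0 : w - z != 0 by rewrite subr_eq0.
have [m' /is_derive_cderiv D] : exists m', cderiv (fun v => (f v - f z) / (v - z)) w m'.
  apply/derivable_cderiv.
  have d1 : derivable (fun v : C^o => f v - f z : C^o) w 1.
    apply: derivableB; last exact: derivable_cst.
    by have [] : is_derive (w : C^o) 1 (f : C^o -> C^o) m by exact/is_derive_cderiv.
  have d2 : derivable (fun v : C^o => v - z : C^o) w 1.
    by apply: derivableB; [exact: derivable_id|exact: derivable_cst].
  exact: (derivableM d1 (derivableV wz0 d2)).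
exists m' => e e0; have /is_derive_cderiv/(_ e e0)[d d0 Hd] := D.
(* The second radius keeps [w + h] away from [z], where the value of [dquot] switches to [l]. *)
exists (Num.min d (mod (w - z))); first by rewrite lt_min d0 mod_gt0.
move=> h; rewrite lt_min => /andP[/Hd + hz]; rewrite /dquot (negbTE wz).
case: eqVneq => // whz _; exfalso; move: hz.
have -> : h = - (w - z) by rewrite -whz; ring.
by rewrite modN ltxx.
Qed.

Lemma dquot_cont f z l : cderiv f z l -> (forall w, exists m, cderiv f w m) ->
  ccont (dquot f z l).
Proof.
move=> Hl Hf w; have [->|wz] := eqVneq w z; last first.
  by have [m /cderiv_ccont1] := dquot_deriv l wz (Hf w).
move=> e e0; have [d d0 Hd] := Hl e e0; exists d => // v vd.
rewrite /dquot eqxx; have [_|vz] := eqVneq v z; first by rewrite subrr mod0 ltW.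
have vz0 : v - z != 0 by rewrite subr_eq0.
rewrite -(ler_pM2r (x:=mod (v - z))) ?mod_gt0// -modM mulrBl divfK//.
by have := Hd _ vd; rewrite (addrC z) subrK.
Qed.

End Primitive.

(** * Power series *)

Section PowerSeries.
Context {R : realType}.
Local Notation C := R[i].
Local Notation mod := (@Normc.normc R).

Lemma mod_nat n : mod (n%:R : C) = n%:R.
Proof. by rewrite -(rmorph_nat (real_complex R) n) mod_real normr_nat. Qed.

Lemma expr_lt_eps (x K e : R) : 0 <= x < 1 -> 0 < e -> exists N, forall n, (N <= n)%N -> K * x ^+ n <= e.
Proof.
move=> /andP[x0 x1] e0.
have K1 : 0 < `|K| + 1 by rewrite ltr_wpDl.
have /cvgrPdist_lt cv : x ^+ n @[n --> \oo] --> 0.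
  by apply: cvg_expr; rewrite ger0_norm.
have [N _ HN] := cv _ (divr_gt0 e0 K1); exists N => n /HN /=.
rewrite sub0r normrN ger0_norm ?exprn_ge0// ltr_pdivlMr// mulrC => /ltW; apply: le_trans.
by rewrite ler_wpM2r ?exprn_ge0//; apply: le_trans (ler_norm K) _; rewrite lerDl.
Qed.

Definition cconv (w : nat -> C) (l : C) := forall e : R, 0 < e ->
  exists N, forall n, (N <= n)%N -> mod (\sum_(0 <= k < n) w k - l) <= e.

Lemma taylorP (h : C -> C^o) c u : taylor_expansion h c u <->
  forall z, cconv (fun k => u k * (z - c) ^+ k) (h z).
Proof.
split=> H z; last first.
  apply/cvg_eps => e e0; have [N HN] := H z e e0.
  by exists N => // n /= Nn; exact: HN.
move=> e e0; have /cvg_eps/(_ e e0)[N _ HN] := H z.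
by exists N => n Nn; exact: (HN n).
Qed.

Lemma cconv_term (w : nat -> C) l : cconv w l -> exists2 B : R, 0 <= B & forall k, mod (w k) <= B.
Proof.
move=> /(_ 1 ltr01)[N HN].
exists (2 + \sum_(0 <= k < N) mod (w k)).
  by rewrite addr_ge0// sumr_ge0// => i _; exact: mod_ge0.
move=> k; have [kN|Nk] := ltnP k N.
  rewrite big_mkord (bigD1 (Ordinal kN))//= addrCA lerDl addr_ge0// sumr_ge0// => i _.
  exact: mod_ge0.
have S0 : 0 <= \sum_(0 <= k < N) mod (w k) by rewrite sumr_ge0// => i _; exact: mod_ge0.
have h1 := HN k Nk; have := HN k.+1 (leqW Nk); rewrite big_nat_recr//= => h2.
set s := \sum_(0 <= i < k) w i in h1 h2.
have -> : w k = (s + w k - l) - (s - l) by ring.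
by apply: le_trans (modB _ _) _; lra.
Qed.

Lemma real_series_cvg (a : nat -> R) (K : R) : (forall k, 0 <= a k) ->
  (forall n, \sum_(0 <= k < n) a k <= K) -> cvgn (series a).
Proof.
move=> a0 aK; apply: nondecreasing_is_cvgn.
  apply: nondecreasing_series => n *; exact: a0.
by exists K => _ [n _ <-]; exact: aK.
Qed.

Lemma ReD (x y : C) : complex.Re (x + y) = complex.Re x + complex.Re y.
Proof. by case: x y => ? ? []. Qed.
Lemma ImD (x y : C) : complex.Im (x + y) = complex.Im x + complex.Im y.
Proof. by case: x y => ? ? []. Qed.
Lemma ReB (x y : C) : complex.Re (x - y) = complex.Re x - complex.Re y.
Proof. by case: x y => ? ? []. Qed.
Lemma ImB (x y : C) : complex.Im (x - y) = complex.Im x - complex.Im y.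
Proof. by case: x y => ? ? []. Qed.
Lemma Re_sum (I : Type) (s : seq I) (F : I -> C) :
  complex.Re (\sum_(i <- s) F i) = \sum_(i <- s) complex.Re (F i).
Proof. exact: (big_morph _ ReD). Qed.
Lemma Im_sum (I : Type) (s : seq I) (F : I -> C) :
  complex.Im (\sum_(i <- s) F i) = \sum_(i <- s) complex.Im (F i).
Proof. exact: (big_morph _ ImD). Qed.

Lemma cconv_le (w : nat -> C) (K : R) l :
  (forall n, mod (\sum_(0 <= k < n) w k) <= K) -> cconv w l -> mod l <= K.
Proof.
move=> HK Hl; apply/ler_addgt0Pr => e /Hl[N /(_ N (leqnn _)) H].
have -> : l = \sum_(0 <= k < N) w k - (\sum_(0 <= k < N) w k - l) by ring.
by apply: le_trans (modB _ _) _; apply: lerD.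
Qed.

Lemma cconv_abs (w : nat -> C) (K : R) : (forall n, \sum_(0 <= k < n) mod (w k) <= K) ->
  exists2 l, cconv w l & mod l <= K.
Proof.
move=> HK.
have cr (f : C -> R) : (forall z, `|f z| <= mod z) -> cvgn (series (fun k => f (w k))).
  move=> fm; apply: normed_cvg.
  apply: (@real_series_cvg (fun k => `|f (w k)|) K) => [k|n]; first exact: normr_ge0.
  by apply: le_trans (HK n); apply: ler_sum => k _.
have /cvg_ex[l1 /cvgrPdist_le h1] := cr (@complex.Re R) mod_Re.
have /cvg_ex[l2 /cvgrPdist_le h2] := cr (@complex.Im R) mod_Im.
have cl : cconv w (l1 +i* l2).
  move=> e e0; have e2 : 0 < e / 2 by rewrite divr_gt0.
  have [N1 _ H1] := h1 _ e2; have [N2 _ H2] := h2 _ e2.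
  exists (maxn N1 N2) => n; rewrite geq_max => /andP[/H1 + /H2].
  rewrite /series /= => k1 k2; apply: le_trans (mod_le_ReIm _) _.
  by rewrite ReB ImB Re_sum Im_sum /= distrC [X in _ + X]distrC; lra.
exists (l1 +i* l2) => //; apply: (cconv_le (w := w)) => // n.
exact: le_trans (mod_sum _ _ _) (HK n).
Qed.

Lemma cconvD w1 w2 l1 l2 : cconv w1 l1 -> cconv w2 l2 -> cconv (fun k => w1 k + w2 k) (l1 + l2).
Proof.
move=> H1 H2 e e0; have e2 : 0 < e / 2 by rewrite divr_gt0.
have [N1 {}H1] := H1 _ e2; have [N2 {}H2] := H2 _ e2.
exists (maxn N1 N2) => n; rewrite geq_max big_split/= => /andP[/H1 k1 /H2 k2].
set s1 := \sum_(_ <= _ < _) w1 _ in k1 *; set s2 := \sum_(_ <= _ < _) w2 _ in k2 *.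
have -> : s1 + s2 - (l1 + l2) = (s1 - l1) + (s2 - l2) by ring.
by apply: le_trans (modD _ _) _; lra.
Qed.

Lemma cconvZ w l c : cconv w l -> cconv (fun k => c * w k) (c * l).
Proof.
move=> H e e0; have m1 : 0 < 1 + mod c by rewrite ltr_wpDr// mod_ge0.
have [N HN] := H _ (divr_gt0 e0 m1); exists N => n /HN h.
rewrite -mulr_sumr -mulrBr modM.
apply: le_trans (ler_wpM2l (mod_ge0 c) h) _.
by rewrite mulrCA ler_piMr ?(ltW e0)// ler_pdivrMr// mul1r lerDr.
Qed.

Lemma cconv_ext w w' l : w =1 w' -> cconv w l -> cconv w' l.
Proof. by move=> /funext ->. Qed.

Lemma cconvB w1 w2 l1 l2 : cconv w1 l1 -> cconv w2 l2 -> cconv (fun k => w1 k - w2 k) (l1 - l2).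
Proof.
move=> H1 /(@cconvZ _ _ (-1)); rewrite mulN1r => /(cconvD H1).
by apply: cconv_ext => k; rewrite mulN1r.
Qed.

Lemma cconv_finite w N : (forall k, (N <= k)%N -> w k = 0) -> cconv w (\sum_(0 <= k < N) w k).
Proof.
move=> w0 e e0; exists N => n Nn.
rewrite (big_cat_nat (leq0n N) Nn)/= [X in _ + X - _](_ : _ = 0).
  by rewrite addr0 subrr mod0 ltW.
by rewrite big_nat_cond big1// => k /andP[/andP[/w0]].
Qed.

Lemma geom_sum (x : R) n : 0 <= x < 1 -> \sum_(0 <= k < n) x ^+ k <= (1 - x)^-1.
Proof.
move=> /andP[x0 x1]; have d0 : 0 < 1 - x by rewrite subr_gt0.
rewrite -(ler_pM2r d0) mulVf ?gt_eqF//.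
have : \sum_(0 <= k < n) x ^+ k * (1 - x) = 1 - x ^+ n.
  elim: n => [|n IH]; first by rewrite big_geq// expr0 subrr.
  by rewrite big_nat_recr//= IH exprS; ring.
by rewrite -mulr_suml => ->; rewrite gerBl exprn_ge0.
Qed.

Definition everywhere_conv (u : nat -> C) := forall z, exists l, cconv (fun k => u k * z ^+ k) l.

(** Convergence at [2 x] bounds the terms there, so those at [x] are dominated by a geometric series
    of ratio one half. *)
Lemma powser_abs u (x : R) : everywhere_conv u -> 0 <= x ->
  exists2 K : R, 0 <= K & forall n, \sum_(0 <= k < n) mod (u k) * x ^+ k <= K.
Proof.
move=> Hu x0; have [l /cconv_term[B B0 HB]] := Hu (2 * x)%:C.
exists (B * (1 - 2^-1)^-1); first by rewrite mulr_ge0// invr_ge0; lra.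
move=> n; apply: le_trans (_ : B * \sum_(0 <= k < n) 2^-1 ^+ k <= _); last first.
  by rewrite ler_wpM2l// geom_sum// invr_ge0 ler0n invf_lt1 ?ltr1n.
rewrite mulr_sumr; apply: ler_sum => k _; have := HB k.
rewrite modM modX mod_real normrM (ger0_norm x0) normr_nat exprMn => h.
rewrite exprVn ler_pdivlMr ?exprn_gt0//; apply: le_trans h.
by rewrite -mulrA [x ^+ k * _]mulrC.
Qed.

(** Strong induction: once all differences below index [m] vanish, evaluation of the difference
    series at a small [y] isolates [d m] up to [y * M]. *)
Lemma powser_unique (u v : nat -> C) (r : R) : 0 < r ->
  (forall z, mod z < r -> exists l, cconv (fun k => u k * z ^+ k) l /\ cconv (fun k => v k * z ^+ k) l) ->
  u =1 v.
Proof.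
move=> r0 H; pose d k := u k - v k.
suff D m : d m = 0 by move=> m; apply/eqP; rewrite -subr_eq0 -/(d m) D.
have Hd z : mod z < r -> cconv (fun k => d k * z ^+ k) 0.
  move=> /H[l [hu hv]]; rewrite -(subrr l); apply: cconv_ext (cconvB hu hv) => k.
  by rewrite -mulrBl.
pose x := r / 2; have x0 : 0 < x by rewrite divr_gt0.
have xr : mod x%:C < r by rewrite mod_real ger0_norm ?ltW// /x; lra.
have [B B0 HB] := cconv_term (Hd _ xr).
have {}HB k : mod (d k) * x ^+ k <= B by have := HB k; rewrite modM modX mod_real (ger0_norm (ltW x0)).
elim/ltn_ind: m => m IH.
apply/eqP; rewrite -mod_eq0 eq_le mod_ge0 andbT; apply/ler_addgt0Pr => e e0; rewrite add0r.
(* With [mod (d k) * x ^ k <= B] and [q = 2 y / x <= 1], the terms of index [k > m] at [y] are at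
   most [B * q ^ m.+1 * 2 ^ - k]; these bounds sum to at most [2 * B * q ^ m.+1 = y * M * y ^ m]. *)
pose M := B * 2 * (2 / x) ^+ m.+1.
have M0 : 0 <= M by rewrite !mulr_ge0// exprn_ge0// divr_ge0// ltW.
pose y := Num.min (x / 2) (e / (M + 1)).
have y0 : 0 < y by rewrite lt_min !divr_gt0// ltr_wpDl.
have yx : y <= x / 2 by rewrite ge_min lexx.
have yM : y * M <= e.
  apply: le_trans (_ : y * (M + 1) <= _); first by rewrite (ler_wpM2l (ltW y0))// lerDl.
  by rewrite -ler_pdivlMr ?ltr_wpDl// ge_min lexx orbT.
apply: le_trans yM.
have yr : mod y%:C < r by rewrite mod_real ger0_norm ?ltW//; move: yx; rewrite /x; lra.
have ym : 0 < y ^+ m by rewrite exprn_gt0.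
rewrite -(ler_pM2r ym).
have cm : cconv (fun k => if k == m then 0 else d k * y%:C ^+ k) (0 - d m * y%:C ^+ m).
  have : cconv (fun k => if k == m then d m * y%:C ^+ m else 0) (d m * y%:C ^+ m).
    have := @cconv_finite (fun k => if k == m then d m * y%:C ^+ m else 0) m.+1.
    rewrite big_nat_recr//= eqxx big_nat_cond big1 ?add0r => [H'|k /andP[/andP[_ km] _]]; last first.
      by rewrite ltn_eqF.
    by apply: H' => k mk; rewrite gtn_eqF.
  move=> /(cconvB (Hd _ yr)); apply: cconv_ext => k.
  by case: eqVneq => [->|_]; rewrite ?subrr ?subr0.
have := cconv_le (K := y * M * y ^+ m) _ cm.
rewrite sub0r modN modM modX mod_real (ger0_norm (ltW y0)); apply => n.
apply: le_trans (mod_sum _ _ _) _.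
pose q := 2 * y / x.
have q0 : 0 <= q by rewrite divr_ge0 ?mulr_ge0 ?ltW.
have q1 : q <= 1 by rewrite ler_pdivrMr//; lra.
apply: le_trans (_ : \sum_(0 <= k < n) B * q ^+ m.+1 * 2^-1 ^+ k <= _); last first.
  rewrite -mulr_sumr (_ : y * M * y ^+ m = B * q ^+ m.+1 * 2); last first.
    by rewrite /M /q (mulrAC 2) [in RHS]exprMn [y ^+ m.+1]exprS; ring.
  rewrite ler_wpM2l ?mulr_ge0 ?exprn_ge0//; apply: le_trans (geom_sum _ _) _.
    by rewrite invr_ge0 ler0n invf_lt1 ?ltr1n.
  by rewrite (_ : (1 - 2^-1)^-1 = 2 :> R)//; field.
apply: ler_sum => k _; case: eqVneq => [->|km].
  by rewrite mod0 !mulr_ge0 ?exprn_ge0.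
have [mk|] := ltnP m k; last first.
  rewrite leq_eqVlt (negbTE km)/= => /IH ->.
  by rewrite mul0r mod0 !mulr_ge0 ?exprn_ge0.
rewrite modM modX mod_real (ger0_norm (ltW y0)).
have -> : y = x * (q * 2^-1) by rewrite /q; field; rewrite gt_eqF.
rewrite [_ ^+ k]exprMn mulrA; apply: le_trans (ler_wpM2r _ (HB k)) _.
  by rewrite exprn_ge0// mulr_ge0.
rewrite -mulrA ler_wpM2l// exprMn ler_wpM2r ?exprn_ge0//.
by rewrite ler_wiXn2l.
Qed.

(* The derivative of [z ^+ k], by a recursion that avoids the exponent [k.-1]. *)
Fixpoint dpow (z : C) k : C := if k is k'.+1 then z ^+ k' + z * dpow z k' else 0.

Lemma dpowS (z : C) k : dpow z k.+1 = z ^+ k + z * dpow z k.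
Proof. by []. Qed.

Lemma mod_dpow (z : C) k : mod (dpow z k) <= (mod z + 1) ^+ k.
Proof.
elim: k => [|k IH]; first by rewrite [dpow z 0]/(0) mod0 expr0.
rewrite dpowS exprS mulrDl mul1r.
apply: le_trans (modD _ _) _; rewrite modM modX [leLHS]addrC lerD//.
  by rewrite ler_wpM2l ?mod_ge0.
by rewrite lerXn2r ?nnegrE ?addr_ge0 ?mod_ge0// lerDl.
Qed.

(** A bound geometric in [k], with no polynomial factor, so that absolute convergence at radius
    [mod z + 2] sums the errors of termwise differentiation at once. *)
Lemma dpow_error (z h : C) k : mod h <= 1 ->
  mod ((z + h) ^+ k - z ^+ k - dpow z k * h) <= mod h ^+ 2 * (mod z + 2) ^+ k.
Proof.
move=> h1; elim: k => [|k IH].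
  by rewrite [dpow z 0]/(0) !expr0 subrr mul0r subr0 mod0 mulr_ge0 ?sqr_ge0.
have -> : (z + h) ^+ k.+1 - z ^+ k.+1 - dpow z k.+1 * h =
  (z + h) * ((z + h) ^+ k - z ^+ k - dpow z k * h) + dpow z k * h ^+ 2.
  by rewrite dpowS 2!exprS; ring.
have z0 := mod_ge0 z.
apply: le_trans (modD _ _) _; rewrite modM [mod (dpow z k * _)]modM modX.
apply: le_trans (_ : (mod z + 1) * (mod h ^+ 2 * (mod z + 2) ^+ k) +
  (mod z + 2) ^+ k * mod h ^+ 2 <= _); last by rewrite [_ ^+ k.+1]exprS le_eqVlt; apply/orP; left; apply/eqP; ring.
apply: lerD.
  apply: ler_pM => //; rewrite ?mod_ge0//; apply: le_trans (modD _ _) _.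
  by rewrite lerD2l.
apply: ler_wpM2r; first exact: sqr_ge0.
apply: le_trans (mod_dpow z k) _; rewrite lerXn2r ?nnegrE ?addr_ge0//.
by rewrite lerD2l ler1n.
Qed.

Lemma powser_cderiv u (f : C -> C) z : (forall z, cconv (fun k => u k * z ^+ k) (f z)) ->
  exists l, cderiv f z l.
Proof.
move=> Hf; have Hu : everywhere_conv u by move=> w; exists (f w).
have z2 : 0 <= mod z + 2 by rewrite addr_ge0 ?mod_ge0.
have [K K0 HK] := powser_abs Hu z2.
have [|l Hl _] := @cconv_abs (fun k => u k * dpow z k) K.
  move=> n; apply: le_trans (HK n); apply: ler_sum => k _.
  rewrite modM ler_wpM2l ?mod_ge0//; apply: (le_trans (mod_dpow z k)).
  by rewrite lerXn2r ?nnegrE ?addr_ge0 ?mod_ge0// lerD2l ler1n.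
exists l => e e0.
exists (Num.min 1 (e / (K + 1))); first by rewrite lt_min ltr01 divr_gt0// ltr_wpDl.
move=> h; rewrite lt_min => /andP[/ltW h1]; rewrite ltr_pdivlMr ?ltr_wpDl// => h2.
apply: le_trans (_ : mod h ^+ 2 * K <= _); last first.
  by have := mod_ge0 h; nra.
have := cconvB (cconvB (Hf (z + h)) (Hf z)) (cconvZ h Hl).
rewrite (mulrC h); apply: cconv_le => n.
apply: le_trans (mod_sum _ _ _) _.
apply: le_trans (ler_wpM2l (sqr_ge0 _) (HK n)); rewrite mulr_sumr.
apply: ler_sum => k _.
have -> : u k * (z + h) ^+ k - u k * z ^+ k - h * (u k * dpow z k) =
  u k * ((z + h) ^+ k - z ^+ k - dpow z k * h) by ring.
rewrite modM mulrCA ler_wpM2l ?mod_ge0//.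
exact: dpow_error.
Qed.

Lemma taylor_entire (f : C -> C^o) c u : taylor_expansion f c u -> entire f.
Proof.
move=> /taylorP H z; apply/derivable_cderiv.
have [w|l Hl] := @powser_cderiv u (fun w => f (w + c)) (z - c).
  by have := H (w + c); rewrite addrK.
exists l => e e0; have [d d0 Hd] := Hl e e0; exists d => // h /Hd.
by rewrite (addrAC (z - c) h) subrK.
Qed.

End PowerSeries.

(** * Taylor expansion of entire functions *)

Section Cauchy.
Context {R : realType}.
Local Notation C := R[i].
Local Notation mod := (@Normc.normc R).

Lemma rcontM (f g : R -> C) : rcont f -> rcont g -> rcont (fun t => f t * g t).
Proof.
move=> cf cg t e e0.
have F0 : 0 < 1 + mod (f t) by rewrite ltr_wpDr ?mod_ge0.
have G0 : 0 < 1 + mod (g t) by rewrite ltr_wpDr ?mod_ge0.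
pose e1 := Num.min 1 (e / 2 / (1 + mod (f t))).
have e10 : 0 < e1 by rewrite lt_min ltr01 !divr_gt0.
have e20 : 0 < e / 2 / (1 + mod (g t)) by rewrite !divr_gt0.
have [d1 d10 H1] := cf t _ e20; have [d2 d20 H2] := cg t _ e10.
exists (Num.min d1 d2); first by rewrite lt_min d10.
move=> s; rewrite lt_min => /andP[/H1 h1 /H2]; rewrite le_min => /andP[h21 h22].
move: h1 h22; rewrite !ler_pdivlMr// => h1 h2.
have -> : f s * g s - f t * g t = (f s - f t) * g s + f t * (g s - g t) by ring.
apply: le_trans (modD _ _) _; rewrite !modM.
have gs : mod (g s) <= 1 + mod (g t).
  have -> : g s = (g s - g t) + g t by ring.
  by apply: le_trans (modD _ _) _; lra.
have := mod_ge0 (f s - f t); have := mod_ge0 (g s - g t); nra.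
Qed.

Lemma rcontB (f g : R -> C) : rcont f -> rcont g -> rcont (fun t => f t - g t).
Proof.
move=> cf cg t e e0; have e20 : 0 < e / 2 by rewrite divr_gt0.
have [d1 d10 H1] := cf t _ e20; have [d2 d20 H2] := cg t _ e20.
exists (Num.min d1 d2); first by rewrite lt_min d10.
move=> s; rewrite lt_min => /andP[/H1 h1 /H2 h2].
have -> : f s - g s - (f t - g t) = (f s - f t) - (g s - g t) by ring.
by apply: le_trans (modB _ _) _; lra.
Qed.

Lemma rcontX (f : R -> C) n : rcont f -> rcont (fun t => f t ^+ n).
Proof.
move=> cf; elim: n => [|n IH]; first exact: rcont_cst.
rewrite (_ : (fun t => f t ^+ n.+1) = (fun t => f t * f t ^+ n)); first exact: rcontM.
by apply/funext => t; rewrite exprS.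
Qed.

Lemma rcont_bounded (g : R -> C) (a b : R) : a <= b -> rcont g ->
  exists M : R, forall t, a <= t <= b -> mod (g t) <= M.
Proof.
move=> ab cg; have [|c _ Hc] := @EVT_max R (fun t => mod (g t)) a b ab.
  apply: continuous_subspaceT => t; apply/cvgrPdist_le => e e0.
  have [d d0 Hd] := cg t e e0; apply/nbhs_ballP; exists d => //= s.
  rewrite /ball/= distrC => /Hd h; apply: le_trans h.
  have := mod_dist (g t) (g s); have := mod_dist (g s) (g t); rewrite (modBC (g t)).
  by rewrite ler_norml; lra.
by exists (mod (g c)) => t tab; apply: Hc; rewrite in_itv.
Qed.

Definition cis (t : R) : C := cos t +i* sin t.

Lemma mod_cis t : mod (cis t) = 1.
Proof. by rewrite /= cos2Dsin2 sqrtr1. Qed.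

Lemma rderiv_cis t : rderiv cis t ('i * cis t).
Proof.
apply/rderivP; rewrite /cis /=; split; apply/is_derive_rd.
  by rewrite mul0r mul1r sub0r; exact: is_derive_cos.
by rewrite mul0r mul1r add0r; exact: is_derive_sin.
Qed.

Lemma cderivX n (z : C) : cderiv (fun w => w ^+ n.+1) z (n.+1%:R * z ^+ n).
Proof.
apply/is_derive_cderiv.
have := @is_deriveX _ _ (fun w : C^o => w : C^o) n.+1 (z : C^o) 1 1 (is_derive_id _ _).
by rewrite mulr_natl /GRing.scale/= mulr1 exprfctE.
Qed.

Definition cisV (t : R) : C := cos t -i* sin t.

Lemma cisVK t : cisV t * cis t = 1.
Proof.
apply/eqP; rewrite eq_complex /= -(cos2Dsin2 t); apply/andP; split; apply/eqP; ring.
Qed.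

Lemma rderiv_cisV t : rderiv cisV t (- 'i * cisV t).
Proof.
apply/rderivP; rewrite /cisV /=; split; apply/is_derive_rd.
  rewrite (_ : _ - _ = - sin t); last by ring.
  exact: is_derive_cos.
rewrite (_ : _ + _ = - cos t); last by ring.
exact: is_deriveN.
Qed.

Lemma cis2pi : cis (2 * pi) = cis 0.
Proof. by rewrite /cis mulr_natl sin2pi cos2pi sin0 cos0. Qed.

Lemma cisV2pi : cisV (2 * pi) = cisV 0.
Proof. by rewrite /cisV mulr_natl sin2pi cos2pi sin0 cos0. Qed.

Lemma cint_cisV n : cint (fun t => cisV t ^+ n.+1) 0 (2 * pi) = 0.
Proof.
rewrite (@cint_prim _ _ (fun t => ('i / n.+1%:R) * cisV t ^+ n.+1)); first by rewrite cisV2pi subrr.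
move=> t.
have := rderivZ ('i / n.+1%:R) (rderiv_comp (cderivX n (cisV t)) (rderiv_cisV t)).
rewrite (_ : _ * _ = cisV t ^+ n.+1)// exprS.
have n0 : n.+1%:R != 0 :> C by rewrite pnatr_eq0.
rewrite [LHS](_ : _ = - ('i * 'i) * (cisV t * cisV t ^+ n)); last by field.
by rewrite -expr2 sqr_i opprK mul1r.
Qed.

(** * Cauchy's coefficient formula on a disc *)

Section Disc.
Variables (f : C -> C) (df : forall z, exists l, cderiv f z l) (c : C) (r : R) (r0 : 0 < r).

Let gam t := c + r%:C * cis t.
(** This is [1 / (gam t - c)] on the circle. *)
Let E t := r%:C^-1 * cisV t.

Let rC0 : r%:C != 0 :> C. Proof. by rewrite fmorph_eq0 gt_eqF. Qed.

Let rc_cis : rcont cis. Proof. by move=> t; exact: rderiv_rcont1 (rderiv_cis t). Qed.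
Let rc_gam : rcont gam.
Proof.
have rG t : rderiv gam t (0 + r%:C * ('i * cis t)).
  by apply: rderivD; [exact: rderiv_cst|apply: rderivZ; exact: rderiv_cis].
by move=> t; exact: rderiv_rcont1 (rG t).
Qed.
Let rc_E : rcont E.
Proof.
by apply: rcontM; [exact: rcont_cst|move=> t; exact: rderiv_rcont1 (rderiv_cisV t)].
Qed.
Let EK t : E t * (r%:C * cis t) = 1.
Proof. by rewrite /E mulrACA mulVf// mul1r cisVK. Qed.

(** Cauchy's integral of [f w / (w - c) ^ n.+1] over the circle, divided by [2 pi 'i]; the
    differential [dw = 'i (w - c) dt] absorbs one power. *)
Definition disc_coef n : C := (2 * pi)%:C^-1 * cint (fun t => f (gam t) * E t ^+ n) 0 (2 * pi).

Let pi2_neq0 : (2 * pi : R)%:C != 0 :> C.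
Proof. by rewrite fmorph_eq0 mulf_neq0// gt_eqF// pi_gt0. Qed.

(* [q = dquot f z l] has a primitive on the plane, so its integral over the circle vanishes;
   iterating [W = (f o gam - f z) + ze * W * E] expands this into the Taylor series of [f] with an
   explicit remainder. *)
Lemma taylor_disc z : mod (z - c) < r -> cconv (fun k => disc_coef k * (z - c) ^+ k) (f z).
Proof.
move=> zr; set ze := z - c in zr *.
have [l Hl] := df z.
have cq := dquot_cont Hl df.
have [Q HQ] := primitive_off_point cq (fun w wz => dquot_deriv l wz (df w)).
set q := dquot f z l in cq HQ *.
pose W t := q (gam t) * (r%:C * cis t).
have rc_W : rcont W.
  apply: rcontM; first exact: (ccont_comp cq rc_gam).
  by apply: rcontM; [exact: rcont_cst|exact: rc_cis].
have rc_f : rcont (fun t => f (gam t)) by exact: (ccont_comp (cderiv_ccont df) rc_gam).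
have IW : cint W 0 (2 * pi) = 0.
  have : cint (fun t => 'i * W t) 0 (2 * pi) = 0.
    rewrite (@cint_prim _ _ (fun t => Q (gam t))).
      by rewrite /gam cis2pi subrr.
    move=> t; rewrite (_ : 'i * W t = q (gam t) * (0 + r%:C * ('i * cis t))); last by rewrite /W; ring.
    apply: rderiv_comp (HQ _) _.
    by apply: rderivD; [exact: rderiv_cst|apply: rderivZ; exact: rderiv_cis].
  rewrite cintZ// => /eqP; rewrite mulf_eq0 => /orP[|/eqP//].
  by rewrite eq_complex /= oner_eq0 andbF.
have WE t : W t = (f (gam t) - f z) + ze * (W t * E t).
  rewrite -(dquotE f z l) -/q /W.
  rewrite (_ : ze * _ = ze * q (gam t) * (E t * (r%:C * cis t))); last by ring.
  by rewrite EK mulr1 /gam /ze; ring.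
pose Rm N := cint (fun t => W t * E t ^+ N) 0 (2 * pi).
pose K n := cint (fun t => E t ^+ n) 0 (2 * pi).
have K0 : K 0%N = (2 * pi)%:C by rewrite /K cint_cst mul1r subr0.
have KS n : K n.+1 = 0.
  rewrite /K (_ : (fun t => E t ^+ n.+1) = (fun t => r%:C^-1 ^+ n.+1 * cisV t ^+ n.+1)).
    rewrite cintZ ?cint_cisV ?mulr0//; apply: rcontX => t.
    exact: rderiv_rcont1 (rderiv_cisV t).
  by apply/funext => t; rewrite /E exprMn.
have step N : Rm N = (2 * pi)%:C * disc_coef N - f z * K N + ze * Rm N.+1.
  rewrite /Rm [in LHS](_ : (fun t => W t * E t ^+ N) =
    (fun t => (f (gam t) * E t ^+ N - f z * E t ^+ N) + ze * (W t * E t ^+ N.+1))).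
    have rE n : rcont (fun t => E t ^+ n) by exact: rcontX.
    have r1 : rcont (fun t => f (gam t) * E t ^+ N) by exact: rcontM.
    have r2 : rcont (fun t => W t * E t ^+ N.+1) by exact: rcontM.
    have rc := rcont_cst.
    rewrite cintD; last by apply: rcontM.
      rewrite cintZ// cintB//; last exact: rcontM.
      by rewrite cintZ// (mulrA (2 * pi)%:C) divff// mul1r.
    by apply: rcontB => //; exact: rcontM.
  by apply/funext => t; rewrite [in LHS]WE exprS; ring.
have main N : (2 * pi)%:C * (\sum_(0 <= k < N.+1) disc_coef k * ze ^+ k - f z) = - (ze ^+ N.+1 * Rm N.+1).
  elim: N => [|N IH].
    have := step 0%N; rewrite K0 /Rm; under eq_fun do rewrite expr0 mulr1.
    rewrite IW big_nat1 expr0 mulr1 expr1 => /eqP; rewrite eq_sym addr_eq0 => /eqP <-.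
    ring.
  rewrite big_nat_recr//= mulrBr mulrDr addrAC -mulrBr IH step KS mulr0 subr0.
  by rewrite [ze ^+ N.+2]exprS; ring.
have pi0 : 0 < pi :> R by exact: pi_gt0.
have [||M HM] := @rcont_bounded W 0 (2 * pi) => //; first by rewrite mulr_ge0 ?ltW.
have M0 : 0 <= M by apply: le_trans (mod_ge0 (W 0)) (HM 0 _); rewrite lexx mulr_ge0 ?ltW.
have ER t : mod (E t) = r^-1.
  have := congr1 mod (EK t); rewrite !modM mod_cis mod1 mod_real (ger0_norm (ltW r0)) mulr1.
  by move=> h; apply: (mulIf (x := r)); rewrite ?gt_eqF// h mulVf// gt_eqF.
have RB N : mod (Rm N) <= 2 * (M * r^-1 ^+ N) * (2 * pi).
  have := @cint_bound _ (fun t => W t * E t ^+ N) (M * r^-1 ^+ N) 0 (2 * pi).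
  rewrite !subr0 [`|2 * pi|]ger0_norm; last by rewrite mulr_ge0 ?ltW.
  apply; first by apply: rcontM => //; exact: rcontX.
  move=> s /andP[s0 s1]; rewrite modM modX ER.
  apply: ler_wpM2r; first by rewrite exprn_ge0// invr_ge0 ltW.
  apply: HM; rewrite add0r; nra.
move=> e e0.
(* The remainder [ze ^ n * Rm n] decays like [(mod ze / r) ^ n]. *)
have [|N HN] := @expr_lt_eps _ (mod ze / r) (2 * M) e _ e0.
  by rewrite divr_ge0 ?mod_ge0 ?ltW//= ltr_pdivrMr// mul1r.
exists N.+1 => -[//|n] Nn.
have p20 : 0 < 2 * pi :> R by rewrite mulr_gt0.
rewrite -(ler_pM2l p20) -[X in X * mod _](ger0_norm (ltW p20)) -mod_real -modM main modN modM modX.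
apply: le_trans (ler_wpM2l (exprn_ge0 _ (mod_ge0 _)) (RB _)) _.
apply: le_trans (_ : 2 * pi * (2 * M * (mod ze / r) ^+ n.+1) <= _).
  by rewrite exprMn; lra.
by rewrite ler_pM2l//; apply: HN; rewrite ltnW.
Qed.

End Disc.

(** The coefficients obtained from the discs of radius 1, 2, 3, ... agree by uniqueness on the unit
    disc, so those of radius 1 serve at every point. *)
Lemma entire_taylor (f : C -> C^o) (c : C) : entire f -> exists u, taylor_expansion f c u.
Proof.
move=> ef; have df z : exists l, cderiv f z l by exact/derivable_cderiv.
pose u n := disc_coef f c n.+1%:R.
have agree m n : u m =1 u n.
  apply: (@powser_unique _ _ _ 1) => // z z1; exists (f (z + c)).
  have H (k : nat) : cconv (fun j => u k j * z ^+ j) (f (z + c)).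
    have := @taylor_disc f df c k.+1%:R _ (z + c); rewrite addrK; apply => //.
    by rewrite (lt_le_trans z1)// ler1n.
  by split.
exists (u 0%N); apply/taylorP => z.
pose n := Num.truncn (mod (z - c)).
have zn : mod (z - c) < n.+1%:R by exact: truncnS_gt.
have := @taylor_disc f df c n.+1%:R (ltr0Sn _ _) z zn.
by apply: cconv_ext => k; rewrite (agree 0%N n).
Qed.

End Cauchy.

(** * Growth of the weight *)

Section Weight.
Context {R : realType}.
Local Notation C := R[i].

Lemma deriv_on_nonnegE (f : R -> R) x l : deriv_on_nonneg f x l -> forall e : R, 0 < e ->
  exists2 d : R, 0 < d & forall y, 0 <= y -> `|y - x| < d ->
    `|f y - f x - l * (y - x)| <= e * `|y - x|.
Proof.
move=> /cvgrPdist_le H e e0; have := H e e0.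
rewrite near_withinE near_withinE => /nbhs_ballP[d /= d0 Hd]; exists d => // y y0 yd.
have [->|yx] := eqVneq y x; first by rewrite !subrr mulr0 subr0 normr0 mulr0.
have yx0 : y - x != 0 by rewrite subr_eq0.
have : `|l - (f y - f x) / (y - x)| <= e.
  by apply: Hd => //=; [rewrite /ball/= distrC|rewrite in_itv/= y0].
by rewrite -(ler_pM2r (x:=`|y - x|)) ?normr_gt0// -normrM mulrBl divfK// distrC.
Qed.

Lemma deriv_on_nonneg_rd (f : R -> R) x l : 0 < x -> deriv_on_nonneg f x l -> rd f x l.
Proof.
move=> x0 /deriv_on_nonnegE H e e0; have [d d0 Hd] := H e e0.
exists (Num.min d x); first by rewrite lt_min d0.
move=> h; rewrite lt_min => /andP[hd hx].
have := Hd (x + h); rewrite [x + h - x]addrAC subrr add0r; apply => //.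
by move: hx; rewrite ltr_norml; lra.
Qed.

Lemma deriv_on_nonneg_cont (f : R -> R) x l : deriv_on_nonneg f x l -> forall e : R, 0 < e ->
  exists2 d : R, 0 < d & forall y, 0 <= y -> `|y - x| < d -> `|f y - f x| <= e.
Proof.
move=> /deriv_on_nonnegE/(_ 1 ltr01)[d d0 H] e e0.
have m1 : 0 < 1 + `|l| by rewrite ltr_wpDr.
exists (Num.min d (e / (1 + `|l|))); first by rewrite lt_min d0 divr_gt0.
move=> y y0; rewrite lt_min => /andP[/(H y y0) h1].
rewrite ltr_pdivlMr// => h2.
have -> : f y - f x = (f y - f x - l * (y - x)) + l * (y - x) by ring.
by apply: le_trans (ler_normD _ _) _; rewrite normrM; lra.
Qed.

Lemma derive_rd (U : R * R -> R) (a v : R * R) l :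
  rd (fun h => U (h *: v + a)) 0 l -> 'D_v U a = l.
Proof.
move=> /is_derive_rd[/= dk dl]; rewrite -dl /derive.
set F := (X in lim (X @ _) = _); set G := (X in _ = lim (X @ _)).
suff -> : F = G by [].
by apply/funext => h; rewrite /F /G /= scale0r !add0r addr0 [h *: 1]mulr1.
Qed.

(** * The Laplacian of a radial function *)

Section Laplacian.
Variables (phi f1 f2 : R -> R).
Hypotheses (d1 : forall x, 0 < x -> rd phi x (f1 x)) (d2 : forall x, 0 < x -> rd f1 x (f2 x)).

Let U := on_R2 (radial_ext phi).

Let UE x y : U (x, y) = phi (Num.sqrt (x ^+ 2 + y ^+ 2)). Proof. by []. Qed.

Lemma rd_shift (f : R -> R) x l : rd f x l -> rd (fun h => f (h + x)) 0 l.
Proof.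
by move=> H e e0; have [d d0 Hd] := H e e0; exists d => // h /Hd; rewrite !add0r (addrC h).
Qed.

Let D1 r : 0 < r -> 'D_((1, 0) : R * R) U (r, 0) = f1 r.
Proof.
move=> r0; apply: derive_rd.
apply: (@rd_ext _ (fun h => phi (h + r)) _ _ _ r) => //.
  move=> s; rewrite subr0 ltr_norml => sr.
  rewrite /U /on_R2 /radial_ext /=; rewrite scaler0 add0r expr0n addr0 sqrtr_sqr.
  by rewrite /GRing.scale/= mulr1 ger0_norm//; lra.
exact/rd_shift/d1.
Qed.

Let D2 r y : 0 < r -> 'D_((0, 1) : R * R) U (r, y) =
  f1 (Num.sqrt (r ^+ 2 + y ^+ 2)) * (y / Num.sqrt (r ^+ 2 + y ^+ 2)).
Proof.
move=> r0; apply: derive_rd.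
have q0 : 0 < r ^+ 2 + y ^+ 2 by rewrite ltr_pwDl ?exprn_gt0// sqr_ge0.
apply: (@rd_ext _ (fun h => phi (Num.sqrt (r ^+ 2 + (h + y) ^+ 2))) _ _ _ r) => //.
  move=> s _; rewrite /U /on_R2 /radial_ext /=; rewrite scaler0 add0r.
  by rewrite /GRing.scale/= mulr1.
apply: (@rd_shift (fun h => phi (Num.sqrt (r ^+ 2 + h ^+ 2)))); apply/is_derive_rd.
set rho := Num.sqrt (r ^+ 2 + y ^+ 2).
have rho0 : 0 < rho by rewrite sqrtr_gt0.
have Dq : is_derive y (1 : R) (fun h => r ^+ 2 + h ^+ 2) (2 * y).
  apply/is_derive_rd => e e0; exists e => // h he.
  rewrite (_ : _ - _ - _ = h * h); last by ring.
  by rewrite normrM ler_wpM2r// ltW.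
rewrite (_ : y / rho = (2 * rho)^-1 * (2 * y)); last by field; rewrite gt_eqF.
have Ds := @is_derive1_comp _ (@Num.sqrt R) (fun h => r ^+ 2 + h ^+ 2) y _ _ (is_derive1_sqrt q0) Dq.
by have := @is_derive1_comp _ phi (Num.sqrt \o (fun h => r ^+ 2 + h ^+ 2)) y _ _ ((is_derive_rd _ _ _).2 (d1 rho0)) Ds.
Qed.

Let hpt (s r : R) : s *: ((1, 0) : R * R) + (r, 0) = (s + r, 0).
Proof.
by apply: injective_projections; rewrite /= ?[s *: 1]mulr1 ?[s *: 0]mulr0 ?addr0.
Qed.

Let vpt (s r : R) : s *: ((0, 1) : R * R) + (r, 0) = (r, s).
Proof.
by apply: injective_projections; rewrite /= ?[s *: 1]mulr1 ?[s *: 0]mulr0 ?addr0 ?add0r.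
Qed.

(** On the positive axis the horizontal second derivative is [f2]. The vertical first derivative at
    height [y] is [y * G y], whose derivative at 0 is [G 0 = f1 r / r] by continuity of [G]
    alone. *)
Lemma laplacian_radial r : 0 < r -> laplacian (radial_ext phi) r%:C = f2 r + f1 r / r.
Proof.
move=> r0; rewrite /laplacian [complex.Re _]/= [complex.Im _]/=; congr (_ + _).
  apply: derive_rd; apply: (@rd_ext _ (fun h => f1 (h + r)) _ _ _ r) => //.
    by move=> s; rewrite subr0 ltr_norml => sr; rewrite hpt D1//; lra.
  exact/rd_shift/d2.
apply: derive_rd => e e0.
pose G h := f1 (Num.sqrt (r ^+ 2 + h ^+ 2)) / Num.sqrt (r ^+ 2 + h ^+ 2).
have G0 : G 0 = f1 r / r by rewrite /G expr0n addr0 sqrtr_sqr ger0_norm ?ltW.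
have cG : {for 0, continuous G}.
  have cs : {for 0, continuous (fun h : R => Num.sqrt (r ^+ 2 + h ^+ 2))}.
    apply: (@continuous_comp _ _ _ (fun h : R => r ^+ 2 + h ^+ 2) (@Num.sqrt R)); last exact: sqrt_continuous.
    by apply: continuousD; [exact: cst_continuous|exact: exprn_continuous].
  have s0 : Num.sqrt (r ^+ 2 + 0 ^+ 2) = r by rewrite expr0n addr0 sqrtr_sqr ger0_norm ?ltW.
  apply: continuousM.
    apply: (@continuous_comp _ _ _ (fun h : R => Num.sqrt (r ^+ 2 + h ^+ 2)) f1) => //.
    by rewrite s0; exact: rd_continuous (d2 r0).
  by apply: continuousV => //; rewrite s0 gt_eqF.
move/cvgrPdist_le : cG => /(_ e e0)/nbhs_ballP[d /= d0 Hd].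
exists d => // h hd; rewrite !vpt !D2// mul0r mulr0 subr0 add0r.
have /Hd : ball 0 d h by rewrite /ball/= sub0r normrN.
rewrite G0 distrC => H.
rewrite (_ : _ - _ = (G h - f1 r / r) * h); last by rewrite /G; ring.
by rewrite normrM ler_wpM2r.
Qed.

End Laplacian.

Lemma rd_nondecr (f g : R -> R) (a b : R) : a <= b ->
  (forall t, a <= t <= b -> rd f t (g t)) -> (forall t, a <= t <= b -> 0 <= g t) -> f a <= f b.
Proof.
move=> ab H g0; have [c cab E] := MVT_rd ab H.
by rewrite -subr_ge0 E mulr_ge0 ?subr_ge0// g0.
Qed.

Lemma rd_sqr (k x : R) : rd (fun y => k * y ^+ 2) x (k * (2 * x)).
Proof.
move=> e e0; have k1 : 0 < 1 + `|k| by rewrite ltr_wpDr.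
exists (e / (1 + `|k|)); first by rewrite divr_gt0.
move=> h; rewrite ltr_pdivlMr// => he.
rewrite (_ : _ - _ - _ = k * (h * h)); last by ring.
by rewrite !normrM; have := normr_ge0 h; have := normr_ge0 k; nra.
Qed.

Lemma rdM (f g : R -> R) x k l : rd f x k -> rd g x l ->
  rd (fun y => f y * g y) x (f x * l + g x * k).
Proof. by move=> /is_derive_rd H /is_derive_rd H'; apply/is_derive_rd; exact: is_deriveM. Qed.

Lemma rd_id (x : R) : rd (fun y => y) x 1.
Proof. by apply/is_derive_rd; exact: is_derive_id. Qed.

(** * Monotonicity, growth and gaps of the weight *)

Section WeightFacts.
Variables (phi : R -> R) (hphi : weight phi).

(** Only these consequences of [weight] feed the growth estimates. The last clause says that the
    Laplacian tends to infinity: it is comparable to [tau ^ -2], and [tau] tends to 0. *)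
Lemma weight_derivs : exists f1 f2 : R -> R, [/\ forall x, 0 < x -> rd phi x (f1 x),
  forall x, 0 < x -> rd f1 x (f2 x),
  exists d B : R, 0 < d /\ forall x, 0 <= x < d -> `|f1 x| <= B,
  forall x, 0 < x -> 0 < f2 x + f1 x / x &
  forall K : R, exists2 t, 0 < t & forall x, t <= x -> K <= f2 x + f1 x / x].
Proof.
case: hphi => _ [f1 [f2 [H1 H2 _]]] Lap [tau Htau]; exists f1, f2.
have d1 x : 0 < x -> rd phi x (f1 x) by move=> x0; apply: deriv_on_nonneg_rd => //; apply/H1/ltW.
have d2 x : 0 < x -> rd f1 x (f2 x) by move=> x0; apply: deriv_on_nonneg_rd => //; apply/H2/ltW.
split=> //.
- have [d d0 Hd] := deriv_on_nonneg_cont (H2 0 (lexx _)) ltr01.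
  exists d, (1 + `|f1 0|); split=> // x /andP[x0 xd].
  have -> : f1 x = (f1 x - f1 0) + f1 0 by ring.
  by apply: le_trans (ler_normD _ _) _; rewrite lerD2r Hd// subr0 ger0_norm.
- move=> x x0; rewrite -(laplacian_radial d1 d2)//; apply: Lap.
  by rewrite eq_complex /= negb_and gt_eqF.
move=> K; have [c c0 Hc] := scale_far Htau.
(* With [tau] below this, the Laplacian [D] satisfies [D ^ (-1/2) <= c * tau <= 1 / (|K| + 1)],
   hence [D >= (|K| + 1) ^ 2 >= K]. *)
have e0 : 0 < (c * (`|K| + 1))^-1 by rewrite invr_gt0 mulr_gt0// ltr_wpDl.
have /cvgrPdist_le/(_ _ e0)[t [_ Ht]] := scale_lim Htau.
exists (Num.max 1 (t + 1)) => [|x]; first by rewrite lt_max ltr01.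
rewrite ge_max => /andP[x1 xt]; have x0 : 0 < x by apply: lt_le_trans x1.
have := Ht x; rewrite sub0r normrN ger0_norm ?(ltW (scale_gt0 Htau _))// => H.
have {}H : tau x%:C <= (c * (`|K| + 1))^-1 by apply: H; apply: lt_le_trans xt; rewrite ltrDl.
have [|_] := Hc x%:C; first by rewrite /= expr0n addr0 sqrtr_sqr ger0_norm //; exact: ltW.
rewrite (laplacian_radial d1 d2)//; set D := _ + _.
have D0 : 0 < D.
  by rewrite /D -(laplacian_radial d1 d2)//; apply: Lap; rewrite eq_complex /= negb_and gt_eqF.
have sD0 : 0 < Num.sqrt D by rewrite sqrtr_gt0.
rewrite powRN powR12_sqrt ?(ltW D0)// => h.
have {}h : (Num.sqrt D)^-1 <= (`|K| + 1)^-1.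
  apply: (le_trans h); apply: le_trans (ler_wpM2l (ltW c0) H) _.
  by rewrite invfM mulrA divff ?gt_eqF// mul1r.
move: h; rewrite lef_pV2 ?posrE// ?ltr_wpDl// => h.
have := sqr_sqrtr (ltW D0); have := ler_norm K; have := normr_ge0 K; nra.
Qed.

(* [x * f1 x] has positive derivative and tends to [0] at the origin. *)
Lemma weight_deriv_gt0 f1 f2 : (forall x, 0 < x -> rd f1 x (f2 x)) ->
  (exists d B : R, 0 < d /\ forall x, 0 <= x < d -> `|f1 x| <= B) ->
  (forall x, 0 < x -> 0 < f2 x + f1 x / x) -> forall x, 0 < x -> 0 < f1 x.
Proof.
move=> d2 [d [B [d0 HB]]] Lap.
pose g (x : R) := x * f1 x.
have dg x : 0 < x -> rd g x (x * f2 x + f1 x * 1) by move=> x0; apply: rdM (d2 _ x0); exact: rd_id.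
have dg0 x : 0 < x -> 0 < x * f2 x + f1 x * 1.
  move=> x0; rewrite (_ : _ + _ = x * (f2 x + f1 x / x)); last by field; rewrite gt_eqF.
  by rewrite mulr_gt0// Lap.
have incr s x : 0 < s -> s < x -> g s < g x.
  move=> s0 sx.
  have H t : s <= t <= x -> rd g t (t * f2 t + f1 t * 1).
    by move=> /andP[st tx]; apply: dg; apply: lt_le_trans st.
  have [c /andP[sc cx] E] := MVT_rd (ltW sx) H.
  by rewrite -subr_gt0 E mulr_gt0 ?subr_gt0// dg0//; apply: lt_le_trans sc.
have ge0 x : 0 < x -> 0 <= g x.
  move=> x0; apply/ler_addgt0Pr => e e0.
  have B1 : 0 < `|B| + 1 by rewrite ltr_wpDl.
  pose s := Num.min (x / 2) (Num.min (d / 2) (e / (`|B| + 1))).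
  have s0 : 0 < s by rewrite !lt_min !divr_gt0.
  have sx : s <= x / 2 by rewrite ge_min lexx.
  have sd : s <= d / 2 by rewrite !ge_min lexx orbT.
  have se : s <= e / (`|B| + 1) by rewrite !ge_min lexx !orbT.
  move: se; rewrite ler_pdivlMr// => se.
  have : g s < g x by apply: incr => //; lra.
  have : `|f1 s| <= B by apply: HB; lra.
  rewrite /g ler_norml => /andP[h1 h2]; have := ler_norm B; nra.
move=> x x0; have : 0 < g x.
  by apply: (@le_lt_trans _ _ (g (x / 2))); [apply: ge0; rewrite divr_gt0|apply: incr; lra].
by rewrite /g pmulr_rgt0.
Qed.

Lemma weight_nondecr s r : 0 <= s -> s <= r -> phi s <= phi r.
Proof.
have [f1 [f2 [d1 d2 B0 Lap _]]] := weight_derivs.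
have f10 := weight_deriv_gt0 d2 B0 Lap.
have pos x y : 0 < x -> x <= y -> phi x <= phi y.
  move=> x0 xy; apply: (@rd_nondecr _ f1) => // t /andP[xt _].
    by apply: d1; apply: lt_le_trans xt.
  by apply/ltW/f10; apply: lt_le_trans xt.
rewrite le_eqVlt => /orP[/eqP<-|]; last exact: pos.
rewrite le_eqVlt => /orP[/eqP<-//|r0].
(* The sign of the derivative is known only away from the origin; the value at 0 is reached by
   continuity. *)
have [g1 [_ [H1 _ _]]] := weight_C2 hphi.
apply/ler_addgt0Pr => e e0; have [d d0 Hd] := deriv_on_nonneg_cont (H1 0 (lexx _)) e0.
pose s' := Num.min (d / 2) r.
have s0 : 0 < s' by rewrite lt_min r0 divr_gt0.
have sd : s' <= d / 2 by rewrite ge_min lexx.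
have : `|phi s' - phi 0| <= e by apply: Hd; rewrite ?subr0 ?ger0_norm ?ltW//; lra.
have : phi s' <= phi r by apply: pos => //; rewrite ge_min lexx orbT.
by rewrite ler_norml; lra.
Qed.

Lemma weight_growth K : exists2 t, 0 < t & forall s r, t <= s -> s <= r ->
  K * (r ^+ 2 - s ^+ 2) <= phi r - phi s.
Proof.
have [f1 [f2 [d1 d2 B0 Lap Lim]]] := weight_derivs.
have f10 := weight_deriv_gt0 d2 B0 Lap.
wlog K0 : K / 0 <= K.
  move=> W; have [K0|K0] := leP 0 K; first exact: W.
  have [t t0 Ht] := W 0 (lexx _); exists t => // s r ts sr.
  apply: le_trans (Ht s r ts sr); rewrite mul0r mulr_le0_ge0 ?(ltW K0)//.
  by rewrite subr_ge0 lerXn2r ?nnegrE//; lra.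
(* Past [t] the derivative of [x * f1 x] is at least [8 K x], so [x * f1 x - 4 K x ^ 2] is
   nondecreasing. From [2 t] on, the loss [4 K t ^ 2] is at most [K r ^ 2], which leaves
   [f1 r >= 2 K r], to be integrated. *)
have [t t0 Ht] := Lim (8 * K).
exists (2 * t); first by rewrite mulr_gt0.
have f1K r : 2 * t <= r -> K * (2 * r) <= f1 r.
  move=> tr; have r0 : 0 < r by lra.
  have := @rd_nondecr (fun x => x * f1 x - 4 * K * x ^+ 2) (fun x => (x * f2 x + f1 x * 1) - 4 * K * (2 * x)) t r.
  have -> : (t <= r) = true by lra.
  move=> /(_ isT) H; have {}H : t * f1 t - 4 * K * t ^+ 2 <= r * f1 r - 4 * K * r ^+ 2.
    apply: H => x /andP[tx xr]; have x0 : 0 < x by lra.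
      by apply: rdB (rd_sqr _ _); apply: rdM (d2 _ x0); exact: rd_id.
    have := Ht x tx; rewrite -(ler_pM2l x0).
    rewrite (_ : x * (f2 x + _) = x * f2 x + f1 x * 1); last by field; rewrite gt_eqF.
    by lra.
  have ft := f10 t t0.
  have : r * (K * (2 * r)) <= r * f1 r.
    have : 0 <= t * f1 t by rewrite mulr_ge0 ?ltW.
    have : K * (4 * t ^+ 2) <= K * r ^+ 2 by apply: ler_wpM2l => //; nra.
    have : 0 <= K * r ^+ 2 by rewrite mulr_ge0 ?sqr_ge0.
    by lra.
  by rewrite ler_pM2l.
move=> s r ts sr.
have := @rd_nondecr (fun x => phi x - K * x ^+ 2) (fun x => f1 x - K * (2 * x)) s r sr.
suff : (forall x, s <= x <= r -> rd (fun x => phi x - K * x ^+ 2) x (f1 x - K * (2 * x))) /\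
    (forall x, s <= x <= r -> 0 <= f1 x - K * (2 * x)).
  by move=> [h1 h2] /(_ h1 h2); lra.
split=> x /andP[sx xr]; last by rewrite subr_ge0 f1K//; lra.
by apply: rdB (rd_sqr _ _); apply: d1; lra.
Qed.

Lemma weight_quadratic K : exists c, forall r, 0 <= r -> K * r ^+ 2 <= phi r + c.
Proof.
have [t t0 Ht] := weight_growth K.
exists (`|K| * t ^+ 2) => r r0.
have p0 := weight_ge0 hphi.
have [rt|tr] := leP r t.
  have : K * r ^+ 2 <= `|K| * t ^+ 2.
    apply: (@le_trans _ _ (`|K| * r ^+ 2)); first by rewrite ler_wpM2r ?sqr_ge0// ler_norm.
    by apply: ler_wpM2l => //; nra.
  by have := p0 r r0; lra.
have := Ht t r (lexx _) (ltW tr); have := p0 t (ltW t0).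
have : K * t ^+ 2 <= `|K| * t ^+ 2 by rewrite ler_wpM2r ?sqr_ge0// ler_norm.
lra.
Qed.

Lemma weight_gap rho c0 B : 0 <= rho -> rho < 1 -> 0 <= c0 ->
  exists c, forall r, 0 <= r -> phi (rho * r + c0) <= phi r - B * r ^+ 2 + c.
Proof.
move=> h0 h1 c00.
(* For large [r] one has [rho r + c0 <= s r], and growth from [s r] to [r] at rate
   [|B| / (1 - s ^ 2)] gains exactly [|B| r ^ 2]. For [r <= T] the additive constant covers
   everything. *)
pose s := (1 + rho) / 2; have s1 : s < 1 by rewrite /s; lra.
have s0 : 0 < s by rewrite /s; lra.
have q0 : 0 < 1 - s ^+ 2 by nra.
have [t t0 Ht] := weight_growth (`|B| / (1 - s ^+ 2)).
pose T := Num.max (t / s) (c0 / (s - rho)).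
have T0 : 0 < T by rewrite lt_max divr_gt0.
exists (phi (rho * T + c0) + `|B| * T ^+ 2) => r r0.
have [rT|Tr] := leP r T.
  have : phi (rho * r + c0) <= phi (rho * T + c0).
    by apply: weight_nondecr; [rewrite addr_ge0// mulr_ge0|rewrite lerD2r ler_wpM2l].
  have : B * r ^+ 2 <= `|B| * T ^+ 2.
    apply: (@le_trans _ _ (`|B| * r ^+ 2)); first by rewrite ler_wpM2r ?sqr_ge0// ler_norm.
    by apply: ler_wpM2l => //; nra.
  by have := weight_ge0 hphi r0; lra.
have rs : rho * r + c0 <= s * r.
  have : c0 / (s - rho) <= r by apply: le_trans (ltW Tr); rewrite le_max lexx orbT.
  by rewrite ler_pdivrMr; [lra|rewrite /s; lra].
have tsr : t <= s * r.
  have : t / s <= r by apply: le_trans (ltW Tr); rewrite le_max lexx.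
  by rewrite ler_pdivrMr// mulrC.
have h : phi (rho * r + c0) <= phi (s * r) by apply: weight_nondecr => //; rewrite addr_ge0// mulr_ge0.
have := Ht (s * r) r tsr; rewrite (_ : _ * (_ - _) = `|B| * r ^+ 2); last first.
  by move: (`|B|) => b; field; rewrite gt_eqF.
have -> : (s * r <= r) = true by rewrite ler_piMl// ltW.
move=> /(_ isT) h2.
have : B * r ^+ 2 <= `|B| * r ^+ 2 by rewrite ler_wpM2r ?sqr_ge0// ler_norm.
have : 0 <= `|B| * T ^+ 2 by rewrite mulr_ge0 ?sqr_ge0.
have := weight_ge0 hphi (addr_ge0 (mulr_ge0 h0 (ltW T0)) c00).
lra.
Qed.

(** The absolute value turns [phi] into a continuous function on the whole line, in the form used
    for the measurability of the weight factor. *)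
Lemma weight_continuous : continuous (fun t => phi `|t : R|).
Proof.
have [g1 [_ [H1 _ _]]] := weight_C2 hphi.
move=> x; apply/cvgrPdist_le => e e0.
have [d d0 Hd] := deriv_on_nonneg_cont (H1 `|x| (normr_ge0 _)) e0.
apply/nbhs_ballP; exists d => // y; rewrite /ball/= => xy.
rewrite distrC; apply: Hd => //; apply: le_lt_trans xy.
by rewrite (distrC x); apply: ler_dist_dist.
Qed.

End WeightFacts.
End Weight.

(** * Invariance of plane Lebesgue measure *)

Section PlaneMeasure.
Context {R : realType}.
Local Notation C := R[i].
Local Notation mod := (@Normc.normc R).
Local Notation mu := (@lebesgue_measure R).
Local Notation mR := (measurableTypeR R).

(** The product sigma-algebra is generated by rectangles, so an open set is written as a countable
    union of rational squares; squares not inside [A] are replaced by the empty set, which keeps the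
    full countable index type. *)
Lemma plane_open_measurable (A : set (mR * mR)) :
  (forall p, A p -> exists2 d : R, 0 < d &
    forall q, `|q.1 - p.1| < d -> `|q.2 - p.2| < d -> A q) -> measurable A.
Proof.
move=> H.
pose S (t : rat * rat * rat) : set (mR * mR) :=
  `]ratr t.1.1 - ratr t.2, ratr t.1.1 + ratr t.2[ `*` `]ratr t.1.2 - ratr t.2, ratr t.1.2 + ratr t.2[.
pose F t := if `[< S t `<=` A >] then S t else set0.
rewrite (_ : A = \bigcup_t F t).
  apply: countable_bigcupT_measurable => // t; rewrite /F; case: ifP => // _.
  by apply: measurableX; exact: measurable_itv.
apply/seteqP; split=> [p Ap|p [t _]]; last by rewrite /F; case: ifPn => // /asboolP; exact.
have [d d0 Hd] := H p Ap.
have [e] : exists e, ratr e \in `]0, (d / 2)[ by apply: rat_in_itvoo; rewrite divr_gt0.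
rewrite in_itv/= => /andP[e0 ed].
have [q1] : exists q, ratr q \in `](p.1 - ratr e), (p.1 + ratr e)[ by apply: rat_in_itvoo; lra.
have [q2] : exists q, ratr q \in `](p.2 - ratr e), (p.2 + ratr e)[ by apply: rat_in_itvoo; lra.
rewrite !in_itv/= => /andP[h1 h2] /andP[h3 h4].
exists (q1, q2, e) => //; rewrite /F; case: ifPn => [_|/asboolP []].
  by rewrite /S; split => /=; rewrite in_itv/=; lra.
move=> q [] /=; rewrite !in_itv/= => /andP[k1 k2] /andP[k3 k4].
by apply: Hd; rewrite ltr_norml; lra.
Qed.

Definition cont2 (F : C -> R) := forall z (e : R), 0 < e ->
  exists2 d : R, 0 < d & forall w, mod (w - z) < d -> `|F w - F z| <= e.

Lemma cont2_measurable (F : C -> R) : cont2 F -> measurable_fun setT (on_R2 F : mR * mR -> R).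
Proof.
move=> cF; apply: (measurability _ (RGenOpens.measurableE R)).
move=> /= _ [_ [a [b ->] <-]]; rewrite setTI; apply: plane_open_measurable => p /=.
rewrite /on_R2 in_itv/= => /andP[ha hb].
have e0 : 0 < Num.min (F (p.1 +i* p.2) - a) (b - F (p.1 +i* p.2)) / 2.
  by rewrite divr_gt0// lt_min !subr_gt0 ha.
have [d d0 Hd] := cF (p.1 +i* p.2) _ e0.
exists (d / 2) => [|q q1 q2]; first by rewrite divr_gt0.
have /Hd : mod (q.1 +i* q.2 - (p.1 +i* p.2)) < d.
  by apply: le_lt_trans (mod_le_ReIm _) _ => /=; lra.
rewrite in_itv/= ler_norml.
set m := Num.min _ _; have m1 : m <= F (p.1 +i* p.2) - a by rewrite ge_min lexx.
have m2 : m <= b - F (p.1 +i* p.2) by rewrite ge_min lexx orbT.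
lra.
Qed.

Lemma affine_measurable (a b c : R) :
  measurable_fun setT (fun q : mR * mR => (a * q.1 + b * q.2 + c : mR)).
Proof.
apply: measurable_funD; last exact: measurable_cst.
by apply: measurable_funD; apply: measurable_funM => //; exact: measurable_cst.
Qed.

Lemma affine_pair_measurable (a b c a' b' c' : R) :
  measurable_fun setT (fun q : mR * mR => (a * q.1 + b * q.2 + c, a' * q.1 + b' * q.2 + c') : mR * mR).
Proof. by apply: measurable_fun_pair; exact: affine_measurable. Qed.

Lemma ge0_integral_shift (f : R -> \bar R) (c : R) : measurable_fun (setT : set mR) f ->
  (forall x, 0 <= f x)%E -> (\int[mu]_x f (x + c)%R = \int[mu]_x f x)%E.
Proof.
move=> mf f0.
have mc : measurable_fun setT (fun x : mR => (x + c)%R : mR).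
  by apply: measurable_funD => //; exact: measurable_cst.
have := ge0_integral_pushforward mc mu measurableT mf (fun y _ => f0 y).
rewrite preimage_setT => <-.
apply: eq_measure_integral => //= A mA _.
apply/esym/lebesgue_measure_unique => //= _ [[a b]] _ <-.
rewrite /pushforward (_ : _ @^-1` _ = `]a - c, b - c]%classic); last first.
  by apply/seteqP; split => x /=; rewrite !in_itv/=; lra.
rewrite /= !lebesgue_measure_itv/= !lte_fin.
rewrite (_ : (a - c < b - c) = (a < b)); last by lra.
by case: ifP => // _; rewrite -!EFinB; congr EFin; ring.
Qed.

Lemma ge0_integral_dilate (f : R -> \bar R) (r : R) : 0 < r -> measurable_fun (setT : set mR) f ->
  (forall x, 0 <= f x)%E -> (\int[mu]_x f (r * x)%R = r^-1%:E * \int[mu]_x f x)%E.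
Proof.
move=> r0 mf f0.
have mc : measurable_fun setT (fun x : mR => (r * x)%R : mR).
  by apply: measurable_funM => //; exact: measurable_cst.
have := ge0_integral_pushforward mc mu measurableT mf (fun y _ => f0 y).
rewrite preimage_setT => <-.
have rV0 : 0 <= r^-1 by rewrite invr_ge0 ltW.
rewrite -[RHS](ge0_integral_mscale mu measurableT (NngNum rV0) mf (fun x _ => f0 x)).
apply: eq_measure_integral => //= A mA _.
pose m := measure_function_pushforward__canonical__measure_function_Measure mu mc.
(* Uniqueness of Lebesgue measure is applied to [r] times the pushforward, the multiple that gives
   intervals their length. *)
suff E : mu A = mscale (NngNum (ltW r0)) m A.
  transitivity (r^-1%:E * mu A)%E => //.
  rewrite E -[mscale _ _ _]/(r%:E * pushforward mu (fun x : mR => (r * x)%R : mR) A)%E.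
  by rewrite muleA -EFinM mulVf ?gt_eqF// mul1e.
apply: lebesgue_measure_unique => //= _ [[a b]] _ <-.
rewrite /mscale /= /pushforward (_ : _ @^-1` _ = `]a / r, b / r]%classic); last first.
  by apply/seteqP; split => x /=; rewrite !in_itv/= ltr_pdivrMr// ler_pdivlMr// mulrC.
rewrite /= !lebesgue_measure_itv/= !lte_fin.
rewrite ltr_pM2r ?invr_gt0//.
case: ifP => // _; last by rewrite mule0.
by rewrite -!EFinB -EFinM; congr EFin; field; rewrite gt_eqF.
Qed.

Local Notation mu2 := (mu \x mu)%E.

Section Tonelli.
Variables (F : mR * mR -> \bar R) (mF : measurable_fun setT F) (F0 : forall q, (0 <= F q)%E).

Lemma integral_plane1 : (\int[mu2]_q F q = \int[mu]_x \int[mu]_y F (x, y))%E.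
Proof. exact: fubini_tonelli1. Qed.

Lemma integral_plane2 : (\int[mu2]_q F q = \int[mu]_y \int[mu]_x F (x, y))%E.
Proof. by rewrite integral_plane1 fubini_tonelli. Qed.

End Tonelli.

Section Invariance.
Variables (F : mR * mR -> \bar R) (mF : measurable_fun setT F) (F0 : forall q, (0 <= F q)%E).

Lemma affine_comp_measurable (a b c a' b' c' : R) : measurable_fun setT
  (fun q : mR * mR => F (a * q.1 + b * q.2 + c, a' * q.1 + b' * q.2 + c')%R).
Proof. by apply: (measurableT_comp mF); exact: affine_pair_measurable. Qed.

(** Integrating first along the sheared axis makes every inner integral a translate. The
    coefficients 0 and 1 stay explicit so that the integrand is literally an instance of
    [affine_comp_measurable]. *)
Lemma integral_shear1 (t c : R) :
  (\int[mu2]_q F (1 * q.1 + t * q.2 + c, 0 * q.1 + 1 * q.2 + 0)%R = \int[mu2]_q F q)%E.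
Proof.
rewrite integral_plane2//; last exact: affine_comp_measurable.
rewrite (integral_plane2 mF F0); apply: eq_integral => y _ /=.
rewrite -[RHS](ge0_integral_shift (t * y + c))//; last first.
  by apply: (measurableT_comp mF); apply: measurable_fun_pair => //; exact: measurable_cst.
by apply: eq_integral => x _; congr (F (_, _)); ring.
Qed.

Lemma integral_shear2 (t c : R) :
  (\int[mu2]_q F (1 * q.1 + 0 * q.2 + 0, t * q.1 + 1 * q.2 + c)%R = \int[mu2]_q F q)%E.
Proof.
rewrite integral_plane1//; last exact: affine_comp_measurable.
rewrite (integral_plane1 mF F0); apply: eq_integral => x _ /=.
rewrite -[RHS](ge0_integral_shift (t * x + c))//; last first.
  by apply: (measurableT_comp mF); apply: measurable_fun_pair => //; exact: measurable_cst.
by apply: eq_integral => y _; congr (F (_, _)); ring.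
Qed.

End Invariance.

Lemma integral_dilate_plane (F : mR * mR -> \bar R) (r : R) : 0 < r ->
  measurable_fun setT F -> (forall q, (0 <= F q)%E) ->
  (\int[mu2]_q F (r * q.1 + 0 * q.2 + 0, 0 * q.1 + r * q.2 + 0)%R = (r^-1 ^+ 2)%:E * \int[mu2]_q F q)%E.
Proof.
move=> r0 mF F0.
rewrite integral_plane1//; last exact: affine_comp_measurable.
have mS x : measurable_fun (setT : set mR) (fun y : mR => F (x, y)).
  by apply: (measurableT_comp mF); apply: measurable_fun_pair => //; exact: measurable_cst.
transitivity (\int[mu]_x (r^-1%:E * \int[mu]_y F (r * x, y)%R))%E.
  apply: eq_integral => x _ /=; rewrite -ge0_integral_dilate//.
  by apply: eq_integral => y _; congr (F (_, _)); ring.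
have mI : measurable_fun (setT : set mR) (fun x => \int[mu]_y F (x, y))%E.
  exact: measurable_fun_fubini_tonelli_F.
rewrite ge0_integralZl//; first last.
- by rewrite lee_fin invr_ge0 ltW.
- by move=> x _; exact: integral_ge0.
- apply: (measurableT_comp mI); apply: measurable_funM => //; exact: measurable_cst.
rewrite (ge0_integral_dilate r0 mI) => [|x]; last exact: integral_ge0.
by rewrite muleA -EFinM -expr2 -integral_plane1.
Qed.

End PlaneMeasure.

(** * Plane integrals of functions of a complex variable *)

Section PlaneIntegral.
Context {R : realType}.
Local Notation C := R[i].
Local Notation mod := (@Normc.normc R).
Local Notation mu := (@lebesgue_measure R).
Local Notation mR := (measurableTypeR R).
Local Notation mu2 := (mu \x mu)%E.

Definition mes (F : C -> R) := measurable_fun setT (on_R2 F : mR * mR -> R).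

Definition plane_int (F : C -> R) : \bar R := (\int[mu2]_q (on_R2 F q)%:E)%E.
Local Notation J := plane_int.

Lemma mesE F : mes F -> measurable_fun setT (fun q : mR * mR => (on_R2 F q)%:E).
Proof. by move=> mF; exact/measurable_EFinP. Qed.

Lemma mes_cont F : cont2 F -> mes F. Proof. exact: cont2_measurable. Qed.
Lemma mes_cst k : mes (fun=> k). Proof. exact: measurable_cst. Qed.
Lemma mesM F G : mes F -> mes G -> mes (fun z => F z * G z).
Proof. exact: measurable_funM. Qed.
Lemma mesD F G : mes F -> mes G -> mes (fun z => F z + G z).
Proof. exact: measurable_funD. Qed.
Lemma mes_comp (g : R -> R) F : measurable_fun (setT : set mR) (g : mR -> mR) -> mes F ->
  mes (fun z => g (F z)).
Proof. exact: measurableT_comp. Qed.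
Lemma mes_powR F p : mes F -> mes (fun z => F z `^ p).
Proof. by move=> mF; apply: (mes_comp (g := @powR R ^~ p)) => //; exact: measurable_powR. Qed.

Lemma mes_affine F a c : mes F -> mes (fun z => F (a * z + c)).
Proof.
move=> mF; case: a c => [a b] [c d].
have := measurableT_comp mF (affine_pair_measurable a (- b) c b a d).
rewrite /mes (_ : on_R2 F \o _ = on_R2 (fun z => F ((a +i* b) * z + (c +i* d))))//.
apply/funext => -[x y]; rewrite /on_R2 /=; congr F.
by apply/eqP; rewrite eq_complex /=; apply/andP; split; apply/eqP; ring.
Qed.

Lemma plane_int_ge0 F : (forall z, 0 <= F z) -> (0 <= J F)%E.
Proof. by move=> F0; apply: integral_ge0 => q _; rewrite lee_fin; exact: F0. Qed.

Lemma plane_int_le F G : mes F -> mes G -> (forall z, 0 <= F z) -> (forall z, F z <= G z) -> (J F <= J G)%E.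
Proof.
move=> mF mG F0 FG; apply: ge0_le_integral => //.
- by move=> q _; rewrite lee_fin; exact: F0.
- exact: mesE.
- exact: mesE.
- by move=> q _; rewrite lee_fin; exact: FG.
Qed.

Lemma plane_int_Z F (k : R) : mes F -> (forall z, 0 <= F z) -> (0 <= k)%R -> (J (fun z => k * F z)%R = k%:E * J F)%E.
Proof.
move=> mF F0 k0; rewrite /J /on_R2; under eq_integral do rewrite EFinM.
rewrite ge0_integralZl ?lee_fin//; first exact: (mesE mF).
by move=> q _; rewrite lee_fin; exact: F0.
Qed.

Lemma plane_int_D F G : mes F -> mes G -> (forall z, 0 <= F z) -> (forall z, 0 <= G z) ->
  (J (fun z => F z + G z)%R = J F + J G)%E.
Proof.
move=> mF mG F0 G0; rewrite /J /on_R2; under eq_integral do rewrite EFinD.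
rewrite ge0_integralD//.
- by move=> q _; rewrite lee_fin; exact: F0.
- exact: (mesE mF).
- by move=> q _; rewrite lee_fin; exact: G0.
- exact: (mesE mG).
Qed.

Lemma mes_sum N (F : nat -> C -> R) : (forall j, mes (F j)) ->
  mes (fun z => \sum_(0 <= j < N) F j z).
Proof.
move=> mF; elim: N => [|N IH].
  by rewrite (_ : (fun _ => _) = (fun=> 0)); [exact: mes_cst|apply/funext => z; rewrite big_geq].
rewrite (_ : (fun _ => _) = (fun z => \sum_(0 <= j < N) F j z + F N z)); first exact: mesD.
by apply/funext => z; rewrite big_nat_recr.
Qed.

Lemma plane_int_sum N (F : nat -> C -> R) (K : \bar R) : (forall j, mes (F j)) ->
  (forall j z, 0 <= F j z) -> (forall j, J (F j) = K) ->
  (J (fun z => (\sum_(0 <= j < N) F j z)%R) = N%:R%:E * K)%E.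
Proof.
move=> mF F0 FK; elim: N => [|N IH].
  rewrite mul0e (_ : (fun _ => _) = (fun=> 0)); last by apply/funext => z; rewrite big_geq.
  by rewrite /J /on_R2 integral0.
rewrite (_ : (fun _ => _) = (fun z => \sum_(0 <= j < N) F j z + F N z)); last first.
  by apply/funext => z; rewrite big_nat_recr.
rewrite plane_int_D//; [|exact: mes_sum|by move=> z; rewrite sumr_ge0].
have K0 : (0 <= K)%E by rewrite -(FK 0%N) plane_int_ge0.
by rewrite IH FK -addn1 natrD EFinD ge0_muleDl ?lee_fin// mul1e.
Qed.

Lemma plane_int_shift F c : mes F -> (forall z, 0 <= F z) -> J (fun z => F (z + c)) = J F.
Proof.
case: c => c d mF F0.
pose G (q : mR * mR) := (on_R2 F q)%:E.
have mG : measurable_fun setT G by exact: mesE.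
have G0 q : (0 <= G q)%E by rewrite lee_fin; exact: F0.
rewrite -[RHS](integral_shear1 mG G0 0 c).
have mG1 := affine_comp_measurable mG 1 0 c 0 1 0.
rewrite -[RHS](integral_shear2 mG1 (fun q => G0 _) 0 d).
apply: eq_integral => -[x y] _; rewrite /G /on_R2 /=; congr ((F _)%:E).
by apply/eqP; rewrite eq_complex /=; apply/andP; split; apply/eqP; ring.
Qed.

Lemma plane_int_dilate F r : 0 < r -> mes F -> (forall z, 0 <= F z) ->
  (J (fun z => F (r%:C * z)%R) = (r^-1 ^+ 2)%:E * J F)%E.
Proof.
move=> r0 mF F0.
pose G (q : mR * mR) := (on_R2 F q)%:E.
have mG : measurable_fun setT G by exact: mesE.
have G0 q : (0 <= G q)%E by rewrite lee_fin; exact: F0.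
rewrite -[RHS](integral_dilate_plane r0 mG G0).
apply: eq_integral => -[x y] _; rewrite /G /on_R2 /=; congr ((F _)%:E).
by apply/eqP; rewrite eq_complex /=; apply/andP; split; apply/eqP; ring.
Qed.

Lemma plane_int_rot F a : mod a = 1 -> mes F -> (forall z, 0 <= F z) -> J (fun z => F (a * z)) = J F.
Proof.
(* A rotation with [s = Im a != 0] is the product of three shears. *)
have shears (E : C -> R) c s : s != 0 -> c ^+ 2 + s ^+ 2 = 1 -> mes E -> (forall z, 0 <= E z) ->
    J (fun z => E ((c +i* s) * z)) = J E.
  move=> s0 cs mF F0.
  pose G (q : mR * mR) := (on_R2 E q)%:E.
  have mG : measurable_fun setT G by exact: mesE.
  have G0 q : (0 <= G q)%E by rewrite lee_fin; exact: F0.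
  (* This is [- tan (th / 2)] for the angle [th] of the rotation. *)
  pose t := (c - 1) / s.
  rewrite -[RHS](integral_shear1 mG G0 t 0).
  have mG1 := affine_comp_measurable mG 1 t 0 0 1 0.
  rewrite -[RHS](integral_shear2 mG1 (fun q => G0 _) s 0).
  have mG2 := affine_comp_measurable mG1 1 0 0 s 1 0.
  rewrite -[RHS](integral_shear1 mG2 (fun q => G0 _) t 0).
  apply: eq_integral => -[x y] _; rewrite /G /on_R2 /=; congr ((E _)%:E).
  apply/eqP; rewrite eq_complex /=; apply/andP; split; apply/eqP.
    have s2 : s * s = 1 - c ^+ 2 by rewrite -cs; ring.
    rewrite /t; transitivity (c * x - s * s / s * y); first by field.
    by rewrite s2; field.
  by rewrite /t; field.
case: a => c s /= m1 mF F0.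
have cs : c ^+ 2 + s ^+ 2 = 1.
  have := sqr_sqrtr (addr_ge0 (sqr_ge0 c) (sqr_ge0 s)); rewrite m1 => <-.
  by rewrite expr1n.
have [s0|s0] := eqVneq s 0; last exact: shears.
(* A real [a] of modulus 1 is 1 or -1; the rotation by -1 is obtained as that by ['i] applied
   twice. *)
have : (c == 1) || (c == -1) by rewrite -sqrf_eq1 -cs s0 expr0n addr0.
rewrite s0 => /orP[/eqP->|/eqP->]; first by congr J; apply/funext => z; rewrite mul1r.
have i1 : (0 : R) ^+ 2 + 1 ^+ 2 = 1 by rewrite expr0n expr1n add0r.
rewrite -(shears F 0 1 (oner_neq0 _) i1 mF F0).
have mF1 : mes (fun z => F ('i * z)).
  by have := mes_affine 'i 0 mF; under eq_fun do rewrite addr0.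
rewrite -(shears _ 0 1 (oner_neq0 _) i1 mF1 (fun z => F0 _)).
congr J; apply/funext => z; congr F.
rewrite mulrA; congr (_ * _).
by apply/eqP; rewrite eq_complex /=; apply/andP; split; apply/eqP; ring.
Qed.

Lemma gauss_plane : (J (fun z => expR (- mod z ^+ 2))%R < +oo)%E.
Proof.
have mg : measurable_fun (setT : set mR) (@gauss_fun R) by exact: measurable_gauss_fun.
have mE : measurable_fun setT (fun q : mR * mR => (gauss_fun q.1 * gauss_fun q.2)%:E).
  by apply/measurable_EFinP; apply: measurable_funM; apply: (measurableT_comp mg).
have E0 q : (0 <= (gauss_fun q.1 * gauss_fun q.2)%:E)%E.
  by rewrite lee_fin mulr_ge0// gauss_fun_ge0.
rewrite /J (eq_integral (fun q : mR * mR => (gauss_fun q.1 * gauss_fun q.2)%:E)); last first.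
  move=> [x y] _; rewrite /on_R2 /gauss_fun -expRD /= sqr_sqrtr ?addr_ge0 ?sqr_ge0//.
  by rewrite opprD.
rewrite integral_plane1//=.
have mgE : measurable_fun (setT : set mR) (fun x : mR => (gauss_fun x)%:E).
  exact/measurable_EFinP.
have gE0 (x : mR) : setT x -> (0 <= (gauss_fun x)%:E)%E by rewrite lee_fin gauss_fun_ge0.
have Z (k : \bar R) : (0 <= k)%E ->
    (\int[mu]_y (k * (gauss_fun y)%:E) = k * (Num.sqrt pi)%:E)%E.
  by move=> k0; rewrite (ge0_integralZl mu measurableT mgE gE0 k0) integralT_gauss.
rewrite (eq_integral (fun x : mR => (Num.sqrt pi)%:E * (gauss_fun x)%:E)%E) => [|x _]; last first.
  by under eq_integral do rewrite EFinM; rewrite Z ?gE0// muleC.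
by rewrite Z ?lee_fin ?sqrtr_ge0// -EFinM ltry.
Qed.

End PlaneIntegral.

(** * Averages over rotations *)

Section Projection.
Context {R : realType}.
Local Notation C := R[i].
Local Notation mod := (@Normc.normc R).
Local Notation J := plane_int.

(** Separability of ['X^n - 1] gives [n] distinct roots of unity, and a set of that size contains a
    primitive one. *)
Lemma prim_root_exists n : (0 < n)%N -> exists w : C, n.-primitive_root w.
Proof.
pose p : {poly C} := 'X^n - 1; have [r Dp] := closed_field_poly_normal p.
move=> n_gt0; rewrite (monicP _) ?monicXnsubC // scale1r in Dp.
have rn1: all n.-unity_root r by apply/allP=> z; rewrite -root_prod_XsubC -Dp.
have sz_r: (n < (size r).+1)%N by rewrite -(size_prod_XsubC r id) -Dp size_XnsubC.
have [|z] := hasP (has_prim_root n_gt0 rn1 _ sz_r); last by exists z.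
by rewrite -separable_prod_XsubC -Dp separable_Xn_sub_1 // pnatr_eq0 -lt0n.
Qed.

Lemma mod_unity_root n (w : C) : (0 < n)%N -> w ^+ n = 1 -> mod w = 1.
Proof.
move=> n0 wn; have := congr1 mod wn; rewrite modX mod1 => /eqP.
by rewrite pexpr_eq1 ?mod_ge0// => /eqP.
Qed.

Lemma powR_conv2 (p t x y : R) : 1 <= p -> 0 <= t <= 1 -> 0 <= x -> 0 <= y ->
  (t * x + (1 - t) * y) `^ p <= t * x `^ p + (1 - t) * y `^ p.
Proof.
move=> p1 /andP[t0 t1] x0 y0.
have := @convex_powR R p p1 (Itv01 t0 t1) x y; rewrite !convRE; apply;
  by rewrite inE/= in_itv/= andbT.
Qed.

(** Convexity at the midpoint. Integrated, it becomes the quasi-triangle inequality on [p]-th powers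
    of norms. *)
Lemma powR_D (p x y : R) : 1 <= p -> 0 <= x -> 0 <= y ->
  (x + y) `^ p <= 2 `^ p * (x `^ p + y `^ p).
Proof.
move=> p1 x0 y0; have := @powR_conv2 p 2^-1 x y p1 _ x0 y0.
rewrite (_ : 1 - 2^-1 = 2^-1 :> R); last by field.
rewrite -!mulrDr invr_ge0 ler0n invf_le1// ler1n => /(_ isT) h.
rewrite (_ : x + y = 2 * (2^-1 * (x + y))); last by field.
rewrite powRM//; last by rewrite mulr_ge0 ?addr_ge0.
rewrite ler_wpM2l ?powR_ge0//; apply: (le_trans h).
by rewrite ler_piMl ?addr_ge0 ?powR_ge0// invf_le1// ler1n.
Qed.

Lemma powR_mean (p : R) n (a : nat -> R) : 1 <= p -> (forall j, 0 <= a j) ->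
  (n.+1%:R^-1 * \sum_(0 <= j < n.+1) a j) `^ p <= n.+1%:R^-1 * \sum_(0 <= j < n.+1) a j `^ p.
Proof.
move=> p1 a0; elim: n => [|n IH]; first by rewrite !big_nat1 !invr1 !mul1r.
set t : R := n.+1%:R / n.+2%:R.
have n1 : n.+1%:R != 0 :> R by rewrite pnatr_eq0.
have n2 : n.+2%:R != 0 :> R by rewrite pnatr_eq0.
have t1 : 1 - t = n.+2%:R^-1.
  by rewrite /t -[X in X - _](divff n2) -mulrBl -natrB// subSnn mul1r.
have t01 : 0 <= t <= 1 by rewrite divr_ge0//= -subr_ge0 t1 invr_ge0.
have tE : t * n.+1%:R^-1 = n.+2%:R^-1 by rewrite /t mulrAC divff// mul1r.
have E (b : nat -> R) : n.+2%:R^-1 * \sum_(0 <= j < n.+2) b j =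
    t * (n.+1%:R^-1 * \sum_(0 <= j < n.+1) b j) + (1 - t) * b n.+1.
  by rewrite t1 mulrA tE big_nat_recr//= mulrDr.
rewrite !E; apply: le_trans (powR_conv2 p1 t01 _ (a0 _)) _.
  by rewrite mulr_ge0 ?invr_ge0 ?sumr_ge0.
by rewrite lerD2r ler_wpM2l//; case/andP: t01.
Qed.

Lemma cconv_bigsum N (w : nat -> nat -> C) (l : nat -> C) : (forall j, cconv (w j) (l j)) ->
  cconv (fun k => \sum_(0 <= j < N) w j k) (\sum_(0 <= j < N) l j).
Proof.
move=> H; elim: N => [|N IH].
  rewrite big_geq// => e e0; exists 0%N => n _.
  by rewrite big1 ?subrr ?mod0 ?ltW// => k _; rewrite big_geq.
rewrite big_nat_recr//=; apply: cconv_ext (cconvD IH (H N)) => k.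
by rewrite big_nat_recr.
Qed.

Lemma entire_ccont (f : C -> C^o) : entire f -> ccont f.
Proof. by move=> ef; apply: cderiv_ccont => z; exact/derivable_cderiv. Qed.

Lemma ccont_mes (f : C -> C) : ccont f -> mes (fun z => mod (f z)).
Proof.
move=> cf; apply: mes_cont => z e e0; have [d d0 Hd] := cf z e e0; exists d => // w /Hd h.
have := mod_dist (f w) (f z); have := mod_dist (f z) (f w); rewrite (modBC (f z)).
by rewrite ler_norml; lra.
Qed.

Lemma entire_mes (f : C -> C^o) : entire f -> mes (fun z => mod (f z)).
Proof. by move=> /entire_ccont; exact: ccont_mes. Qed.

Lemma cvg_powR_ge0 (p x : R) (s : nat -> R) : 1 <= p -> (forall n, 0 <= s n) -> 0 <= x ->
  s n @[n --> \oo] --> x -> s n `^ p @[n --> \oo] --> x `^ p.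
Proof.
move=> p1 s0; have p0 : 0 < p by apply: lt_le_trans p1.
rewrite le_eqVlt => /orP[/eqP<- sx|x0 sx].
  rewrite powR0 ?gt_eqF//; apply/cvgrPdist_le => e e0.
  have e1 : 0 < e `^ p^-1 by rewrite powR_gt0.
  move/cvgrPdist_le : sx => /(_ _ e1); apply: filterS => n.
  rewrite !sub0r !normrN !ger0_norm ?powR_ge0// => h.
  apply: le_trans (ge0_ler_powR (ltW p0) _ _ h) _; rewrite ?nnegrE ?powR_ge0//.
  by rewrite -powRrM mulVf ?gt_eqF// powRr1// ltW.
have cx : {for x, continuous (@powR R ^~ p)}.
  apply: differentiable_continuous; apply/derivable1_diffP.
  by apply: derivable_powR; rewrite in_itv/= x0.
exact: (cvg_comp _ _ sx cx).
Qed.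

Section RadialWeight.
Variables (w : C -> R) (mw : mes w) (w0 : forall z, 0 <= w z)
  (wrad : forall a z, mod a = 1 -> w (a * z) = w z) (p : R) (p1 : 1 <= p).

(** One construction with two uses: with [al] a root of unity it isolates coefficients in
    [coef_projection]; with [al = a] it is a mean of the orbit under the rotation by [a], hence an
    element of its span. On coefficients it is multiplication by [average_coef]. *)
Definition rotation_average (al : C) m N (f : C -> C) : C -> C^o := fun z =>
  N.+1%:R^-1 * \sum_(0 <= j < N.+1) (al ^+ (j * m))^-1 * f (al ^+ j * z).

Definition average_coef (al : C) m N k : C :=
  N.+1%:R^-1 * \sum_(0 <= j < N.+1) ((al ^+ m)^-1 * al ^+ k) ^+ j.

Lemma average_coef_diag al m N : al != 0 -> average_coef al m N m = 1.
Proof.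
move=> al0; rewrite /average_coef mulVf ?expf_neq0//; under eq_bigr do rewrite expr1n.
by rewrite big_const_nat subn0 iter_addr_0 mulVf// pnatr_eq0.
Qed.

Lemma average_coef_geom al m N k :
  ((al ^+ m)^-1 * al ^+ k - 1) * average_coef al m N k =
    N.+1%:R^-1 * (((al ^+ m)^-1 * al ^+ k) ^+ N.+1 - 1).
Proof. by rewrite /average_coef mulrCA big_mkord -subrX1. Qed.

Lemma rotation_average_cconv al m N (f : C -> C) u :
  (forall z, cconv (fun k => u k * z ^+ k) (f z)) ->
  forall z, cconv (fun k => average_coef al m N k * (u k * z ^+ k)) (rotation_average al m N f z).
Proof.
move=> cf z.
apply: cconv_ext (cconvZ _ (@cconv_bigsum N.+1
  (fun j k => (al ^+ (j * m))^-1 * (u k * (al ^+ j * z) ^+ k))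
  (fun j => (al ^+ (j * m))^-1 * f (al ^+ j * z)) _)) => [k|j]; last first.
  exact: cconvZ.
rewrite /average_coef -mulrA mulr_suml; congr (_ * _); apply: eq_bigr => j _.
rewrite !exprMn exprVn -!exprM (mulnC m) (mulnC k); ring.
Qed.

Section UnitModulus.
Variables (al : C) (al1 : mod al = 1) (m N : nat).

Let alX j : mod (al ^+ j) = 1. Proof. by rewrite modX al1 expr1n. Qed.

Lemma average_coef_le1 k : mod (average_coef al m N k) <= 1.
Proof.
rewrite /average_coef modM modV mod_nat; apply: le_trans (ler_wpM2l _ (mod_sum _ _ _)) _.
  by rewrite invr_ge0.
under eq_bigr do rewrite modX modM modV !alX invr1 mul1r expr1n.
by rewrite big_const_nat subn0 iter_addr_0 -mulr_natr mul1r mulVf// pnatr_eq0.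
Qed.

(** Jensen's inequality bounds the [p]-th power of the mean by the mean of [p]-th powers of rotates
    of [f], all with the same integral because [w] is rotation invariant. *)
Lemma rotation_average_le (f : C -> C^o) u : taylor_expansion f 0 u ->
  (J (fun z => mod (rotation_average al m N f z) `^ p * w z)%R <= J (fun z => mod (f z) `^ p * w z)%R)%E.
Proof.
move=> tf; set Q := rotation_average al m N f.
have p0 : 0 <= p by apply: le_trans p1.
have cf z : cconv (fun k => u k * z ^+ k) (f z).
  by move/taylorP : tf => /(_ z); rewrite subr0.
have mQ : mes (fun z => mod (Q z)).
  apply: entire_mes; apply: (@taylor_entire _ _ 0 (fun k => average_coef al m N k * u k)).
  by apply/taylorP => z; apply: cconv_ext (rotation_average_cconv al m N cf z) => k; rewrite subr0 mulrA.
have mf := entire_mes (taylor_entire tf).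
pose G j z := mod (f (al ^+ j * z)) `^ p * w z.
have mG j : mes (G j).
  apply: mesM => //; apply: mes_powR.
  by have := mes_affine (al ^+ j) 0 mf; under eq_fun do rewrite addr0.
have G0 j z : 0 <= G j z by rewrite mulr_ge0 ?powR_ge0.
have GJ j : J (G j) = J (fun z => mod (f z) `^ p * w z)%R.
  have mF : mes (fun z => mod (f z) `^ p * w z) by apply: mesM => //; exact: mes_powR.
  have F0 z : 0 <= mod (f z) `^ p * w z by rewrite mulr_ge0 ?powR_ge0.
  rewrite -(plane_int_rot (alX j) mF F0); congr J; apply/funext => z.
  by rewrite /G wrad.
apply: (@le_trans _ _ (J (fun z => N.+1%:R^-1 * \sum_(0 <= j < N.+1) G j z)%R)).
  apply: plane_int_le.
  - by apply: mesM => //; exact: mes_powR.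
  - by apply: mesM; [exact: mes_cst|exact: mes_sum].
  - by move=> z; rewrite mulr_ge0 ?powR_ge0.
  - move=> z; rewrite /G -mulr_suml mulrA ler_wpM2r//.
    apply: le_trans (powR_mean N p1 (a := fun j => mod (f (al ^+ j * z))) _); last first.
      by move=> j; exact: mod_ge0.
    have N0 : 0 <= N.+1%:R^-1 :> R by rewrite invr_ge0.
    apply: ge0_ler_powR => //; rewrite ?nnegrE ?mod_ge0//.
      by rewrite mulr_ge0// sumr_ge0// => j _; exact: mod_ge0.
    rewrite /Q /rotation_average modM modV mod_nat ler_wpM2l//; apply: le_trans (mod_sum _ _ _) _.
    by apply: ler_sum => j _; rewrite modM modV alX invr1 mul1r.
rewrite plane_int_Z//; [|exact: mes_sum|by move=> z; rewrite sumr_ge0].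
by rewrite (plane_int_sum _ mG G0 GJ) muleA -EFinM mulVf ?mul1e// pnatr_eq0.
Qed.

End UnitModulus.

(* Averaging [om ^- (j m) f (om ^ j z)] over the [N]-th roots of unity keeps only the
   Taylor coefficients of index congruent to [m] modulo [N]. *)
Lemma coef_projection (f : C -> C^o) (u : nat -> C) m : taylor_expansion f 0 u ->
  (J (fun z => mod (u m * z ^+ m) `^ p * w z)%R <= J (fun z => mod (f z) `^ p * w z)%R)%E.
Proof.
move=> tf.
have ef := taylor_entire tf.
have cf z : cconv (fun k => u k * z ^+ k) (f z).
  by move/taylorP : tf => /(_ z); rewrite subr0.
have p0 : 0 <= p by apply: le_trans p1.
(* An order above [m] makes [m] the only surviving index below it. *)
have /choice[om Hom] n : exists om : C, (n + m).+1.-primitive_root om by exact: prim_root_exists.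
have om1 n : mod (om n) = 1.
  by apply: (@mod_unity_root (n + m).+1) => //; exact: prim_expr_order (Hom n).
have om0 n : om n != 0 by rewrite -mod_eq0 om1 oner_eq0.
pose Q n := rotation_average (om n) m (n + m) f.
pose c n := average_coef (om n) m (n + m).
have cQ n z : cconv (fun k => c n k * (u k * z ^+ k)) (Q n z) by exact: rotation_average_cconv.
have cm n : c n m = 1 by exact: average_coef_diag.
have c0 n k : (k < (n + m).+1)%N -> k != m -> c n k = 0.
  move=> kN km; have := average_coef_geom (om n) m (n + m) k.
  set x := _ * om n ^+ k => E.
  have xN : x ^+ (n + m).+1 = 1.
    rewrite /x exprMn exprVn -!exprM -(mulnC (n + m).+1) -(mulnC (n + m).+1) !exprM.
    by rewrite (prim_expr_order (Hom n)) !expr1n invr1 mulr1.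
  have x1 : x != 1.
    apply/eqP => /(congr1 (fun y => om n ^+ m * y)); rewrite mulr1 mulVKf ?expf_neq0// => /eqP.
    rewrite (eq_prim_root_expr (Hom n)) !modn_small// ?(negbTE km)//.
    by rewrite ltnS leq_addl.
  by move: E; rewrite xN subrr mulr0 => /eqP; rewrite mulf_eq0 subr_eq0 (negbTE x1)/= => /eqP.
have c1 n k : mod (c n k) <= 1 by exact: average_coef_le1.
have lim z : mod (Q n z) @[n --> \oo] --> mod (u m * z ^+ m).
  have u0 : everywhere_conv u by move=> v; exists (f v).
  have [K K0 HK] := powser_abs u0 (mulr_ge0 (ler0n R 2) (mod_ge0 z)).
  (* Surviving indices other than [m] exceed [n], so their terms are at most [2 ^ - n] times those
     of the absolute series at radius [2 * mod z]. *)
  have B n : mod (Q n z - u m * z ^+ m) <= K * 2^-1 ^+ n.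
    have fin := @cconv_finite _ (fun k => if k == m then u m * z ^+ m else 0) m.+1.
    rewrite big_nat_recr//= eqxx big_nat_cond big1 ?add0r in fin; last first.
      by move=> k /andP[/andP[_ km] _]; rewrite ltn_eqF.
    have {}fin : cconv (fun k => if k == m then u m * z ^+ m else 0) (u m * z ^+ m).
      by apply: fin => k mk; rewrite gtn_eqF.
    apply: cconv_le (cconvB (cQ n z) fin) => M.
    apply: le_trans (mod_sum _ _ _) _.
    rewrite [leRHS]mulrC; apply: le_trans (ler_wpM2l _ (HK M)); last by rewrite exprn_ge0.
    rewrite mulr_sumr; apply: ler_sum => k _.
    have R0 : 0 <= 2^-1 ^+ n * (mod (u k) * (2 * mod z) ^+ k).
      by rewrite !mulr_ge0 ?exprn_ge0 ?mulr_ge0 ?mod_ge0.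
    case: eqVneq => [->|km]; first by rewrite cm mul1r subrr mod0 !mulr_ge0 ?exprn_ge0 ?mulr_ge0 ?mod_ge0.
    have [kN|Nk] := ltnP k (n + m).+1; first by rewrite c0// mul0r subr0 mod0.
    rewrite subr0 [mod (c n k * _)]modM [mod (u k * _)]modM modX; apply: le_trans (ler_wpM2r _ (c1 n k)) _.
      by rewrite mulr_ge0 ?mod_ge0 ?exprn_ge0 ?mod_ge0.
    rewrite mul1r mulrCA ler_wpM2l ?mod_ge0// exprMn mulrA ler_peMl ?exprn_ge0 ?mod_ge0//.
    have -> : k = (n + (k - n))%N by rewrite subnKC// (leq_trans _ Nk)// ltnW// ltnS leq_addr.
    rewrite exprD mulrA -exprMn mulVf// expr1n mul1r.
    by rewrite exprn_ege1// ler1n.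
  apply/cvgrPdist_le => e e0.
  have [|M HM] := @expr_lt_eps _ (2^-1) K e _ e0.
    by rewrite invr_ge0 ler0n invf_lt1// ltr1n.
  exists M => // n /= /HM h; apply: le_trans h; apply: le_trans (B n).
  have := mod_dist (u m * z ^+ m) (Q n z); have := mod_dist (Q n z) (u m * z ^+ m).
  by rewrite (modBC (u m * _)) ler_norml; lra.
have mQ n : mes (fun z => mod (Q n z)).
  apply: entire_mes; apply: (@taylor_entire _ _ 0 (fun k => c n k * u k)); apply/taylorP => z.
  by apply: cconv_ext (cQ n z) => k; rewrite subr0 mulrA.
have mf := entire_mes ef.
have JQ n : (J (fun z => mod (Q n z) `^ p * w z)%R <= J (fun z => mod (f z) `^ p * w z)%R)%E.
  exact: rotation_average_le tf.
pose h n (q : measurableTypeR R * measurableTypeR R) :=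
  (on_R2 (fun z => mod (Q n z) `^ p * w z) q)%:E.
have lh q : limn_einf (h ^~ q) = (on_R2 (fun z => mod (u m * z ^+ m) `^ p * w z) q)%:E.
  apply: (cvg_limn_einf_sup _).1; apply: cvg_EFin; first exact: nearW.
  rewrite /on_R2; apply: cvgMl.
  apply: (@cvg_powR_ge0 p _ (fun n => mod (Q n _))) => // [n|]; exact: mod_ge0.
have mh n : measurable_fun setT (h n).
  by apply: mesE; apply: mesM => //; apply: mes_powR; exact: mQ.
have h0 n q : setT q -> (0 <= h n q)%E by rewrite lee_fin mulr_ge0 ?powR_ge0.
(* The averages converge pointwise to [u m * z ^ m] and their integrals are bounded by that of [f],
   so Fatou's lemma carries the bound to the limit. *)
have := fatou (lebesgue_measure \x lebesgue_measure)%E measurableT mh h0.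
under eq_integral do rewrite lh.
move=> H; apply: (le_trans H); rewrite limn_einf_lim.
apply: lime_le; first exact: is_cvg_einfs.
by apply: nearW => n; apply: le_trans (JQ n); apply: ereal_inf_lbound; exists n => /=.
Qed.

End RadialWeight.
End Projection.

(** * Coefficient bounds in the Fock space *)

Section Fock.
Context {R : realType}.
Local Notation C := R[i].
Local Notation mod := (@Normc.normc R).
Local Notation J := plane_int.
Local Notation mR := (measurableTypeR R).
Variables (phi : R -> R) (hphi : weight phi) (p : R) (hp : 1 <= p).
Local Notation I := (fock_integral phi p).
Local Notation F := (fock_space phi p).
Local Notation W := (fun z : C => expR (- p * radial_ext phi z)).

Lemma p_gt0 : 0 < p. Proof. exact: lt_le_trans hp. Qed.

Lemma fockE f : I f = J (fun z => mod (f z) `^ p * W z). Proof. by []. Qed.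

Lemma mesW : mes W.
Proof.
rewrite (_ : W = fun z => expR (- p * (phi `|mod z|))); last first.
  by apply/funext => z; rewrite /radial_ext ger0_norm// mod_ge0.
apply: (mes_comp (g := @expR R)) => //; apply: mesM; first exact: mes_cst.
apply: (mes_comp (g := fun t => phi `|t|)).
  by apply: continuous_measurable_fun; exact: weight_continuous.
by apply: (@ccont_mes _ id) => z e e0; exists e => // w /ltW.
Qed.

Lemma W_gt0 z : 0 < W z. Proof. exact: expR_gt0. Qed.

Lemma mes_fock (f : C -> C^o) : entire f -> mes (fun z => mod (f z) `^ p * W z).
Proof. by move=> ef; apply: mesM mesW; apply: mes_powR; exact: entire_mes. Qed.

Lemma fock_integrand_ge0 (f : C -> C) z : 0 <= mod (f z) `^ p * W z.
Proof. by rewrite mulr_ge0 ?powR_ge0// ltW ?W_gt0. Qed.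

Lemma fock_integral_ge0 f : (0 <= I f)%E.
Proof. by apply: plane_int_ge0 => z; exact: fock_integrand_ge0. Qed.

Lemma entireD (f g : C -> C^o) : entire f -> entire g -> entire (fun z => f z + g z).
Proof. by move=> ef eg z; exact: derivableD. Qed.

Lemma entireZ (c : C) (f : C -> C^o) : entire f -> entire (fun z => c * f z).
Proof. by move=> ef z; exact: derivableZ. Qed.

Lemma fock_integral_D (f g : C -> C^o) : entire f -> entire g ->
  (I (fun z => f z + g z)%R <= (2 `^ p)%:E * (I f + I g))%E.
Proof.
move=> ef eg; rewrite fockE [I f]fockE [I g]fockE.
rewrite -plane_int_D//; first last.
- exact: fock_integrand_ge0.
- exact: fock_integrand_ge0.
- exact: mes_fock.
- exact: mes_fock.
rewrite -plane_int_Z ?powR_ge0//; first last.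
- by move=> z; rewrite addr_ge0 ?fock_integrand_ge0.
- by apply: mesD; exact: mes_fock.
apply: plane_int_le.
- by apply: mes_fock; exact: entireD.
- by apply: mesM; [exact: mes_cst|apply: mesD; exact: mes_fock].
- exact: fock_integrand_ge0.
move=> z; rewrite -mulrDl mulrA ler_wpM2r ?(ltW (W_gt0 _))//.
apply: le_trans (powR_D hp (mod_ge0 _) (mod_ge0 _)).
by apply: ge0_ler_powR; rewrite ?nnegrE ?addr_ge0 ?mod_ge0 ?(ltW p_gt0)// modD.
Qed.

Lemma fock_integral_Z (c : C) (f : C -> C^o) : entire f -> (I (fun z => c * f z)%R = (mod c `^ p)%:E * I f)%E.
Proof.
move=> ef; rewrite !fockE -plane_int_Z ?powR_ge0//; first last.
- exact: fock_integrand_ge0.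
- exact: mes_fock.
by congr J; apply/funext => z; rewrite modM powRM ?mod_ge0// mulrA.
Qed.

Lemma fockD (f g : C -> C^o) : F f -> F g -> F (fun z => f z + g z).
Proof.
move=> [ef If] [eg Ig]; split; first exact: entireD.
apply: le_lt_trans (fock_integral_D ef eg) _; rewrite lte_mul_pinfty ?lee_fin ?powR_ge0//.
exact: (lte_add_pinfty If Ig).
Qed.

Lemma fockZ (c : C) (f : C -> C^o) : F f -> F (fun z => c * f z).
Proof.
move=> [ef If]; split; first exact: entireZ.
by rewrite fock_integral_Z// lte_mul_pinfty ?lee_fin ?powR_ge0.
Qed.

Lemma fockB (f g : C -> C^o) : F f -> F g -> F (fun z => f z - g z).
Proof.
move=> Ff /(@fockZ (-1)) Fg; have := fockD Ff Fg.
by congr F; apply/funext => z; rewrite mulN1r.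
Qed.

Lemma taylor_fock (f : C -> C^o) c : F f -> exists u, taylor_expansion f c u.
Proof. by case=> ef _; exact: entire_taylor. Qed.

Lemma taylor_shift (f : C -> C^o) c u : taylor_expansion f c u ->
  taylor_expansion (fun z => f (z + c)) 0 u.
Proof.
move=> /taylorP H; apply/taylorP => z.
by have := H (z + c); rewrite addrK subr0.
Qed.

(** A rotation-invariant weight on whose support both [mod z ^ n] and [phi] are controlled by the
    radius [s]. *)
Definition annulus (s : R) : C -> R := fun z => \1_(`[s, s + 1]%classic : set R) (mod z).

Lemma annulusE s z : annulus s z = if s <= mod z <= s + 1 then 1 else 0.
Proof.
rewrite /annulus indicE; case: ifPn => h; first by rewrite mem_set//= in_itv.
by rewrite memNset//= in_itv/=; apply/negP.
Qed.

Lemma mes_mod : mes (fun z : C => mod z).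
Proof. by apply: (@ccont_mes _ id) => z e e0; exists e => // w /ltW. Qed.

Lemma mes_annulus s : mes (annulus s).
Proof. by apply: (mes_comp (g := \1_(`[s, s + 1]%classic : set R))) mes_mod; exact: measurable_indic. Qed.

Lemma annulus_ge0 s z : 0 <= annulus s z.
Proof. by rewrite annulusE; case: ifP. Qed.

(** The annulus contains a square of side one half with a corner at [s], which gives a bound uniform
    in [s]. *)
Lemma annulus_area s : 0 <= s -> ((4^-1)%:E <= J (annulus s))%E.
Proof.
move=> s0.
pose A : set (mR * mR) := `]s, (s + 2^-1)[ `*` `]0, 2^-1[.
have mA : measurable A by apply: measurableX; exact: measurable_itv.
have EA : (\int[lebesgue_measure \x lebesgue_measure]_q (\1_A q)%:E = (4^-1 : R)%:E)%E.
  rewrite integral_indic// setIT.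
  transitivity (lebesgue_measure (`]s, (s + 2^-1)%R[%classic : set mR) *
    lebesgue_measure (`]0%R, (2^-1)%R[%classic : set mR))%E.
    by apply: product_measure1E; exact: measurable_itv.
  rewrite !lebesgue_measure_itv/=.
  rewrite !lte_fin ltrDl invr_gt0 ltr0n -!EFinB -EFinM; congr EFin.
  by field.
rewrite -EA; apply: ge0_le_integral => //.
- by apply/measurable_EFinP; exact: measurable_indic.
- by apply: mesE; exact: mes_annulus.
move=> [x y] _; rewrite lee_fin indicE; have [|_] := boolP (_ \in _); last exact: annulus_ge0.
rewrite inE /A /= !in_itv/= => -[/andP[x1 x2] /andP[y1 y2]].
rewrite /on_R2 annulusE.
have -> : s <= mod (x +i* y) <= s + 1; last by [].
apply/andP; split.
  by apply: le_trans (mod_Re _) => /=; rewrite ger0_norm; lra.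
by apply: le_trans (mod_le_ReIm _) _ => /=; rewrite !ger0_norm; lra.
Qed.

(** After translation of [c] to 0, the projection is applied on the annulus: there
    [mod z ^ n >= s ^ n], and by monotonicity the weight at [z + c] is at least
    [exp (- p phi (s + mod c + 1))]. The factor 4 is the inverse of the area bound. *)
Lemma coef_bound (f : C -> C^o) c u n s : F f -> taylor_expansion f c u -> 0 <= s ->
  (((mod (u n) * s ^+ n) `^ p)%:E <= (4 * expR (p * phi (s + mod c + 1)))%:E * I f)%E.
Proof.
move=> [ef If] tf s0.
have tg := taylor_shift tf; set g := fun z => _ in tg.
have wrad a z : mod a = 1 -> annulus s (a * z) = annulus s z.
  by rewrite !annulusE modM => ->; rewrite mul1r.
have H := coef_projection (mes_annulus s) (annulus_ge0 s) wrad hp n tg.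
set A := (mod (u n) * s ^+ n) `^ p.
have A0 : 0 <= A by rewrite powR_ge0.
have H1 : (A%:E * J (annulus s) <= J (fun z => mod (g z) `^ p * annulus s z)%R)%E.
  apply: le_trans H; rewrite -(plane_int_Z (mes_annulus s) (annulus_ge0 s) A0).
  apply: plane_int_le.
  - by apply: mesM; [exact: mes_cst|exact: mes_annulus].
  - apply: mesM (mes_annulus s); apply: mes_powR.
    rewrite (_ : (fun _ => _) = (fun z => mod (u n) * mod z ^+ n)); last first.
      by apply/funext => z; rewrite modM modX.
    apply: mesM; first exact: mes_cst.
    by apply: (mes_comp (g := fun t => t ^+ n)) mes_mod; exact: exprn_measurable.
  - by move=> z; rewrite mulr_ge0// annulus_ge0.
  - move=> z; rewrite annulusE; case: ifPn => [/andP[h1 h2]|_]; last by rewrite !mulr0.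
    rewrite !mulr1; apply: ge0_ler_powR; rewrite ?nnegrE ?mod_ge0 ?(ltW p_gt0)//.
      by rewrite mulr_ge0 ?mod_ge0 ?exprn_ge0.
    rewrite modM modX ler_wpM2l ?mod_ge0// lerXn2r ?nnegrE ?mod_ge0//.
have H2 : (J (fun z => mod (g z) `^ p * annulus s z)%R <= (expR (p * phi (s + mod c + 1)))%:E * I f)%E.
  have mf := mes_fock ef.
  rewrite fockE -(plane_int_shift c mf (fock_integrand_ge0 f)) -plane_int_Z ?expR_ge0//; first last.
  - by move=> z; rewrite fock_integrand_ge0.
  - by have := mes_affine 1 c mf; under eq_fun do rewrite mul1r.
  apply: plane_int_le.
  - apply: mesM (mes_annulus s); apply: mes_powR.
    by have := mes_affine 1 c (entire_mes ef); under eq_fun do rewrite mul1r.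
  - apply: mesM; first exact: mes_cst.
    by have := mes_affine 1 c mf; under eq_fun do rewrite mul1r.
  - by move=> z; rewrite mulr_ge0 ?powR_ge0 ?annulus_ge0.
  - move=> z; rewrite annulusE; case: ifPn => [/andP[h1 h2]|_]; last first.
      by rewrite mulr0 mulr_ge0 ?expR_ge0 ?fock_integrand_ge0.
    rewrite mulr1 mulrCA ler_peMr ?powR_ge0// -expRD.
    rewrite -[leLHS]expR0 ler_expR mulNr -mulrBr mulr_ge0 ?(ltW p_gt0)// subr_ge0.
    rewrite /radial_ext; apply: (weight_nondecr hphi (mod_ge0 _)).
    by apply: le_trans (modD _ _) _; lra.
have H3 : (A%:E * (4^-1)%:E <= (expR (p * phi (s + mod c + 1)))%:E * I f)%E.
  apply: le_trans H2; apply: le_trans H1; apply: lee_wpmul2l; first by rewrite lee_fin.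
  exact: annulus_area.
rewrite EFinM -muleA; apply: le_trans (lee_wpmul2l _ H3); last by rewrite lee_fin.
by rewrite -!EFinM mulrCA divff// mulr1.
Qed.

End Fock.

(** * Norm estimates from dominated coefficients *)

Section FockEstimates.
Context {R : realType}.
Local Notation C := R[i].
Local Notation mod := (@Normc.normc R).
Local Notation J := plane_int.
Variables (phi : R -> R) (hphi : weight phi) (p : R) (hp : 1 <= p).
Local Notation I := (fock_integral phi p).
Local Notation F := (fock_space phi p).
Local Notation W := (fun z : C => expR (- p * radial_ext phi z)).
Let p0 : 0 < p := p_gt0 hp.

Lemma fine_I (f : C -> C^o) : F f -> I f = (fine (I f))%:E.
Proof. by case=> _ If; rewrite fineK// ge0_fin_numE ?fock_integral_ge0. Qed.

Lemma powRV (x : R) : 0 <= x -> (x `^ p) `^ p^-1 = x.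
Proof. by move=> x0; rewrite -powRrM divff ?gt_eqF// powRr1. Qed.

Lemma powR_le_inv (x y : R) : 0 <= x -> 0 <= y -> x `^ p <= y -> x <= y `^ p^-1.
Proof.
move=> x0 y0 xy; rewrite -[leLHS]powRV//.
by apply: ge0_ler_powR => //; rewrite ?nnegrE ?powR_ge0// invr_ge0 ltW.
Qed.

Lemma coef_growth (f : C -> C^o) c u : F f -> taylor_expansion f c u ->
  exists2 K : R, 0 <= K & forall n s, 0 <= s ->
    mod (u n) * s ^+ n <= K * expR (phi (s + mod c + 1)).
Proof.
move=> Ff tf; exists ((4 * fine (I f)) `^ p^-1); first exact: powR_ge0.
move=> n s s0; have := coef_bound hphi hp n Ff tf s0.
have If0 : 0 <= fine (I f) by rewrite fine_ge0// fock_integral_ge0.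
rewrite (fine_I Ff) -EFinM lee_fin => h.
have e0 : 0 <= expR (p * phi (s + mod c + 1)) by exact: expR_ge0.
apply: le_trans (powR_le_inv _ _ h) _.
- by rewrite mulr_ge0 ?mod_ge0 ?exprn_ge0.
- by rewrite !mulr_ge0.
rewrite mulrAC [leLHS]powRM ?mulr_ge0//.
by rewrite (mulrC p) expRM powRV ?expR_ge0.
Qed.

Lemma gauss_fin : J (fun z : C => expR (- mod z ^+ 2)) =
  (fine (J (fun z : C => expR (- mod z ^+ 2))))%:E.
Proof.
rewrite fineK// ge0_fin_numE; first exact: gauss_plane.
by apply: plane_int_ge0 => z; exact: expR_ge0.
Qed.

Lemma mes_gauss : mes (fun z : C => expR (- mod z ^+ 2)).
Proof.
apply: (mes_comp (g := @gauss_fun R)) mes_mod; exact: measurable_gauss_fun.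
Qed.

(** Against the weight, the [p]-th power of [exp (phi - mod z ^ 2)] leaves [exp (- p * mod z ^ 2)],
    which is at most the Gaussian since [p >= 1]. *)
Lemma fock_integral_le_gauss (g : C -> C^o) (K : R) : entire g -> 0 <= K ->
  (forall z, mod (g z) <= K * expR (phi (mod z) - mod z ^+ 2)) ->
  (I g <= (K `^ p)%:E * J (fun z : C => expR (- mod z ^+ 2))%R)%E.
Proof.
move=> eg K0 H; rewrite fockE.
rewrite -(plane_int_Z mes_gauss (fun z => expR_ge0 _) (powR_ge0 _ _)).
apply: plane_int_le.
- exact: mes_fock.
- by apply: mesM mes_gauss; exact: mes_cst.
- exact: fock_integrand_ge0.
move=> z; apply: (@le_trans _ _ ((K * expR (phi (mod z) - mod z ^+ 2)) `^ p * W z)).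
  rewrite ler_wpM2r ?expR_ge0//; apply: ge0_ler_powR => //; rewrite ?nnegrE ?mod_ge0 ?(ltW p0)//.
  by rewrite mulr_ge0 ?expR_ge0.
rewrite powRM ?expR_ge0// -expRM -mulrA -expRD ler_wpM2l ?powR_ge0// ler_expR /radial_ext.
have : 1 * mod z ^+ 2 <= p * mod z ^+ 2 by rewrite ler_wpM2r ?sqr_ge0.
by lra.
Qed.

(* [d] is dominated by the coefficients of [f] at the smaller radius [s * mod z], and
   [weight_gap] turns the gain into a Gaussian factor. *)
Lemma fock_dominated (f : C -> C^o) c u r : F f -> taylor_expansion f c u -> 0 <= r -> r < 1 ->
  exists2 M : R, 0 <= M & forall (g : C -> C^o) d e, 0 <= e -> taylor_expansion g c d ->
    (forall n, mod (d n) <= e * (r ^+ n * mod (u n))) -> (I g <= (M * e `^ p)%:E)%E.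
Proof.
move=> Ff tf r0 r1; have [K K0 HK] := coef_growth Ff tf.
(* A ratio strictly between [r] and 1: [r / s] gives a convergent geometric series, while [s < 1]
   leaves room for [weight_gap]. *)
pose s := (1 + r) / 2; have s0 : 0 < s by rewrite /s; lra.
have s1 : s < 1 by rewrite /s; lra.
pose q := r / s; have q01 : 0 <= q < 1.
  by rewrite divr_ge0 ?(ltW s0)//= ltr_pdivrMr// mul1r /s; lra.
have q1 : 0 <= (1 - q)^-1 by rewrite invr_ge0 subr_ge0; case/andP: q01 => _ /ltW.
(* The shift [mod c + mod c + 1] pays for replacing [mod (z - c)] by [mod z] and for the shift
   already present in [coef_growth]. *)
have [C1 HC1] := weight_gap hphi 1 (ltW s0) s1 (addr_ge0 (addr_ge0 (mod_ge0 c) (mod_ge0 c)) ler01).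
pose B := (1 - q)^-1 * K * expR C1.
have B0 : 0 <= B by rewrite !mulr_ge0 ?expR_ge0.
exists (B `^ p * fine (J (fun z : C => expR (- mod z ^+ 2)))).
  by rewrite mulr_ge0 ?powR_ge0// fine_ge0// plane_int_ge0// => z; exact: expR_ge0.
move=> g d e e0 tg Hd.
have -> : (B `^ p * fine (J (fun z : C => expR (- mod z ^+ 2))) * e `^ p)%:E =
    (((e * B) `^ p)%:E * J (fun z : C => expR (- mod z ^+ 2))%R)%E.
  by rewrite [in RHS]gauss_fin -EFinM (powRM _ e0 B0); congr EFin; ring.
apply: fock_integral_le_gauss; [exact: taylor_entire tg|by rewrite mulr_ge0|].
move=> z; have /taylorP/(_ z) := tg; apply: cconv_le => n.
apply: le_trans (mod_sum _ _ _) _.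
pose x := mod (z - c); have x0 : 0 <= x by exact: mod_ge0.
pose X := expR (phi (s * mod z + (mod c + mod c + 1))).
have xE : expR (phi (s * x + mod c + 1)) <= X.
  rewrite ler_expR; apply: (weight_nondecr hphi).
    by apply: addr_ge0 => //; apply: addr_ge0 (mod_ge0 c); rewrite mulr_ge0 ?(ltW s0).
  have := modB z c; rewrite -/x => h.
  have : s * x <= s * (mod z + mod c) by rewrite ler_wpM2l// ltW.
  have : s * mod c <= mod c by rewrite ler_piMl ?mod_ge0// ltW.
  by lra.
apply: (@le_trans _ _ (\sum_(0 <= k < n) e * (K * X) * q ^+ k)).
  apply: ler_sum => k _; rewrite modM modX -/x.
  apply: le_trans (ler_wpM2r (exprn_ge0 _ x0) (Hd k)) _.
  rewrite -!mulrA; apply: ler_wpM2l => //.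
  have -> : r ^+ k * (mod (u k) * x ^+ k) = q ^+ k * (mod (u k) * (s * x) ^+ k).
    have -> : r = q * s by rewrite /q divfK ?gt_eqF.
    by rewrite !exprMn; ring.
  rewrite mulrC [leRHS]mulrA ler_wpM2r ?exprn_ge0//; first by case/andP: q01.
  apply: le_trans (HK k _ (mulr_ge0 (ltW s0) x0)) _.
  by rewrite ler_wpM2l.
rewrite -mulr_sumr.
apply: le_trans (ler_wpM2l _ (geom_sum n q01)) _; first by rewrite !mulr_ge0 ?expR_ge0.
have h : X <= expR C1 * expR (phi (mod z) - mod z ^+ 2).
  by rewrite -expRD ler_expR; have := HC1 (mod z) (mod_ge0 z); lra.
rewrite (_ : e * (K * X) * (1 - q)^-1 = e * ((1 - q)^-1 * K) * X); last by ring.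
rewrite (_ : e * B * _ = e * ((1 - q)^-1 * K) * (expR C1 * expR (phi (mod z) - mod z ^+ 2))).
  by rewrite ler_wpM2l// !mulr_ge0.
by rewrite /B; ring.
Qed.

Lemma exp_partial_sum (x : R) n : 0 <= x -> \sum_(0 <= k < n) x ^+ k / k`!%:R <= expR x.
Proof.
move=> x0; apply: (@nondecreasing_cvgn_le R (series (exp_coeff x))).
  by apply: nondecreasing_series => k _ _; rewrite divr_ge0 ?exprn_ge0.
exact: is_cvg_series_exp_coeff.
Qed.

(** Such a [g] grows at most like [exp (mod (z - c))]. Of the bound [2 * mod z ^ 2 <= phi + c2], one
    square pays for the Gaussian and the other dominates [mod z] up to a constant. *)
Lemma exp_type_fock (g : C -> C^o) c d (A : R) : taylor_expansion g c d ->
  (forall n, mod (d n) <= A / n`!%:R) -> F g.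
Proof.
move=> tg Hd; have eg := taylor_entire tg; split=> //.
have A0 : 0 <= A by have := Hd 0%N; rewrite fact0 invr1 mulr1; apply: le_trans; exact: mod_ge0.
have [c2 H2] := weight_quadratic hphi 2.
have B0 : 0 <= A * expR (mod c + 1 + c2) by rewrite mulr_ge0 ?expR_ge0.
apply: le_lt_trans (fock_integral_le_gauss eg B0 _) _; last first.
  by rewrite lte_mul_pinfty ?lee_fin ?powR_ge0// gauss_plane.
move=> z; have /taylorP/(_ z) := tg; apply: cconv_le => n.
apply: le_trans (mod_sum _ _ _) _.
apply: (@le_trans _ _ (A * expR (mod (z - c)))).
  apply: le_trans (ler_wpM2l A0 (exp_partial_sum n (mod_ge0 _))); rewrite mulr_sumr.
  apply: ler_sum => k _; rewrite modM modX.
  apply: le_trans (ler_wpM2r (exprn_ge0 _ (mod_ge0 _)) (Hd k)) _.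
  by rewrite mulrA mulrAC.
rewrite -mulrA ler_wpM2l// -expRD ler_expR.
have := H2 (mod z) (mod_ge0 z); have := modB z c.
have : 0 <= (mod z - 1) ^+ 2 by exact: sqr_ge0.
by rewrite sqrrB1; have := mod_ge0 z; nra.
Qed.

Lemma poly_taylor (P : {poly C}) c : taylor_expansion (fun z => P.[z - c] : C^o) c (fun k => P`_k).
Proof.
apply/taylorP => z; rewrite horner_coef -(big_mkord xpredT (fun k => P`_k * (z - c) ^+ k)).
by apply: cconv_finite => k sk; rewrite nth_default// mul0r.
Qed.

Lemma poly_fock (P : {poly C}) c : F (fun z => P.[z - c] : C^o).
Proof.
pose A := \sum_(0 <= k < size P) mod P`_k * k`!%:R.
apply: (exp_type_fock (A := A) (@poly_taylor P c)) => n.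
rewrite ler_pdivlMr; last by rewrite ltr0n fact_gt0.
have T0 k : 0 <= mod P`_k * k`!%:R by rewrite mulr_ge0 ?mod_ge0.
have [Pn|nP] := ltnP n (size P); last by rewrite nth_default// mod0 mul0r sumr_ge0.
by rewrite /A big_mkord (bigD1 (Ordinal Pn))//= lerDl sumr_ge0.
Qed.

Lemma taylor_ext (f g : C -> C^o) c u v : f =1 g -> u =1 v -> taylor_expansion f c u ->
  taylor_expansion g c v.
Proof. by move=> /funext -> /funext ->. Qed.

Lemma fock_ext (f g : C -> C^o) : f =1 g -> F f -> F g.
Proof. by move=> /funext ->. Qed.

Lemma power_taylor (c : C) m : taylor_expansion (fun z => (z - c) ^+ m : C^o) c (fun k => (k == m)%:R).
Proof.
have H := (taylorP _ _ _).1 (@poly_taylor 'X^m c); apply/taylorP => z.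
have := H z; rewrite hornerXn; apply: cconv_ext => k.
by rewrite coefXn.
Qed.

Lemma power_fock (c : C) m : F (fun z => (z - c) ^+ m : C^o).
Proof.
by apply: fock_ext (poly_fock 'X^m c) => z; rewrite hornerXn.
Qed.

End FockEstimates.

(** * Density of polynomials *)

Section Density.
Context {R : realType}.
Local Notation C := R[i].
Local Notation mod := (@Normc.normc R).
Local Notation J := plane_int.
Local Notation mR := (measurableTypeR R).
Variables (phi : R -> R) (hphi : weight phi) (p : R) (hp : 1 <= p).
Local Notation I := (fock_integral phi p).
Local Notation F := (fock_space phi p).
Local Notation W := (fun z : C => expR (- p * radial_ext phi z)).
Let p0 : 0 < p := p_gt0 hp.

Definition outside (r : R) : C -> R := fun z => \1_(`]r, +oo[%classic : set R) (mod z).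

Lemma outsideE r z : outside r z = if r < mod z then 1 else 0.
Proof.
rewrite /outside indicE; case: ifPn => h; first by rewrite mem_set//= in_itv/= h.
by rewrite memNset//= in_itv/= andbT; apply/negP.
Qed.

Lemma mes_outside r : mes (outside r).
Proof. by apply: (mes_comp (g := \1_(`]r, +oo[%classic : set R))) mes_mod; exact: measurable_indic. Qed.

Lemma fock_tail (f : C -> C^o) (e : R) : F f -> 0 < e ->
  exists2 r : R, 0 < r & (J (fun z => outside r z * (mod (f z) `^ p * W z))%R < e%:E)%E.
Proof.
move=> [ef If] e0; have mf := mes_fock hphi p ef.
pose G (q : mR * mR) := (on_R2 (fun z => mod (f z) `^ p * W z) q)%:E.
have iG : (lebesgue_measure \x lebesgue_measure)%E.-integrable setT G.
  apply/integrableP; split; first exact: mesE.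
  rewrite (eq_integral G) => [|q _]; first exact: If.
  by rewrite gee0_abs// lee_fin /on_R2 fock_integrand_ge0.
pose h n (q : mR * mR) := (on_R2 (fun z => outside n.+1%:R z * (mod (f z) `^ p * W z)) q)%:E.
have := @dominated_cvg _ _ _ (lebesgue_measure \x lebesgue_measure)%E setT measurableT h (cst 0%E) G.
rewrite integral0 => H.
have {}H : (\int[lebesgue_measure \x lebesgue_measure]_x h n x)%E @[n --> \oo] --> (0 : \bar R)%E.
  apply: H => //.
  - by move=> n; apply: mesE; apply: mesM mf; exact: mes_outside.
  - move=> [x y] _; apply: cvg_near_cst; exists (Num.truncn (mod (x +i* y))) => // n /= xn.
    rewrite /h /on_R2 /= outsideE ltNge (_ : _ <= _) ?mul0r//.
    by apply: le_trans (ltW (truncnS_gt _)) _; rewrite ler_nat ltnS.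
  - move=> n q _; rewrite /h /G /on_R2 gee0_abs ?lee_fin; last first.
      by rewrite outsideE; case: ifP => _; rewrite ?mul1r ?mul0r ?fock_integrand_ge0.
    by rewrite outsideE; case: ifP => _; rewrite ?mul1r ?mul0r ?fock_integrand_ge0.
have /fine_cvgP[fn /cvgrPdist_lt/(_ e e0) fe] := H.
have [N _ /(_ N (leqnn N))[/= fN]] := filterI fn fe.
rewrite sub0r normrN => hN; exists N.+1%:R; first by rewrite ltr0n.
rewrite -[X in (X < _)%E]/(\int[lebesgue_measure \x lebesgue_measure]_x h N x)%E.
by rewrite -(fineK fN) lte_fin; apply: le_lt_trans hN; exact: ler_norm.
Qed.

Lemma fock1 : F (fun=> 1 : C^o).
Proof.
by apply: fock_ext (poly_fock hphi hp 1%:P 0) => z; rewrite hornerC.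
Qed.

Lemma plane_int_weight_fin : (J W < +oo)%E.
Proof.
have [_] := fock1; rewrite fockE (_ : (fun _ => _) = W)//.
by apply/funext => z; rewrite mod1 powR1 mul1r.
Qed.

(** The factor [2 ^ k], in place of [k], is absorbed by doubling the radius of the absolute
    series. *)
Lemma bernoulli_ge (r : R) k : 0 <= r <= 1 -> 1 - r ^+ k <= (1 - r) * 2 ^+ k.
Proof.
move=> /andP[r0 r1]; elim: k => [|k IH]; first by rewrite !expr0; lra.
have rk : r ^+ k <= 1 by rewrite exprn_ile1.
have rk0 : 0 <= r ^+ k by rewrite exprn_ge0.
have tk : 1 <= 2 ^+ k :> R by rewrite exprn_ege1// ler1n.
rewrite !exprS; nra.
Qed.

(** On the disc of radius [2 T] the difference is uniformly small by its series. Outside it,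
    [r >= 1 / 2] puts both [z] and [r z] beyond [T], and [phi (r * mod z) <= phi (mod z)], so both
    terms are bounded by the tail integrand [G]. *)
Lemma dilate_close (f : C -> C^o) (e : R) : F f -> 0 < e ->
  exists2 r : R, 0 < r < 1 & (I (fun z => f (r%:C * z) - f z)%R < e%:E)%E.
Proof.
move=> Ff e0; have [ef If] := Ff.
have [u tu] := entire_taylor 0 ef.
have cf z : cconv (fun k => u k * z ^+ k) (f z).
  by move/taylorP : tu => /(_ z); rewrite subr0.
have u0 : everywhere_conv u by move=> v; exists (f v).
have t0 : 0 < 2 `^ p :> R by rewrite powR_gt0.
(* The tail enters once directly and once after the change of variables [r z], which costs
   [r ^ -2 <= 4]: five times in all, with the factor [2 ^ p] of [powR_D]. *)
have eta0 : 0 < e / 2 / (5 * 2 `^ p) by rewrite !divr_gt0// mulr_gt0.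
have [T T0 HT] := fock_tail Ff eta0.
set G := fun z : C => _ in HT.
have mG : mes G by apply: mesM (mes_fock hphi p ef); exact: mes_outside.
have G0 z : 0 <= G z.
  by rewrite /G outsideE; case: ifP => _; rewrite ?mul1r ?mul0r ?fock_integrand_ge0.
(* Radius [4 T]: the disc of radius [2 T], doubled by [bernoulli_ge]. *)
have [S S0 HS] := powser_abs u0 (ltW (mulr_gt0 (ltr0n R 4) T0)).
pose Wf := fine (J W).
have WfE : J W = Wf%:E.
  rewrite fineK// ge0_fin_numE; first exact: plane_int_weight_fin.
  by apply: plane_int_ge0 => z; exact: expR_ge0.
have Wf0 : 0 <= Wf by rewrite fine_ge0// plane_int_ge0// => z; exact: expR_ge0.
pose dl := (e / 2 / (Wf + 1)) `^ p^-1.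
have q0 : 0 < e / 2 / (Wf + 1) by rewrite !divr_gt0// ltr_wpDl.
have dl0 : 0 < dl by rewrite powR_gt0.
have dlp : dl `^ p = e / 2 / (Wf + 1) by rewrite /dl -powRrM mulVf ?gt_eqF// powRr1// ltW.
pose d := Num.min 2^-1 (dl / (S + 1)).
have d0 : 0 < d by rewrite lt_min invr_gt0 ltr0n divr_gt0// ltr_wpDl.
have d1 : d <= 2^-1 by rewrite ge_min lexx.
have d2 : d * S <= dl.
  apply: (@le_trans _ _ (d * (S + 1))); first by rewrite ler_wpM2l ?lerDl// ltW.
  by rewrite -ler_pdivlMr ?ltr_wpDl// ge_min lexx orbT.
exists (1 - d); first by lra.
set r := 1 - d; have r0 : 0 < r by rewrite /r; lra.
have r12 : 2^-1 <= r by rewrite /r; lra.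
have r1 : r <= 1 by rewrite /r; lra.
have mGr : mes (fun z => G (r%:C * z)).
  by have := mes_affine r%:C 0 mG; under eq_fun do rewrite addr0.
have mW := mesW hphi p.
have W0 (z : C) : 0 <= W z by exact: expR_ge0.
have efr : entire (fun z => f (r%:C * z)).
  apply: (@taylor_entire _ _ 0 (fun k => r%:C ^+ k * u k)); apply/taylorP => z.
  by apply: cconv_ext (cf (r%:C * z)) => k; rewrite subr0 exprMn; ring.
have edf : entire (fun z => f (r%:C * z) - f z) by move=> z; apply: derivableB.
pose H1 z := 2 `^ p * (G (r%:C * z) + G z).
pose H2 z := dl `^ p * W z.
have mH1 : mes H1 by apply: mesM; [exact: mes_cst|exact: mesD].
have mH2 : mes H2 by apply: mesM => //; exact: mes_cst.
have H10 z : 0 <= H1 z by rewrite mulr_ge0 ?powR_ge0 ?addr_ge0.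
have H20 z : 0 <= H2 z by rewrite mulr_ge0 ?powR_ge0.
apply: (@le_lt_trans _ _ (J (fun z => H1 z + H2 z)%R)).
  apply: plane_int_le.
  - exact: (mes_fock hphi p edf).
  - exact: mesD.
  - exact: fock_integrand_ge0.
  move=> z; have [z2T|z2T] := leP (mod z) (2 * T).
    apply: (@le_trans _ _ (H2 z)); last by rewrite lerDr.
    rewrite ler_wpM2r//; apply: ge0_ler_powR; rewrite ?nnegrE ?mod_ge0 ?(ltW p0) ?(ltW dl0)//.
    apply: le_trans d2.
    have := cconvB (cf (r%:C * z)) (cf z); apply: cconv_le => n.
    apply: le_trans (mod_sum _ _ _) _.
    apply: le_trans (ler_wpM2l (ltW d0) (HS n)); rewrite mulr_sumr; apply: ler_sum => k _.
    rewrite exprMn mulrCA -[X in _ - X]mul1r -mulrBl !modM modX.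
    have -> : mod (r%:C ^+ k - 1) = 1 - r ^+ k.
      rewrite -rmorphXn -(rmorph1 (real_complex R)) -rmorphB mod_real ler0_norm ?opprB//.
      by rewrite subr_le0 exprn_ile1// ltW.
    have B := @bernoulli_ge r k _; rewrite (_ : 1 - r = d) in B; last by rewrite /r; ring.
    have {}B : 1 - r ^+ k <= d * 2 ^+ k by apply: B; rewrite r1 ltW.
    apply: le_trans (ler_wpM2r _ B) _; first by rewrite mulr_ge0 ?mod_ge0 ?exprn_ge0 ?mod_ge0.
    rewrite -mulrA ler_wpM2l ?(ltW d0)// mulrCA ler_wpM2l ?mod_ge0//.
    rewrite -exprMn lerXn2r ?nnegrE ?mulr_ge0 ?mod_ge0 ?(ltW T0)//.
    by lra.
  apply: (@le_trans _ _ (H1 z)); last by rewrite lerDl.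
  have zT : T < mod z by lra.
  have rz : T < mod (r%:C * z).
    rewrite modM mod_real gtr0_norm//.
    have : 2^-1 * mod z <= r * mod z by rewrite ler_wpM2r ?mod_ge0.
    by lra.
  rewrite /H1 /G !outsideE zT rz !mul1r.
  apply: (@le_trans _ _ ((2 `^ p * (mod (f (r%:C * z)) `^ p + mod (f z) `^ p)) * W z)).
    rewrite ler_wpM2r//; apply: le_trans (powR_D hp (mod_ge0 _) (mod_ge0 _)).
    by apply: ge0_ler_powR; rewrite ?nnegrE ?addr_ge0 ?mod_ge0 ?(ltW p0)// modB.
  rewrite -mulrA ler_wpM2l ?powR_ge0// mulrDl lerD2r ler_wpM2l ?powR_ge0//.
  rewrite ler_expR !mulNr lerN2 ler_wpM2l ?(ltW p0)//; apply: (weight_nondecr hphi (mod_ge0 _)).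
  by rewrite modM mod_real gtr0_norm// ler_piMl ?mod_ge0.
rewrite plane_int_D// plane_int_Z//; [|exact: mesD|by move=> z; rewrite addr_ge0].
rewrite plane_int_D// plane_int_dilate// /H2 plane_int_Z ?powR_ge0// WfE dlp.
have GE : J G = (fine (J G))%:E.
  by rewrite fineK// ge0_fin_numE ?plane_int_ge0//; apply: lt_trans HT _; rewrite ltry.
have Gf0 : 0 <= fine (J G) by rewrite fine_ge0// plane_int_ge0.
rewrite GE lte_fin in HT; rewrite GE.
change ((2 `^ p * (r^-1 ^+ 2 * fine (J G) + fine (J G)) + e / 2 / (Wf + 1) * Wf)%:E < e%:E)%E.
rewrite lte_fin.
move: (fine (J G)) HT Gf0 => g; rewrite ltr_pdivlMr ?mulr_gt0// => HT Gf0.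
have rV : r^-1 ^+ 2 <= 4.
  have : r^-1 <= 2 by rewrite -[leRHS]invrK lef_pV2 ?posrE ?invr_gt0.
  have : 0 <= r^-1 by rewrite invr_ge0 ltW.
  by move: (r^-1) => x; nra.
have h1 : 2 `^ p * (r^-1 ^+ 2 * g + g) <= g * (5 * 2 `^ p).
  rewrite (_ : g * (5 * 2 `^ p) = 2 `^ p * (5 * g)); last by ring.
  by rewrite ler_wpM2l ?powR_ge0//; nra.
have h2 : e / 2 / (Wf + 1) * Wf <= e / 2.
  by rewrite -mulrA ler_piMr// ?divr_ge0 ?(ltW e0)// mulrC ler_pdivrMr ?ltr_wpDl// mul1r lerDl.
by lra.
Qed.

(** The dilate [f (r z)] has coefficients [r ^ k * u k]; with [r = q * s], its Taylor tail beyond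
    [N] is at most [q ^ N] times [s ^ k * mod (u k)], which is the form required by
    [fock_dominated]. *)
Lemma poly_dense (f : C -> C^o) c (e : R) : F f -> 0 < e ->
  exists P : {poly C}, (I (fun z => f z - P.[z - c])%R < e%:E)%E.
Proof.
move=> Ff e0.
have t0 : 0 < 2 `^ p :> R by rewrite powR_gt0.
have e1 : 0 < e / 2 / 2 `^ p by rewrite !divr_gt0.
have [r /andP[r0 r1] Hr] := dilate_close Ff e1.
have [ef If] := Ff.
have [u tu] := entire_taylor 0 ef.
have cf z : cconv (fun k => u k * z ^+ k) (f z).
  by move/taylorP : tu => /(_ z); rewrite subr0.
pose s := (1 + r) / 2; have s0 : 0 < s by rewrite /s; lra.
have s1 : s < 1 by rewrite /s; lra.
have rs : r <= s by rewrite /s; lra.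
pose q := r / s; have q01 : 0 <= q < 1.
  by rewrite divr_ge0 ?(ltW s0) ?(ltW r0)//= ltr_pdivrMr// mul1r /s; lra.
have [M M0 HM] := fock_dominated hphi hp Ff tu (ltW s0) s1.
have e2 : 0 < (e / 2 / 2 `^ p / (M + 1)) `^ p^-1.
  by rewrite powR_gt0// divr_gt0// ltr_wpDl.
have [N HN] := expr_lt_eps 1 q01 e2.
have Msmall : M * (q ^+ N) `^ p < e / 2 / 2 `^ p.
  have := HN N (leqnn N); rewrite mul1r => h.
  have {}h : (q ^+ N) `^ p <= e / 2 / 2 `^ p / (M + 1).
    apply: (le_trans (ge0_ler_powR (ltW p0) _ _ h)).
    - by rewrite nnegrE exprn_ge0//; case/andP: q01.
    - by rewrite nnegrE powR_ge0.
    - rewrite -powRrM mulVf ?gt_eqF// powRr1//.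
      by rewrite ltW// divr_gt0// ltr_wpDl.
  apply: (le_lt_trans (ler_wpM2l M0 h)).
  by rewrite mulrCA gtr_pMr// ltr_pdivrMr ?ltr_wpDl// mul1r ltrDl.
pose P : {poly C} := \poly_(k < N) (r%:C ^+ k * u k).
have tfr : taylor_expansion (fun z => f (r%:C * z) : C^o) 0 (fun k => r%:C ^+ k * u k).
  apply/taylorP => z.
  by apply: cconv_ext (cf (r%:C * z)) => k; rewrite subr0 exprMn; ring.
have tP := @poly_taylor _ P 0.
have td : taylor_expansion (fun z => P.[z - 0] - f (r%:C * z) : C^o) 0 (fun k => P`_k - r%:C ^+ k * u k).
  apply/taylorP => z; have /taylorP/(_ z) h1 := tP; have /taylorP/(_ z) h2 := tfr.
  by apply: cconv_ext (cconvB h1 h2) => k; rewrite mulrBl.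
have bd n : mod (P`_n - r%:C ^+ n * u n) <= q ^+ N * (s ^+ n * mod (u n)).
  rewrite coef_poly; case: ltnP => [_|Nn].
    by rewrite subrr mod0 !mulr_ge0 ?exprn_ge0 ?mod_ge0 ?(ltW s0)//; case/andP: q01.
  rewrite sub0r modN modM modX mod_real gtr0_norm// mulrA ler_wpM2r ?mod_ge0//.
  have -> : r = q * s by rewrite /q divfK ?gt_eqF.
  rewrite exprMn ler_wpM2r ?exprn_ge0 ?(ltW s0)//.
  by case/andP: q01 => q0 /ltW q1; rewrite ler_wiXn2l.
have qN0 : 0 <= q ^+ N by rewrite exprn_ge0//; case/andP: q01.
have := HM _ _ _ qN0 td bd.
set D := fun z => P.[z - 0] - f (r%:C * z) => ID.
have eD : entire D by exact: taylor_entire td.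
(* The approximation is found at the centre 0 and rewritten in powers of [z - c]. *)
exists (P \Po ('X + c%:P)).
have -> : (fun z => f z - (P \Po ('X + c%:P)).[z - c]) =
    (fun z => -1 * (D z + (f (r%:C * z) - f z))).
  apply/funext => z; rewrite horner_comp hornerD hornerX hornerC subrK /D subr0; ring.
have efr : entire (fun z => f (r%:C * z) : C^o) by exact: taylor_entire tfr.
have edf : entire (fun z => f (r%:C * z) - f z : C^o) by move=> z; apply: derivableB.
have EI := fock_integral_Z hphi p (-1) (entireD eD edf).
rewrite modN mod1 powR1 mul1e in EI.
apply: (@le_lt_trans _ _ (I (fun z => D z + (f (r%:C * z) - f z))%R)).
  by rewrite -EI.
apply: le_lt_trans (fock_integral_D hphi hp eD edf) _.
rewrite -(lte_pdivlMl _ _ t0).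
have ID' : (I D < (e / 2 / 2 `^ p)%:E)%E by apply: le_lt_trans ID _; rewrite lte_fin.
apply: lt_le_trans (lteD ID' Hr) _.
by rewrite -EFinD -EFinM lee_fin -mulrDl mulrC; lra.
Qed.

End Density.

(** * Bounded affine composition operators *)

Section Boundedness.
Context {R : realType}.
Local Notation C := R[i].
Local Notation mod := (@Normc.normc R).
Local Notation J := plane_int.
Variables (phi : R -> R) (hphi : weight phi) (p : R) (hp : 1 <= p).
Local Notation I := (fock_integral phi p).
Local Notation F := (fock_space phi p).
Local Notation N := (fock_norm phi p).
Let p0 : 0 < p := p_gt0 hp.

Lemma fock_normE (f : C -> C^o) : F f -> N f = (fine (I f) `^ p^-1)%:E.
Proof. by move=> Ff; rewrite /fock_norm (fine_I Ff) poweR_EFin. Qed.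

Lemma fock_norm_lt (f : C -> C^o) (e : R) : F f -> 0 < e ->
  (N f < e%:E)%E = (I f < (e `^ p)%:E)%E.
Proof.
move=> Ff e0; have i0 : 0 <= fine (I f) by rewrite fine_ge0// fock_integral_ge0.
rewrite (fock_normE Ff) [in RHS](fine_I Ff) !lte_fin; apply/idP/idP => h.
  have := gt0_ltr_powR p0 _ _ h; rewrite -powRrM mulVf ?gt_eqF// powRr1//.
  by apply; rewrite nnegrE ?powR_ge0 ?(ltW e0).
rewrite -[X in _ < X](powRV hp (ltW e0)).
by apply: gt0_ltr_powR => //; rewrite ?nnegrE ?powR_ge0// invr_gt0.
Qed.

Lemma powR_root_bound (x y M : R) : 0 <= x -> 0 <= y ->
  y `^ p^-1 <= M * x `^ p^-1 -> y <= `|M| `^ p * x.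
Proof.
move=> x0 y0 h.
have {}h : y `^ p^-1 <= `|M| * x `^ p^-1.
  by apply: (le_trans h); rewrite ler_wpM2r ?powR_ge0// ler_norm.
have := ge0_ler_powR (ltW p0) _ _ h; rewrite powRM ?powR_ge0//.
rewrite -!powRrM mulVf ?gt_eqF// !powRr1//; apply; rewrite nnegrE ?powR_ge0//.
by rewrite mulr_ge0 ?powR_ge0.
Qed.

Lemma bounded_integral T : bounded_on F N T ->
  exists2 A : R, 0 <= A & forall f, F f -> fine (I (T f)) <= A * fine (I f).
Proof.
move=> [FT [M HM]]; exists (`|M| `^ p); first exact: powR_ge0.
move=> f Ff; have := HM f Ff; rewrite (fock_normE (FT _ Ff)) (fock_normE Ff).
rewrite -EFinM lee_fin; apply: powR_root_bound.
  by rewrite fine_ge0// fock_integral_ge0.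
by rewrite fine_ge0// fock_integral_ge0.
Qed.

(* The lower bound [m n >= m 0 (n! b ^ n) ^ p / A ^ n] beats the upper bound on [m (2 n)]
   because [(2 n)! >= n! n!]. *)
Lemma superfactorial_growth_absurd (A b D : R) (m : nat -> R) :
  1 <= A -> 0 < b -> (forall n, 0 < m n) ->
  (forall n, (n.+1%:R * b) `^ p * m n <= A * m n.+1) ->
  (forall n, m (2 * n)%N <= n`!%:R `^ p * D) -> False.
Proof.
move=> A1 b0 m0 step up.
have A0 : 0 < A by apply: lt_le_trans A1.
have fb n : 0 <= n`!%:R * b ^+ n by rewrite mulr_ge0 ?exprn_ge0 ?(ltW b0).
have low n : (n`!%:R * b ^+ n) `^ p * m 0%N <= A ^+ n * m n.
  elim: n => [|n IH]; first by rewrite fact0 !expr0 mulr1 powR1.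
  rewrite factS natrM exprS.
  have -> : n.+1%:R * n`!%:R * (b * b ^+ n) = (n.+1%:R * b) * (n`!%:R * b ^+ n) by ring.
  rewrite powRM ?fb ?mulr_ge0 ?(ltW b0)// -mulrA.
  apply: le_trans (ler_wpM2l (powR_ge0 _ _) IH) _.
  rewrite mulrCA exprSr -mulrA ler_wpM2l ?exprn_ge0 ?(ltW A0)//.
have fact2 n : (n`!%:R * n`!%:R <= (2 * n)`!%:R :> R).
  rewrite -natrM ler_nat; have := bin_fact (leq_pmull n (ltn0Sn 1)).
  rewrite (_ : 2 * n - n = n)%N; last by rewrite mul2n -addnn addnK.
  by move=> <-; apply: leq_pmull; rewrite bin_gt0; exact: leq_pmull.
pose B := A `^ p^-1; have B0 : 0 < B by rewrite powR_gt0.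
have AE k : A ^+ k = (B ^+ k) `^ p.
  have -> : A = B `^ p by rewrite /B -powRrM mulVf ?gt_eqF// powRr1// ltW.
  rewrite -powR_mulrn ?powR_ge0// -[B ^+ k]powR_mulrn; last exact: ltW.
  by rewrite -[LHS]powRrM -[RHS]powRrM mulrC.
have D0 : 0 <= D.
  have := up 0%N; rewrite fact0 powR1 mul1r; apply: le_trans; exact: ltW.
(* The summand 1 keeps [E] positive even if [D = 0]. *)
pose E := (D / m 0%N) `^ p^-1 + 1.
have E0 : 0 < E by rewrite ltr_wpDl ?powR_ge0.
pose x := (B / b) ^+ 2.
(* Combining the two bounds and taking [p]-th roots gives [n! * (b / B) ^ (2 n) <= E]; its
   reciprocal contradicts the convergence to 0 of the terms of the exponential series at [x]. *)
have main n : E^-1 <= x ^+ n / n`!%:R.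
  have n0 : 0 < n`!%:R :> R by rewrite ltr0n fact_gt0.
  have Bn : 0 < B ^+ (2 * n) by rewrite exprn_gt0.
  have bn : 0 < b ^+ (2 * n) by rewrite exprn_gt0.
  have h1 : (n`!%:R * n`!%:R * b ^+ (2 * n)) `^ p * m 0%N <= (B ^+ (2 * n)) `^ p * (n`!%:R `^ p * D).
    rewrite -AE; apply: le_trans (ler_wpM2l _ (up n)); last by rewrite exprn_ge0 ?(ltW A0).
    apply: le_trans (low _); rewrite ler_wpM2r ?(ltW (m0 _))//.
    apply: ge0_ler_powR; rewrite ?nnegrE ?(ltW p0) ?fb//.
      by rewrite !mulr_ge0 ?(ltW bn).
    by rewrite ler_wpM2r ?(ltW bn).
  have h2 : (n`!%:R * (b ^+ (2 * n) / B ^+ (2 * n))) `^ p <= D / m 0%N.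
    rewrite ler_pdivlMr// -(ler_pM2l (x := (B ^+ (2 * n) * n`!%:R) `^ p)); last first.
      by rewrite powR_gt0// mulr_gt0.
    rewrite [leLHS]mulrA -[_ `^ p * _ `^ p]powRM ?mulr_ge0 ?divr_ge0 ?(ltW Bn) ?(ltW bn)//.
    rewrite (_ : B ^+ _ * _ * (_ * _) = n`!%:R * n`!%:R * b ^+ (2 * n)); last first.
      by field; rewrite gt_eqF.
    apply: (le_trans h1); rewrite mulrA -powRM ?(ltW Bn)//.
    by rewrite invr_ge0 ltW.
  have h3 : n`!%:R * (b ^+ (2 * n) / B ^+ (2 * n)) <= E.
    apply: le_trans (powR_le_inv hp _ _ h2) _; last by rewrite lerDl.
      by rewrite mulr_ge0 ?divr_ge0 ?(ltW Bn) ?(ltW bn).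
    by rewrite divr_ge0 ?(ltW (m0 _)).
  have -> : x ^+ n / n`!%:R = (n`!%:R * (b ^+ (2 * n) / B ^+ (2 * n)))^-1.
    by rewrite /x -exprM expr_div_n !invfM invrK; field; rewrite !gt_eqF.
  by rewrite lef_pV2 ?posrE// mulr_gt0// divr_gt0.
have /cvgrPdist_lt/(_ E^-1) := cvg_series_cvg_0 (is_cvg_series_exp_coeff x).
rewrite invr_gt0 => /(_ E0)[n _ /(_ n (leqnn n))].
rewrite sub0r normrN => /(le_lt_trans (ler_norm _)) h.
by have := lt_le_trans h (main n); rewrite /exp_coeff /= ltxx.
Qed.

Definition monomial_integral n : R := fine (I (fun z => z ^+ n : C^o)).
Local Notation mi := monomial_integral.

Lemma monomial_fock n : F (fun z => z ^+ n : C^o).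
Proof. by apply: fock_ext (power_fock hphi hp 0 n) => z; rewrite subr0. Qed.

Lemma monomial_taylor n : taylor_expansion (fun z => z ^+ n : C^o) 0 (fun k => (k == n)%:R).
Proof. by apply: taylor_ext (@power_taylor _ 0 n) => // z; rewrite subr0. Qed.

(** The coefficient bound at radius 1, applied to [z ^ n] itself. *)
Lemma monomial_integral_gt0 n : 0 < mi n.
Proof.
have := coef_bound hphi hp n (monomial_fock n) (@monomial_taylor n) ler01.
rewrite eqxx mod1 expr1n mulr1 powR1 (fine_I (monomial_fock n)) -EFinM lee_fin => h.
have : 0 < (4 * expR (p * phi (1 + mod 0 + 1))) * mi n by apply: lt_le_trans h.
by rewrite pmulr_rgt0// mulr_gt0 ?expR_gt0.
Qed.

Lemma weight_factor_rot (a z : C) : mod a = 1 ->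
  expR (- p * radial_ext phi (a * z)) = expR (- p * radial_ext phi z).
Proof. by move=> a1; rewrite /radial_ext modM a1 mul1r. Qed.

Lemma fock_integral_coef_projection (f : C -> C^o) u m : taylor_expansion f 0 u ->
  (I (fun z => u m * z ^+ m)%R <= I f)%E.
Proof.
move=> tf.
exact: (coef_projection (mesW hphi p) (fun z => ltW (expR_gt0 _)) weight_factor_rot hp m tf).
Qed.

Lemma coef_monomial_integral (f : C -> C^o) u n : F f -> taylor_expansion f 0 u ->
  mod (u n) `^ p * mi n <= fine (I f).
Proof.
move=> Ff tf.
have := fock_integral_coef_projection n tf.
have [em _] := monomial_fock n.
by rewrite (fock_integral_Z hphi p _ em) (fine_I (monomial_fock n)) (fine_I Ff) -EFinM lee_fin.
Qed.

Lemma coef_affine_pow (a b : C) n k :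
  ((a *: 'X + b%:P) ^+ n)`_k = (a ^+ k * b ^+ (n - k)) *+ 'C(n, k).
Proof.
rewrite addrC exprDn coef_sum.
under eq_bigr do rewrite coefMn -polyC_exp coefCM exprZn coefZ coefXn.
have [kn|nk] := ltnP k n.+1.
  rewrite (bigD1 (Ordinal kn))//= eqxx mulr1 big1 ?addr0; first by rewrite mulrC.
  move=> i; rewrite -val_eqE/= => ik; rewrite eq_sym (negbTE ik) !mulr0.
  by rewrite mul0rn.
rewrite bin_small// mulr0n big1// => i _.
by rewrite gtn_eqF ?mulr0 ?mul0rn// (leq_trans (ltn_ord i)).
Qed.

(** One term of the exponential series: [mod z ^ (2 n) <= n! * exp (mod z ^ 2)], and the quadratic
    bound on [phi] turns the exponential into [exp (phi - mod z ^ 2 + c)]. *)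
Lemma monomial_integral_le c : (forall r, 0 <= r -> 2 * r ^+ 2 <= phi r + c) ->
  forall n, mi (2 * n) <= n`!%:R `^ p * (expR c `^ p * fine (J (fun z : C => expR (- mod z ^+ 2)))).
Proof.
move=> Hc n; have [em _] := monomial_fock (2 * n).
have K0 : 0 <= n`!%:R * expR c by rewrite mulr_ge0 ?expR_ge0.
have H : (forall z, mod (z ^+ (2 * n)) <= n`!%:R * expR c * expR (phi (mod z) - mod z ^+ 2)).
  move=> z; rewrite modX exprM -mulrA -expRD.
  have n0 : 0 < n`!%:R :> R by rewrite ltr0n fact_gt0.
  rewrite mulrC -ler_pdivrMr//.
  have := exp_partial_sum n.+1 (sqr_ge0 (mod z)); rewrite big_nat_recr//= => h.
  apply: (@le_trans _ _ (expR (mod z ^+ 2))).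
    apply: le_trans h; rewrite lerDr sumr_ge0// => k _.
    by apply: divr_ge0 => //; apply: exprn_ge0; exact: sqr_ge0.
  by rewrite ler_expR; have := Hc (mod z) (mod_ge0 z); lra.
have := fock_integral_le_gauss hphi hp em K0 H.
rewrite [X in (X <= _)%E -> _](fine_I (monomial_fock _)) [X in (_ <= _ * X)%E -> _]gauss_fin -EFinM lee_fin.
by rewrite (powRM _ _ (expR_ge0 c)) ?mulrA.
Qed.

Section Affine.
Variables (a b : C).
Hypothesis Tb : bounded_on F N (composition_operator (affine_map a b)).

(** The case [k = n] gives [mod a <= 1]. When [mod a = 1], the case of index [n] in
    [(a z + b) ^ n.+1], with coefficient of modulus [n.+1 * mod b], gives the growth excluded by
    [superfactorial_growth_absurd]. *)
Lemma affine_monomial_bound : exists2 A : R, 0 <= A & forall n k,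
  mod ((a ^+ k * b ^+ (n - k)) *+ 'C(n, k)) `^ p * mi k <= A * mi n.
Proof.
have [A A0 HA] := bounded_integral Tb; exists A; first exact: A0.
move=> n k.
apply: le_trans (HA _ (monomial_fock n)).
rewrite -coef_affine_pow; apply: coef_monomial_integral.
  exact: Tb.1 (monomial_fock n).
have H := (taylorP _ _ _).1 (@poly_taylor R ((a *: 'X + b%:P) ^+ n) 0); apply/taylorP => z.
have := H z; congr cconv.
by rewrite hornerE hornerD hornerZ hornerX hornerC subr0.
Qed.

Lemma affine_bounded_mod_le1 : mod a <= 1.
Proof.
have [A A0 HA] := affine_monomial_bound.
rewrite leNgt; apply/negP => a1.
have B n : mod a ^+ n <= A.
  have := HA n n; rewrite subnn expr0 mulr1 binn mulr1n ler_pM2r ?monomial_integral_gt0//.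
  apply: le_trans; rewrite modX; apply: le1r_powR => //.
  by rewrite exprn_ege1// ltW.
have a01 : 0 <= (mod a)^-1 < 1.
  by rewrite invr_ge0 mod_ge0/= invf_lt1// (lt_trans _ a1).
have A10 : 0 < (A + 1)^-1 by rewrite invr_gt0 ltr_wpDl.
have [m Hm] := expr_lt_eps 1 a01 A10.
have := Hm m (leqnn m); rewrite mul1r exprVn lef_pV2 ?posrE ?exprn_gt0 ?ltr_wpDl//; last first.
  exact: lt_trans a1.
by have := B m; lra.
Qed.

Lemma affine_bounded_rotation : mod a = 1 -> b = 0.
Proof.
move=> a1; apply/eqP/negPn/negP => b0.
have mb0 : 0 < mod b by rewrite mod_gt0.
have [A A0 HA] := affine_monomial_bound.
have A1 : 1 <= A.
  have := HA 0%N 0%N; rewrite !expr0 mulr1 bin0 mulr1n mod1 powR1.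
  by rewrite ler_pM2r ?monomial_integral_gt0.
have [c Hc] := weight_quadratic hphi 2.
pose D := expR c `^ p * fine (J (fun z : C => expR (- mod z ^+ 2))).
apply: (@superfactorial_growth_absurd A (mod b) D mi A1 mb0 monomial_integral_gt0).
  move=> n; have := HA n.+1 n; rewrite subSnn binSn expr1.
  by rewrite -mulr_natl !modM modX a1 expr1n mul1r mod_nat.
exact: monomial_integral_le Hc.
Qed.

End Affine.
End Boundedness.

(** * Necessary conditions for cyclicity *)

Section Dynamics.
Context {R : realType}.
Local Notation C := R[i].
Local Notation mod := (@Normc.normc R).
Variables (phi : R -> R) (hphi : weight phi) (p : R) (hp : 1 <= p).
Local Notation F := (fock_space phi p).
Local Notation N := (fock_norm phi p).

Lemma coef_continuous (c : C) n : exists2 K : R, 0 < K & forall (f : C -> C^o) u e,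
  F f -> taylor_expansion f c u -> 0 < e -> (N f < e%:E)%E -> mod (u n) <= K * e.
Proof.
pose B := 4 * expR (p * phi (1 + mod c + 1)).
have B0 : 0 < B by rewrite mulr_gt0// expR_gt0.
exists (B `^ p^-1); first by rewrite powR_gt0.
move=> f u e Ff tf e0; rewrite (fock_norm_lt hp Ff e0) => If.
have := coef_bound hphi hp n Ff tf ler01; rewrite expr1n mulr1 => h.
have {}h : mod (u n) `^ p <= B * e `^ p.
  rewrite -lee_fin EFinM; apply: (le_trans h); apply: lee_wpmul2l; last exact: ltW.
  by rewrite lee_fin ltW.
apply: le_trans (powR_le_inv hp (mod_ge0 _) _ h) _.
  by rewrite mulr_ge0 ?powR_ge0// ltW.
by rewrite powRM ?(ltW B0) ?powR_ge0// powRV// ltW.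
Qed.

Lemma taylor_add (f g : C -> C^o) c u v : taylor_expansion f c u -> taylor_expansion g c v ->
  taylor_expansion (fun z => f z + g z) c (fun n => u n + v n).
Proof.
move=> tf tg; apply/taylorP => z.
apply: cconv_ext (cconvD ((taylorP _ _ _).1 tf z) ((taylorP _ _ _).1 tg z)) => k.
by rewrite mulrDl.
Qed.

Lemma taylor_sub (f g : C -> C^o) c u v : taylor_expansion f c u -> taylor_expansion g c v ->
  taylor_expansion (fun z => f z - g z) c (fun n => u n - v n).
Proof.
move=> tf tg; apply/taylorP => z.
apply: cconv_ext (cconvB ((taylorP _ _ _).1 tf z) ((taylorP _ _ _).1 tg z)) => k.
by rewrite mulrBl.
Qed.

Lemma taylor_scale (f : C -> C^o) c u l : taylor_expansion f c u ->
  taylor_expansion (fun z => l * f z) c (fun n => l * u n).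
Proof.
move=> tf; apply/taylorP => z.
by apply: cconv_ext (cconvZ l ((taylorP _ _ _).1 tf z)) => k; rewrite mulrA.
Qed.

Lemma taylor_zero c : taylor_expansion (fun=> 0 : C^o) c (fun=> 0).
Proof.
apply/taylorP => z e e0; exists 0%N => n _.
by rewrite big1 ?subrr ?mod0 ?ltW// => k _; rewrite mul0r.
Qed.

Lemma fock0 : F (fun=> 0 : C^o).
Proof.
by apply: fock_ext (poly_fock hphi hp 0 0) => z; rewrite horner0.
Qed.

(** This is [exp (z - c)], obtained from its series; it is the explicit vector used to exhibit
    cyclicity. *)
Lemma exp_like_exists (c : C) : exists h : C -> C^o, taylor_expansion h c (fun n => n`!%:R^-1).
Proof.
have H z : exists l, cconv (fun n => n`!%:R^-1 * (z - c) ^+ n) l.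
  have [|l Hl _] := @cconv_abs _ (fun n => n`!%:R^-1 * (z - c) ^+ n) (expR (mod (z - c))).
    move=> n; apply: le_trans (exp_partial_sum n (mod_ge0 _)).
    apply: ler_sum => k _; rewrite modM modV mod_nat modX mulrC.
    exact: lexx.
  by exists l.
have [h Hh] := choice H.
by exists h; apply/taylorP.
Qed.

Lemma exp_like_fock (h : C -> C^o) c : taylor_expansion h c (fun n => n`!%:R^-1) -> F h.
Proof.
move=> th; apply: (exp_type_fock hphi hp (A := 1) th) => n.
by rewrite modV mod_nat mul1r.
Qed.

Section Orbit.
Variables (a b z0 : C).
Hypothesis fixed : a * z0 + b = z0.
Local Notation T := (composition_operator (affine_map a b)).
Hypothesis FT : forall f : C -> C^o, F f -> F (T f).

Lemma iter_compE k (h : C -> C^o) : iter k T h = (fun z => h (a ^+ k * (z - z0) + z0)).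
Proof.
elim: k => [|k IH]; first by apply/funext => z; rewrite /= expr0 mul1r subrK.
rewrite iterS IH /composition_operator /affine_map; apply/funext => z /=.
congr h; rewrite exprSr -mulrA; congr (_ * _ + _).
by rewrite -{1}fixed; ring.
Qed.

Lemma iter_fock k (h : C -> C^o) : F h -> F (iter k T h).
Proof. by move=> Fh; elim: k => [//|k IH]; rewrite iterS; exact: FT. Qed.

Lemma iter_taylor k (h : C -> C^o) u : taylor_expansion h z0 u ->
  taylor_expansion (iter k T h) z0 (fun n => a ^+ (k * n) * u n).
Proof.
move=> th; rewrite iter_compE; apply/taylorP => z.
apply: cconv_ext ((taylorP _ _ _).1 th (a ^+ k * (z - z0) + z0)) => n.
by rewrite addrK exprMn exprM; ring.
Qed.

(** An element of the span multiplies each [u j] by an exponential sum in [j] that depends on [h]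
    only through the chosen combination; linear relations between coefficients are tested on these
    sums. *)
Lemma span_taylor (h s : C -> C^o) u : F h -> taylor_expansion h z0 u ->
  linear_span (orbit_of T h) s ->
  F s /\ exists n (c : 'I_n -> C) (k : 'I_n -> nat),
    taylor_expansion s z0 (fun j => (\sum_i c i * a ^+ (k i * j)) * u j).
Proof.
move=> Fh th [n [c [v [Hv ->]]]].
have /(_ _)/cid2-/all_sig2[k _ Hk] : forall i, exists2 k, True & iter k T h = v i.
  by move=> i; have [k _ <-] := Hv i; exists k.
split; last first.
  exists n, c, k; rewrite {Hv}.
  rewrite (_ : \sum_i c i *: v i = fun z => \sum_i c i * v i z); last first.
    by apply/funext => z; rewrite fct_sumE.
  have H : forall t : seq 'I_n, taylor_expansion (fun z => \sum_(i <- t) c i * v i z : C^o) z0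
      (fun j => (\sum_(i <- t) c i * a ^+ (k i * j)) * u j).
    elim=> [|i t IH].
      apply: taylor_ext (@taylor_zero z0) => j; first by rewrite big_nil.
      by rewrite big_nil mul0r.
    apply: taylor_ext (taylor_add (taylor_scale (l := c i) (@iter_taylor (k i) h u th)) IH) => j.
      by rewrite big_cons Hk.
    by rewrite big_cons mulrDl mulrA.
  exact: H.
rewrite (_ : \sum_i c i *: v i = fun z => \sum_i c i * v i z); last first.
  by apply/funext => z; rewrite fct_sumE.
have H : forall t : seq 'I_n, F (fun z => \sum_(i <- t) c i * v i z : C^o).
  elim=> [|i t IH].
    by apply: fock_ext fock0 => z; rewrite big_nil.
  apply: fock_ext (fockD hphi hp (fockZ hphi (c i) (iter_fock (k i) Fh)) IH) => z.
  by rewrite big_cons Hk.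
exact: H.
Qed.

(* The continuous functional [al * coef i + be * coef j] vanishes on the orbit of [h] but not at [y]. *)
Lemma functional_not_cyclic (h y : C -> C^o) u v i j (al be : C) : F h -> taylor_expansion h z0 u ->
  F y -> taylor_expansion y z0 v -> al * v i + be * v j != 0 ->
  (forall n (c : 'I_n -> C) (k : 'I_n -> nat),
    al * ((\sum_l c l * a ^+ (k l * i)) * u i) + be * ((\sum_l c l * a ^+ (k l * j)) * u j) = 0) ->
  ~ cyclic_vector F N T h.
Proof.
move=> Fh th Fy ty nz van [_ dense].
have [Ki Ki0 HKi] := coef_continuous z0 i; have [Kj Kj0 HKj] := coef_continuous z0 j.
pose B := mod al * Ki + mod be * Kj + 1.
have B0 : 0 < B by rewrite ltr_wpDl// addr_ge0// mulr_ge0 ?mod_ge0 ?ltW.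
pose e := mod (al * v i + be * v j) / (2 * B).
have m0 : 0 < mod (al * v i + be * v j) by rewrite mod_gt0.
have e0 : 0 < e by rewrite divr_gt0// mulr_gt0.
have [s [Fs /(span_taylor Fh th)[_ [n [c [k ts]]]]] Ns] := dense y e Fy e0.
have Fd : F (fun z => y z - s z) by exact: (fockB hphi hp Fy Fs).
have td := taylor_sub ty ts.
have hi := HKi _ _ _ Fd td e0 Ns; have hj := HKj _ _ _ Fd td e0 Ns.
have := van n c k; set si := _ * u i in hi *; set sj := _ * u j in hj * => E.
have : mod (al * v i + be * v j) <= B * e.
  have -> : al * v i + be * v j = al * (v i - si) + be * (v j - sj).
    by rewrite -[LHS]subr0 -E; ring.
  apply: le_trans (modD _ _) _; rewrite !modM /B !mulrDl -!mulrA.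
  apply: le_trans (_ : mod al * (Ki * e) + mod be * (Kj * e) <= _); last by rewrite lerDl mul1r ltW.
  by apply: lerD; rewrite ler_wpM2l ?mod_ge0.
have -> : B * e = mod (al * v i + be * v j) / 2 by rewrite /e; field; rewrite gt_eqF.
by lra.
Qed.

Lemma cyclic_coef_neq0 (h : C -> C^o) u n : F h -> taylor_expansion h z0 u ->
  cyclic_vector F N T h -> u n <> 0.
Proof.
move=> Fh th cyc un; move: cyc.
apply: (@functional_not_cyclic h _ u _ n n 1 0 Fh th (power_fock hphi hp z0 n) (@power_taylor R z0 n)).
  by rewrite eqxx mul0r mul1r addr0 oner_eq0.
by move=> m c k; rewrite un !mulr0 addr0.
Qed.

Lemma periodic_not_cyclic m : (0 < m)%N -> a ^+ m = 1 -> ~ is_cyclic F N T.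
Proof.
move=> m0 am [h cyc]; have [Fh _] := cyc.
have [u tu] := taylor_fock z0 Fh.
have E n (c : 'I_n -> C) (k : 'I_n -> nat) : \sum_l c l * a ^+ (k l * m) = \sum_l c l * a ^+ (k l * 0).
  by apply: eq_bigr => l _; rewrite mulnC exprM am expr1n muln0 expr0.
apply: (cyclic_coef_neq0 (n := 0) Fh tu cyc); apply/eqP/negPn/negP => u0.
move: cyc.
(* On [(z - z0) ^ m] the functional takes the value [- u 0], which has just been shown to be
   nonzero. *)
apply: (@functional_not_cyclic h _ u _ 0 m (u m) (- u 0%N) Fh tu (power_fock hphi hp z0 m) (@power_taylor R z0 m)).
  by rewrite eqxx ltn_eqF// mulr0 add0r mulr1 oppr_eq0.
by move=> n c k; rewrite E; ring.
Qed.

Lemma not_supercyclic : mod a <= 1 -> ~ is_supercyclic F N T.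
Proof.
move=> a1 [h [Fh dense]].
have [u tu] := taylor_fock z0 Fh.
have [K0 K00 HK0] := coef_continuous z0 0; have [K1 K10 HK1] := coef_continuous z0 1.
(* The target is [1 + B (z - z0)]. A multiple [l * T ^ k h] with both coefficients within 1/2 of it
   has [mod (l * u 0) <= 3/2], so its coefficient of index 1 is at most
   [3/2 * mod (u 1) / mod (u 0)], below [B - 1/2]. That [u 0 != 0] follows from the approximation
   itself. *)
pose B : R := 3 + 3 * mod (u 1%N) / mod (u 0%N).
have Fy : F (fun z => (z - z0) ^+ 0 + B%:C * (z - z0) ^+ 1 : C^o).
  exact: (fockD hphi hp (power_fock hphi hp z0 0) (fockZ hphi B%:C (power_fock hphi hp z0 1))).
have ty := taylor_add (@power_taylor R z0 0) (taylor_scale (l := B%:C) (@power_taylor R z0 1)).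
pose e := (2 * (K0 + K1))^-1; have e0 : 0 < e by rewrite invr_gt0 mulr_gt0// addr_gt0.
have [s [Fs [l [k sE]]] Ns] := dense _ e Fy e0.
have ts : taylor_expansion s z0 (fun n => l * (a ^+ (k * n) * u n)).
  by rewrite sE; exact: taylor_scale (@iter_taylor k h u tu).
have Fd : F (fun z => (z - z0) ^+ 0 + B%:C * (z - z0) ^+ 1 - s z) by exact: (fockB hphi hp Fy Fs).
have td := taylor_sub ty ts.
have h0 := HK0 _ _ _ Fd td e0 Ns; have h1 := HK1 _ _ _ Fd td e0 Ns.
rewrite /= muln0 expr0 mul1r mulr0 addr0 in h0.
rewrite /= muln1 mulr1 add0r in h1.
have K0e : K0 * e <= 2^-1.
  by rewrite /e invfM mulrCA ler_piMr ?invr_ge0// ler_pdivrMr ?addr_gt0// mul1r lerDl ltW.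
have K1e : K1 * e <= 2^-1.
  by rewrite /e invfM mulrCA ler_piMr ?invr_ge0// ler_pdivrMr ?addr_gt0// mul1r lerDr ltW.
have {}h0 := le_trans h0 K0e; have {}h1 := le_trans h1 K1e.
have lu0 : 2^-1 <= mod l * mod (u 0%N).
  by have := mod_dist 1 (l * u 0%N); rewrite mod1 modM; lra.
have lu1 : mod l * mod (u 0%N) <= 3 / 2.
  by have := mod_dist (l * u 0%N) 1; rewrite modBC mod1 modM; lra.
have u0 : 0 < mod (u 0%N).
  rewrite lt_def mod_ge0 andbT; apply/eqP => E; move: lu0; rewrite E mulr0; lra.
have ak : mod (a ^+ k) <= 1 by rewrite modX exprn_ile1// mod_ge0.
have h2 : mod (l * (a ^+ k * u 1%N)) <= mod l * mod (u 1%N).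
  by rewrite !modM ler_wpM2l ?mod_ge0// ler_piMl ?mod_ge0.
have h3 : B - 2^-1 <= mod l * mod (u 1%N).
  have := mod_dist B%:C (l * (a ^+ k * u 1%N)); rewrite mod_real ger0_norm; first by lra.
  by rewrite addr_ge0// divr_ge0 ?mulr_ge0 ?mod_ge0.
have h4 : mod l * mod (u 1%N) <= 3 / 2 * (mod (u 1%N) / mod (u 0%N)).
  rewrite mulrA ler_pdivlMr// mulrAC ler_wpM2r ?mod_ge0//.
have h5 : 0 <= mod (u 1%N) / mod (u 0%N) by rewrite divr_ge0 ?mod_ge0.
move: h3; rewrite /B -mulrA; lra.
Qed.

End Orbit.
End Dynamics.

(** * Closed span of an orbit *)

Section Closure.
Context {R : realType}.
Local Notation C := R[i].
Local Notation mod := (@Normc.normc R).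
Variables (phi : R -> R) (hphi : weight phi) (p : R) (hp : 1 <= p).
Local Notation I := (fock_integral phi p).
Local Notation F := (fock_space phi p).
Local Notation N := (fock_norm phi p).
Let p0 : 0 < p := p_gt0 hp.

Lemma ge0_mul_small (k e : R) : 0 <= k -> 0 < e -> exists2 d, 0 < d & k * d < e.
Proof.
move=> k0 e0; exists (e / (k + 1)); first by rewrite divr_gt0// ltr_wpDl.
by rewrite mulrCA gtr_pMr// ltr_pdivrMr ?mul1r ?ltrDl// ltr_wpDl.
Qed.

Lemma fock_integral_ext (f g : C -> C^o) : f =1 g -> I f = I g.
Proof. by move=> /funext ->. Qed.

Lemma fock_integral_small_D (f g : C -> C^o) (e : R) : F f -> F g -> 0 < e ->
  (I f < (e / 2 / 2 `^ p)%:E)%E -> (I g < (e / 2 / 2 `^ p)%:E)%E ->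
  (I (fun z => f z + g z)%R < e%:E)%E.
Proof.
move=> [ef _] [eg _] e0 hf hg.
have t0 : 0 < 2 `^ p :> R by rewrite powR_gt0.
apply: le_lt_trans (fock_integral_D hphi hp ef eg) _.
rewrite -(lte_pdivlMl _ _ t0); apply: lt_le_trans (lteD hf hg) _.
by rewrite -EFinD -EFinM lee_fin -mulrDl mulrC; lra.
Qed.

Section ClosureOf.
Variables (S : set (C -> C^o)).
Hypothesis SF : forall s, S s -> F s.
Hypothesis S0 : S (fun=> 0).
Hypothesis SD : forall f g, S f -> S g -> S (fun z => f z + g z).
Hypothesis SZ : forall c f, S f -> S (fun z => c * f z).

(** Closeness is measured by the integral, where limits and sums need only [fock_integral_small_D];
    the passage to the norm is made once, in [clos_norm_dense]. *)
Definition clos (y : C -> C^o) := F y /\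
  forall e : R, 0 < e -> exists2 s, S s & (I (fun z => y z - s z)%R < e%:E)%E.

Lemma fock_integral_zero : I (fun=> 0%R) = 0%E.
Proof.
have [e1 _] := fock1 hphi hp.
have := fock_integral_Z hphi p 0 e1; rewrite mod0 powR0 ?gt_eqF// mul0e => <-.
by apply: fock_integral_ext => z; rewrite mul0r.
Qed.

Lemma clos_in s : S s -> clos s.
Proof.
move=> Ss; split; first exact: SF.
move=> e e0; exists s; first exact: Ss.
rewrite (_ : (fun _ => _) = fun=> 0); last by apply/funext => z; rewrite subrr.
by rewrite fock_integral_zero lte_fin.
Qed.

Lemma clos_ext f g : f =1 g -> clos f -> clos g.
Proof. by move=> /funext ->. Qed.

Let half_gt0 (e : R) : 0 < e -> 0 < e / 2 / 2 `^ p.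
Proof. by move=> e0; rewrite !divr_gt0// powR_gt0. Qed.

Lemma clos_D f g : clos f -> clos g -> clos (fun z => f z + g z).
Proof.
move=> [Ff cf] [Fg cg]; split; first exact: (fockD hphi hp Ff Fg).
move=> e e0; have [s Ss hs] := cf _ (half_gt0 e0); have [t St ht] := cg _ (half_gt0 e0).
exists (fun z => s z + t z); first exact: SD.
have E z : f z - s z + (g z - t z) = f z + g z - (s z + t z) by rewrite opprD addrACA.
rewrite -(fock_integral_ext E).
exact: fock_integral_small_D (fockB hphi hp Ff (SF Ss)) (fockB hphi hp Fg (SF St)) e0 hs ht.
Qed.

Lemma clos_Z c f : clos f -> clos (fun z => c * f z).
Proof.
move=> [Ff cf]; split; first exact: (fockZ hphi c Ff).
move=> e e0; have [d d0 hd] := ge0_mul_small (powR_ge0 (mod c) p) e0.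
have [s Ss hs] := cf d d0; exists (fun z => c * s z); first exact: SZ.
have [efs _] := fockB hphi hp Ff (SF Ss).
rewrite (_ : (fun _ => _) = fun z => c * (f z - s z)); last first.
  by apply/funext => z; rewrite mulrBr.
rewrite (fock_integral_Z hphi p c efs); apply: le_lt_trans (_ : (mod c `^ p)%:E * d%:E < _)%E; last first.
  by rewrite -EFinM lte_fin.
by apply: lee_wpmul2l; [rewrite lee_fin powR_ge0|exact: ltW].
Qed.

Lemma clos_lim f : F f -> (forall e : R, 0 < e -> exists2 g, clos g & (I (fun z => f z - g z)%R < e%:E)%E) ->
  clos f.
Proof.
move=> Ff H; split; first exact: Ff.
move=> e e0; have [g [Fg cg] hg] := H _ (half_gt0 e0).
have [s Ss hs] := cg _ (half_gt0 e0); exists s; first exact: Ss.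
have E z : f z - g z + (g z - s z) = f z - s z by rewrite addrA subrK.
rewrite -(fock_integral_ext E).
exact: fock_integral_small_D (fockB hphi hp Ff Fg) (fockB hphi hp Fg (SF Ss)) e0 hg hs.
Qed.

Lemma clos_sum n (f : nat -> C -> C^o) : (forall k, (k < n)%N -> clos (f k)) ->
  clos (fun z => \sum_(0 <= k < n) f k z).
Proof.
elim: n => [|n IH] H; first by apply: clos_ext (clos_in S0) => z; rewrite big_geq.
apply: clos_ext (clos_D (IH _) (H n (ltnSn n))) => [z|k kn]; first by rewrite big_nat_recr.
by apply: H; exact: ltnW.
Qed.

Lemma clos_dense (z0 : C) : (forall m, clos (fun z => (z - z0) ^+ m)) -> forall f, F f -> clos f.
Proof.
move=> H f Ff; apply: (clos_lim Ff) => e e0.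
have [P HP] := poly_dense hphi hp z0 Ff e0; exists (fun z => P.[z - z0]); last exact: HP.
apply: clos_ext (@clos_sum (size P) (fun k z => P`_k * (z - z0) ^+ k) _) => [z|k _].
  by rewrite horner_coef big_mkord.
exact: clos_Z.
Qed.

Lemma clos_norm_dense : (forall f, F f -> clos f) -> norm_dense F N S.
Proof.
move=> H y e Fy e0; have [_ cy] := H y Fy.
have ep : 0 < e `^ p by rewrite powR_gt0.
have [s Ss hs] := cy _ ep; exists s; first by split; [exact: SF|].
have Fd := fockB hphi hp Fy (SF Ss).
by have := fock_norm_lt hp Fd e0; rewrite hs => /idP.
Qed.

End ClosureOf.

Section SpanClosure.
Variables (a b z0 : C).
Hypothesis fixed : a * z0 + b = z0.
Local Notation T := (composition_operator (affine_map a b)).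
Hypothesis FT : forall f : C -> C^o, F f -> F (T f).
Hypothesis a_neq0 : a != 0.
Variables (h : C -> C^o) (u : nat -> C).
Hypotheses (Fh : F h) (th : taylor_expansion h z0 u).
Local Notation S := (linear_span (orbit_of T h)).

Lemma span_fock s : S s -> F s.
Proof. by move=> Ss; have [] := span_taylor hphi hp fixed FT Fh th Ss. Qed.

Lemma span_zero : S (fun=> 0).
Proof.
by exists 0%N, (fun=> 0), (fun=> h); split=> [[]//|]; rewrite big_ord0.
Qed.

Lemma span_add f g : S f -> S g -> S (fun z => f z + g z).
Proof.
move=> [n [c [v [Hv ->]]]] [m [d [w [Hw ->]]]].
exists (n + m)%N, (fun i => match fintype.split i with inl j => c j | inr j => d j end),
  (fun i => match fintype.split i with inl j => v j | inr j => w j end); split.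
  by move=> i; case: (fintype.split i).
rewrite big_split_ord /=; congr (_ + _); apply: eq_bigr => i _.
  by rewrite (unsplitK (inl i)).
by rewrite (unsplitK (inr i)).
Qed.

Lemma span_scale l f : S f -> S (fun z => l * f z).
Proof.
move=> [n [c [v [Hv ->]]]]; exists n, (fun i => l * c i), v; split=> //.
rewrite -[LHS]/(l *: (\sum_(i < n) c i *: v i)) scaler_sumr.
by apply: eq_bigr => i _; rewrite scalerA.
Qed.

Lemma span_iter k : S (iter k T h).
Proof.
exists 1%N, (fun=> 1), (fun=> iter k T h); split; first by move=> _; exists k.
by rewrite big_ord1 scale1r.
Qed.

Local Notation SF := span_fock.
Local Notation S0 := span_zero.
Local Notation SD := span_add.
Local Notation SZ := span_scale.
Local Notation Siter := span_iter.
Local Notation cl := (clos S).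

(* [a ^- (k m) (T ^ k h - sum_(n < m) a ^ (k n) u n (z - z0) ^ n)] tends to [u m (z - z0) ^ m]. *)
Lemma contraction_power_closure m : mod a < 1 -> (forall n, u n <> 0) -> cl (fun z => (z - z0) ^+ m).
Proof.
(* Strong induction puts the subtracted lower powers already in the closed span. *)
move=> a1 un; elim/ltn_ind: m => m IH.
have um : u m != 0 by apply/eqP.
suff H : cl (fun z => u m * (z - z0) ^+ m).
  apply: clos_ext (clos_Z SF SZ (u m)^-1 H) => z.
  by rewrite mulrA mulVf// mul1r.
apply: (clos_lim SF); first exact: (fockZ hphi _ (power_fock hphi hp z0 m)).
move=> e e0.
have a0 : 0 < mod a by rewrite mod_gt0.
have [M M0 HM] := fock_dominated hphi hp Fh th (ltW a0) a1.
have [d d0 hd] := ge0_mul_small M0 e0.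
have dp : 0 < d `^ p^-1 * mod a ^+ m by rewrite mulr_gt0 ?powR_gt0 ?exprn_gt0.
have a01 : 0 <= mod a < 1 by rewrite mod_ge0.
have [k Hk] := expr_lt_eps 1 a01 dp.
pose q z := \sum_(0 <= n < m) (a ^+ (k.+1 * n) * u n) * (z - z0) ^+ n.
pose g z := a ^- (k.+1 * m) * (iter k.+1 T h z + -1 * q z).
exists g.
  apply: (clos_Z SF SZ); apply: (clos_D SF SD); first exact: (clos_in SF (Siter _)).
  apply: (clos_Z SF SZ); apply: (clos_sum SF S0 SD) => n nm.
  by apply: (clos_Z SF SZ); exact: IH.
(* The iterate is taken at [k.+1]: of the exponent [k.+1 * (n - m)], one copy of [n - m] provides
   the decay asked by [fock_dominated], and the remaining [k * (n - m) >= k] provides smallness. *)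
pose D n := if (n <= m)%N then 0 else - (a ^+ (k.+1 * (n - m)) * u n).
have tq : taylor_expansion q z0 (fun n => if (n < m)%N then a ^+ (k.+1 * n) * u n else 0).
  apply/taylorP => z.
  have -> : q z = \sum_(0 <= n < m) (if (n < m)%N then a ^+ (k.+1 * n) * u n else 0) * (z - z0) ^+ n.
    by apply: eq_big_nat => n /andP[_ nm]; rewrite nm.
  by apply: cconv_finite => n mn; rewrite ltnNge mn mul0r.
have tg := taylor_scale (l := a ^- (k.+1 * m)) (taylor_add (@iter_taylor _ a b z0 fixed k.+1 h u th) (taylor_scale (l := -1) tq)).
have td := taylor_sub (taylor_scale (l := u m) (@power_taylor _ z0 m)) tg.
have {}td : taylor_expansion (fun z => u m * (z - z0) ^+ m - g z) z0 D.
  apply: taylor_ext td => n; first by [].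
  rewrite /D; case: ltngtP => nm.
  - by rewrite mulr0 sub0r mulN1r subrr mulr0 oppr0.
  - rewrite mulr0 sub0r mulr0 addr0 mulrA; congr (- (_ * _)).
    have -> : (k.+1 * n = k.+1 * m + k.+1 * (n - m))%N by rewrite -mulnDr subnKC// ltnW.
    by rewrite exprD mulrA mulVf ?mul1r// expf_neq0.
  - by rewrite nm mulr0 addr0 mulr1 mulrA mulVf ?expf_neq0// mul1r subrr.
(* Division by [mod a ^ m] compensates for decay measured by [mod a ^ n] instead of
   [mod a ^ (n - m)]. *)
have e1 : 0 <= mod a ^+ k / mod a ^+ m by rewrite divr_ge0 ?exprn_ge0 ?mod_ge0.
apply: le_lt_trans (HM _ _ _ e1 td _) _ => [n|]; last first.
  rewrite lte_fin; apply: le_lt_trans hd; apply: ler_wpM2l => //.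
  have := Hk k (leqnn k); rewrite mul1r => hk.
  have {}hk : mod a ^+ k / mod a ^+ m <= d `^ p^-1 by rewrite ler_pdivrMr ?exprn_gt0.
  apply: le_trans (ge0_ler_powR (ltW p0) _ _ hk) _; rewrite ?nnegrE ?powR_ge0//.
  by rewrite -powRrM mulVf ?gt_eqF// powRr1// ltW.
rewrite /D; case: leqP => mn; first by rewrite mod0; apply: mulr_ge0 e1 _; rewrite mulr_ge0 ?exprn_ge0 ?mod_ge0.
rewrite modN modM modX mulrA ler_wpM2r ?mod_ge0// mulSn exprD.
have -> : mod a ^+ k / mod a ^+ m * mod a ^+ n = mod a ^+ (n - m) * mod a ^+ k.
  rewrite -[in LHS](subnKC (ltnW mn)) exprD; field.
  by rewrite expf_neq0// gt_eqF.
rewrite ler_wpM2l ?exprn_ge0 ?mod_ge0//.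
by rewrite ler_wiXn2l ?mod_ge0 ?(ltW a1)// -[leqLHS]muln1 leq_mul2l subn_gt0 mn orbT.
Qed.

End SpanClosure.
End Closure.

(** * Convergence of averages along a rotation *)

Section Rotation.
Context {R : realType}.
Local Notation C := R[i].
Local Notation mod := (@Normc.normc R).
Variables (phi : R -> R) (hphi : weight phi) (p : R) (hp : 1 <= p).
Local Notation I := (fock_integral phi p).
Local Notation F := (fock_space phi p).
Let p0 : 0 < p := p_gt0 hp.

Lemma fock_integral_rotation_average (f : C -> C^o) u al m n : mod al = 1 -> taylor_expansion f 0 u ->
  (I (rotation_average al m n f) <= I f)%E.
Proof.
move=> al1 tf.
exact: (rotation_average_le (mesW hphi p) (fun z => ltW (expR_gt0 _)) (weight_factor_rot phi p) hp al1 m n tf).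
Qed.

Lemma rotation_average_taylor (f : C -> C^o) u al m n : taylor_expansion f 0 u ->
  taylor_expansion (rotation_average al m n f) 0 (fun k => average_coef al m n k * u k).
Proof.
move=> tf; apply/taylorP => z.
have cf y : cconv (fun k => u k * y ^+ k) (f y).
  by move/taylorP : tf => /(_ y); rewrite subr0.
by apply: cconv_ext (rotation_average_cconv al m n cf z) => k; rewrite subr0 mulrA.
Qed.

Lemma fock_rotation_average (f : C -> C^o) u al m n : mod al = 1 -> F f -> taylor_expansion f 0 u ->
  F (rotation_average al m n f).
Proof.
move=> al1 [_ If] tf; split; first exact: taylor_entire (@rotation_average_taylor f u al m n tf).
exact: le_lt_trans (fock_integral_rotation_average m n al1 tf) If.
Qed.

Lemma rotation_averageB al m n (f g : C -> C^o) z :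
  rotation_average al m n (fun z => f z - g z) z =
    rotation_average al m n f z - rotation_average al m n g z.
Proof.
rewrite /rotation_average -mulrBr -sumrB; congr (_ * _).
by apply: eq_bigr => j _; rewrite mulrBr.
Qed.

(** At [k <> m] the multiplier is a geometric mean of ratio [x <> 1], at most
    [2 / (n.+1 * mod (x - 1))]; the sum of the bounds [B k] over [k < s] gives one [n] for all these
    indices. *)
Lemma average_coef_small (a : C) m (s : nat) (d : R) : mod a = 1 ->
  (forall k, k <> m -> a ^+ k <> a ^+ m) -> 0 < d ->
  exists n, forall k, (k < s)%N -> mod ((k == m)%:R - average_coef a m n k) <= d.
Proof.
move=> a1 inj d0.
have a0 : a != 0 by rewrite -mod_eq0 a1 oner_eq0.
pose B k := 2 / mod ((a ^+ m)^-1 * a ^+ k - 1).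
have B0 k : 0 <= B k by rewrite divr_ge0 ?mod_ge0.
pose S := \sum_(k < s) B k.
exists (Num.truncn (S / d)) => k ks; set n := Num.truncn _.
have [->|km] := eqVneq k m; first by rewrite average_coef_diag// subrr mod0 ltW.
set x := (a ^+ m)^-1 * a ^+ k.
have x1 : x - 1 != 0.
  rewrite subr_eq0; apply/eqP => /(congr1 (fun y => a ^+ m * y)).
  by rewrite mulr1 mulVKf ?expf_neq0//; apply: inj; exact/eqP.
have mx : mod x = 1 by rewrite modM modV !modX a1 !expr1n invr1 mul1r.
rewrite sub0r modN.
have -> : average_coef a m n k = (x - 1)^-1 * (n.+1%:R^-1 * (x ^+ n.+1 - 1)).
  by rewrite -average_coef_geom mulKf.
rewrite !modM !modV mod_nat.
have h : mod (x ^+ n.+1 - 1) <= 2.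
  by apply: le_trans (modB _ _) _; rewrite modX mx expr1n mod1.
have Sk : B k <= S by rewrite /S (bigD1 (Ordinal ks))//= lerDl sumr_ge0.
have nS : S / d <= n.+1%:R by apply: ltW; exact: truncnS_gt.
have n0 : 0 < n.+1%:R :> R by rewrite ltr0n.
apply: (@le_trans _ _ (n.+1%:R^-1 * B k)).
  rewrite /B mulrCA ler_wpM2l ?invr_ge0// mulrC ler_wpM2r ?invr_ge0 ?mod_ge0//.
rewrite mulrC ler_pdivrMr//; apply: (le_trans Sk).
by rewrite mulrC -ler_pdivrMr.
Qed.

(* [P] is compared with the polynomial with coefficients [2 ^ k P_k], whose dilation it is. *)
Lemma poly_average_small (P : {poly C}) (a : C) m (e : R) : mod a = 1 ->
  (forall k, k <> m -> a ^+ k <> a ^+ m) -> 0 < e ->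
  exists n, (I (fun z => P`_m * z ^+ m - rotation_average a m n (fun z => P.[z - 0]) z)%R < e%:E)%E.
Proof.
move=> a1 inj e0.
pose Q : {poly C} := \poly_(k < size P) (2%:R ^+ k * P`_k).
have h2 : 2^-1 < 1 :> R by lra.
have h20 : 0 <= 2^-1 :> R by lra.
have [M M0 HM] := fock_dominated hphi hp (poly_fock hphi hp Q 0) (@poly_taylor _ Q 0) h20 h2.
have [d d0 hd] := ge0_mul_small M0 e0.
have dp : 0 < d `^ p^-1 by rewrite powR_gt0.
have [n Hn] := average_coef_small (size P) a1 inj dp.
exists n.
have tP := @poly_taylor _ P 0.
have tA := @rotation_average_taylor _ _ a m n tP.
have tm := taylor_scale (l := P`_m) (@power_taylor _ 0 m).
have td := taylor_sub tm tA.
have td' : taylor_expansion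
    (fun z => P`_m * z ^+ m - rotation_average a m n (fun z => P.[z - 0]) z : C^o) 0
    (fun k => ((k == m)%:R - average_coef a m n k) * P`_k).
  apply: taylor_ext td => [z|k]; first by rewrite subr0.
  rewrite mulrBl; congr (_ - _); case: eqVneq => [->|_]; first by rewrite mulr1 mul1r.
  by rewrite mulr0 mul0r.
apply: le_lt_trans (HM _ _ _ (ltW dp) td' _) _ => [k|]; last first.
  by rewrite lte_fin -powRrM mulVf ?gt_eqF// powRr1// ltW.
have [kP|Pk] := ltnP k (size P); last first.
  rewrite nth_default// mulr0 mod0; apply: mulr_ge0; first exact: ltW.
  by rewrite mulr_ge0 ?mod_ge0 ?exprn_ge0.
rewrite coef_poly kP modM modM modX mod_nat.
rewrite [2^-1 ^+ k * _]mulrA -exprMn mulVf ?pnatr_eq0// expr1n mul1r.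
by rewrite ler_wpM2r ?mod_ge0//; exact: Hn.
Qed.

(** For a polynomial [P] near [h], the errors are the average of [h - P], the monomial
    [(u m - P_m) z ^ m], and the defect of [P] itself. The first two are bounded by [h - P]
    uniformly in [n], so [P] can be fixed before [n]. *)
Lemma average_monomial_close (h : C -> C^o) u (a : C) m (e : R) : F h -> taylor_expansion h 0 u ->
  mod a = 1 -> (forall k, k <> m -> a ^+ k <> a ^+ m) -> 0 < e ->
  exists n, (I (fun z => u m * z ^+ m - rotation_average a m n h z)%R < e%:E)%E.
Proof.
move=> Fh th a1 inj e0.
have t0 : 0 < 2 `^ p :> R by rewrite powR_gt0.
(* Three errors are added in two applications of [fock_integral_small_D], hence two levels of
   tolerance. *)
pose e1 := e / 2 / 2 `^ p; have e10 : 0 < e1 by rewrite !divr_gt0.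
pose e2 := e1 / 2 / 2 `^ p; have e20 : 0 < e2 by rewrite !divr_gt0.
have e3 : 0 < Num.min e1 e2 by rewrite lt_min e10.
have [P HP] := poly_dense hphi hp 0 Fh e3.
have [n Hn] := poly_average_small P a1 inj e20.
exists n.
have FP := poly_fock hphi hp P 0; have tP := @poly_taylor _ P 0.
have Fg := fockB hphi hp Fh FP; have tg := taylor_sub th tP.
have h1 : (I (fun z => h z - P.[z - 0])%R < e1%:E)%E.
  by apply: lt_le_trans HP _; rewrite lee_fin ge_min lexx.
have h2 : (I (fun z => h z - P.[z - 0])%R < e2%:E)%E.
  by apply: lt_le_trans HP _; rewrite lee_fin ge_min lexx orbT.
have FAg := fock_rotation_average m n a1 Fg tg.
have FAP := fock_rotation_average m n a1 FP tP.
have Fz c : F (fun z => c * z ^+ m : C^o).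
  by apply: fock_ext (fockZ hphi c (power_fock hphi hp 0 m)) => z; rewrite subr0.
have k1 : (I (fun z => -1 * rotation_average a m n (fun z => h z - P.[z - 0]) z)%R < e1%:E)%E.
  rewrite (fock_integral_Z hphi p (-1) FAg.1) modN mod1 powR1 mul1e.
  exact: le_lt_trans (fock_integral_rotation_average m n a1 tg) h1.
have k2 : (I (fun z => (u m - P`_m) * z ^+ m)%R < e2%:E)%E.
  exact: le_lt_trans (fock_integral_coef_projection hphi hp m tg) h2.
have FD := fockB hphi hp (Fz P`_m) FAP.
have k3 := fock_integral_small_D hphi hp (Fz (u m - P`_m)) FD e10 k2 Hn.
have E z : -1 * rotation_average a m n (fun z => h z - P.[z - 0]) z +
    ((u m - P`_m) * z ^+ m + (P`_m * z ^+ m - rotation_average a m n (fun z => P.[z - 0]) z)) =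
    u m * z ^+ m - rotation_average a m n h z.
  by rewrite (@rotation_averageB a m n h (fun z => P.[z - 0])); ring.
rewrite -(fock_integral_ext phi p E).
exact: (fock_integral_small_D hphi hp (fockZ hphi (-1) FAg) (fockD hphi hp (Fz (u m - P`_m)) FD) e0 k1 k3).
Qed.

End Rotation.

(** * Cyclicity of vectors with nonzero coefficients *)

Section Sufficiency.
Context {R : realType}.
Local Notation C := R[i].
Local Notation mod := (@Normc.normc R).
Variables (phi : R -> R) (hphi : weight phi) (p : R) (hp : 1 <= p).
Local Notation F := (fock_space phi p).
Local Notation N := (fock_norm phi p).

Lemma rotation_power_closure (a : C) (h : C -> C^o) u m :
  (forall f : C -> C^o, F f -> F (composition_operator (affine_map a 0) f)) ->
  F h -> taylor_expansion h 0 u -> mod a = 1 ->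
  (forall k, k <> m -> a ^+ k <> a ^+ m) -> u m <> 0 ->
  clos phi p (linear_span (orbit_of (composition_operator (affine_map a 0)) h)) (fun z => (z - 0) ^+ m).
Proof.
move=> FT Fh th a1 inj /eqP um.
have fixed : a * 0 + 0 = 0 :> C by rewrite mulr0 addr0.
have SF := span_fock hphi hp fixed FT Fh th.
have SD := @span_add R a 0 h; have SZ := @span_scale R a 0 h.
have S0 := @span_zero R a 0 h; have SI := @span_iter R a 0 h.
suff H : clos phi p (linear_span (orbit_of (composition_operator (affine_map a 0)) h))
    (fun z => u m * z ^+ m).
  apply: clos_ext (clos_Z hphi hp SF SZ (u m)^-1 H) => z.
  by rewrite mulrA mulVf// mul1r subr0.
apply: (clos_lim hphi hp SF).
  by apply: fock_ext (fockZ hphi (u m) (power_fock hphi hp 0 m)) => z; rewrite subr0.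
move=> e e0; have [n Hn] := average_monomial_close hphi hp Fh th a1 inj e0.
exists (rotation_average a m n h); last exact: Hn.
apply: clos_ext (clos_Z hphi hp SF SZ n.+1%:R^-1 (clos_sum hphi hp SF S0 SD (n := n.+1)
  (f := fun j z => (a ^+ (j * m))^-1 * iter j (composition_operator (affine_map a 0)) h z) _)) => [z|j _].
  rewrite /rotation_average; congr (_ * _); apply: eq_bigr => j _.
  by rewrite (iter_compE fixed) subr0 addr0.
exact: (clos_Z hphi hp SF SZ _ (clos_in hphi hp SF (SI j))).
Qed.

(** A coincidence [a ^ i = a ^ j] with [i < j] gives [a ^ (j - i) = 1], hence [a ^ (j - i).+1 = a]
    with exponent above 1. *)
Lemma rotation_free_pow (a : C) m k : a != 0 -> (forall n, (1 < n)%N -> a ^+ n <> a) ->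
  k <> m -> a ^+ k <> a ^+ m.
Proof.
move=> a0 an.
have H i j : (i < j)%N -> a ^+ i <> a ^+ j.
  move=> ij E; apply: (an (j - i).+1); first by rewrite ltnS subn_gt0.
  have : a ^+ i * a ^+ (j - i) = a ^+ i * 1 by rewrite -exprD subnKC ?mulr1 ?E// ltnW.
  by move/mulfI => E'; rewrite exprS E' ?mulr1// expf_neq0.
move=> /eqP; rewrite neq_ltn => /orP[/H//|/H E F]; exact: E.
Qed.

Section Affine.
Variables (a b : C).
Hypothesis nonconst : ~ exists c, forall z, affine_map a b z = c.
Local Notation T := (composition_operator (affine_map a b)).
Hypothesis Tb : bounded_on F N T.
Local Notation z0 := (b / (1 - a)).

Lemma nonconst_neq0 : a != 0.
Proof. by apply/eqP => a0; apply: nonconst; exists b => z; rewrite /affine_map a0 mul0r add0r. Qed.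

(** For [a = 1] boundedness forces [b = 0]; then [z0] is 0 by the convention on division and the map
    is the identity. *)
Lemma affine_fixed : a * z0 + b = z0.
Proof.
have [a1|a1] := eqVneq a 1.
  by rewrite (affine_bounded_rotation hphi hp Tb) ?a1 ?mod1// mul0r mulr0 addr0.
have {}a1 : 1 - a != 0 by rewrite subr_eq0 eq_sym.
by field.
Qed.

Lemma cyclic_of_coef_neq0 (h : C -> C^o) u : (forall n, (1 < n)%N -> a ^+ n <> a) ->
  F h -> taylor_expansion h z0 u -> (forall n, u n <> 0) -> cyclic_vector F N T h.
Proof.
move=> an Fh th un; split; first exact: Fh.
have a0 := nonconst_neq0; have [FT _] := Tb.
have SF := span_fock hphi hp affine_fixed FT Fh th.
have SD := @span_add R a b h; have SZ := @span_scale R a b h.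
have S0 := @span_zero R a b h.
apply: (clos_norm_dense hphi hp SF); apply: (clos_dense hphi hp SF S0 SD SZ (z0 := z0)) => m.
have := affine_bounded_mod_le1 hphi hp Tb; rewrite le_eqVlt => /orP[/eqP a1|a1]; last first.
  exact: (contraction_power_closure hphi hp affine_fixed FT a0 Fh th m a1 un).
have b0 := affine_bounded_rotation hphi hp Tb a1.
have z00 : z0 = 0 by rewrite b0 mul0r.
rewrite z00 in th *; rewrite b0 in FT *.
by apply: (rotation_power_closure FT Fh th a1 _ (un m)) => k; exact: rotation_free_pow.
Qed.

End Affine.
End Sufficiency.

Theorem theorem2p5 (R : realType) (phi : R -> R) (hphi : weight phi)
  (p : R) (hp : 1 <= p) (a b : R[i])
  (hnonconst : ~ exists c, forall z, affine_map a b z = c)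
  (hbounded : bounded_on (fock_space phi p) (fock_norm phi p)
                (composition_operator (affine_map a b))) :
  let F := fock_space phi p in
  let N := fock_norm phi p in
  let T := composition_operator (affine_map a b) in
  [/\ is_cyclic F N T <-> (forall n : nat, (1 < n)%N -> a ^+ n <> a),
      (forall n : nat, (1 < n)%N -> a ^+ n <> a) ->
        forall (h : R[i] -> R[i]^o) (u : nat -> R[i]),
          F h -> taylor_expansion h (b / (1 - a)) u ->
          (cyclic_vector F N T h <-> forall n : nat, u n <> 0) &
      ~ is_supercyclic F N T].
Proof.
move=> F N T; have fixed := affine_fixed hphi hp hbounded; have [FT _] := hbounded.
have a0 := nonconst_neq0 hnonconst.
split.
- split=> [cyc n n1 an|an].
    (* Since [a != 0], the relation [a ^ n = a] is [a ^ n.-1 = 1], with [n.-1 > 0]. *)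
    apply: (periodic_not_cyclic hphi hp fixed FT (m := n.-1) _ _ cyc).
      by rewrite -ltnS prednK// ltnW.
    by apply: (mulfI a0); rewrite mulr1 -exprS prednK// ltnW.
  have [h th] := exp_like_exists (b / (1 - a)); exists h.
  apply: (cyclic_of_coef_neq0 hphi hp hnonconst hbounded an _ th).
    exact: (exp_like_fock hphi hp th).
  by move=> n; apply/eqP; rewrite invr_eq0 pnatr_eq0 -lt0n fact_gt0.
- move=> an h u Fh th; split=> [cyc n|un].
    exact: (cyclic_coef_neq0 hphi hp fixed FT Fh th cyc).
  exact: (cyclic_of_coef_neq0 hphi hp hnonconst hbounded an Fh th un).
exact: (not_supercyclic hphi hp fixed (affine_bounded_mod_le1 hphi hp hbounded)).
Qed.
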